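(* Let $s\in\mathbb{N}$, $\alpha\in\mathbb{N}_0$, $0<\lambda\le1$, and let $f\in C([0,1]^s)$ satisfy $\|f\|_{\alpha,\lambda}<\infty$ (in the sense defined in the context). Let $\mu=\int_{[0,1]^s}f(\boldsymbol{x})\,d\boldsymbol{x}$. For each $m\in\mathbb{N}$ put $n=2^m$, let $r=r_m\ge m$ be an integer, and let $\hat\mu^{(r)}_\infty$ be the sample median of $2r-1$ independently generated copies of the randomized digital net estimator $\hat\mu_\infty$ (with $2^m$ points), where the randomization is asymptotically full-rank. Then for every $\epsilon>0$, as $m\to\infty$, $$\mathbb{E}\big((\hat\mu^{(r)}_\infty-\mu)^2\big)=O\big(n^{-2\alpha-2\lambda-1+\epsilon}\big).$$
   Context: Notation: $\mathbb{N}=\{1,2,\dots\}$, $\mathbb{N}_0=\mathbb{N}\cup\{0\}$, $\mathbb{N}_*^s=\mathbb{N}_0^s\setminus\{\boldsymbol{0}\}$, $\mathbb{Z}_{\le\alpha}=\{0,1,\dots,\alpha\}$, $1{:}s=\{1,\dots,s\}$. For positive sequences, $a_m=O(b_m)$ means there is $C<\infty$ with $a_m\le Cb_m$ for all but finitely many $m$. Randomized digital nets. For $i\in\{0,\dots,2^m-1\}$ with $i=\sum_{\ell=1}^m i_\ell2^{\ell-1}$ write $\vec{i}=(i_1,\dots,i_m)^{\mathsf T}\in\{0,1\}^m$. For $k=\sum_{\ell\ge1}a_\ell2^{\ell-1}\in\mathbb{N}_0$ write $\vec{k}=(a_1,a_2,\dots)^{\mathsf T}$ (finitely many nonzero entries).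 For each $m$ let $C_1,\dots,C_s\in\{0,1\}^{\infty\times m}$ be random matrices, and let $\vec D_1,\dots,\vec D_s\in\{0,1\}^\infty$ be random vectors all of whose entries are independent and uniform on $\{0,1\}$, independent of $(C_1,\dots,C_s)$. The points $\boldsymbol{x}_i=(x_{i1},\dots,x_{is})\in[0,1]^s$ are given by $x_{ij}=\sum_{\ell\ge1}(\vec x_{ij})_\ell2^{-\ell}$ with $\vec x_{ij}=C_j\vec i+\vec D_j \bmod 2$, and $\hat\mu_\infty=2^{-m}\sum_{i=0}^{2^m-1}f(\boldsymbol{x}_i)$. For $\boldsymbol{k}\in\mathbb{N}_*^s$ let $Z(\boldsymbol{k})$ be the indicator of the event $\sum_{j=1}^s\vec k_j^{\mathsf T}C_j=\boldsymbol{0}\bmod 2$. The randomization is asymptotically full-rank if there is a constant $R$ independent of $m$ and $\boldsymbol{k}$ such that $\Pr(Z(\boldsymbol{k})=1)\le2^{-m+R}$ for all $m\in\mathbb{N}$, $\boldsymbol{k}\in\mathbb{N}_*^s$. Fractional Sobolev space. For $0<\lambda\le1$ and $p>\lambda^{-1}$, $f\in\mathcal H_{\lambda,s,p}$ means there exist $D^\lambda_uf\in L^p([0,1]^{|u|})$, $u\subseteq1{:}s$ (with $D^\lambda_\varnothing f\in\mathbb{R}$), such that $$f(\boldsymbol x)=\sum_{u\subseteq1{:}s}\Gamma(\lambda)^{-|u|}\int_{[0,1]^{|u|}}D^\lambda_uf(\boldsymbol t_u)\prod_{j\in u}(x_j-t_j)_+^{\lambda-1}\,d\boldsymbol t_u,$$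 where $(x-t)_+=\max(x-t,0)$ (so that $(x-t)_+^{\lambda-1}$ is $0$ for $t>x$, also when $\lambda=1$), $\boldsymbol t_u=(t_j)_{j\in u}$, and the $u=\varnothing$ term is the constant $D^\lambda_\varnothing f$. The $D^\lambda_uf$ are unique up to a.e. equality. For $p\ge2$, $\|f\|_{\lambda,s}=\big(\sum_{u\subseteq1{:}s}\|D^\lambda_uf\|^2_{L^2([0,1]^{|u|})}\big)^{1/2}$ (with $\|D^\lambda_\varnothing f\|=|D^\lambda_\varnothing f|$). With $f^{(\boldsymbol\alpha)}=\partial^{\alpha_1+\cdots+\alpha_s}f/\partial x_1^{\alpha_1}\cdots\partial x_s^{\alpha_s}$, $f^{(\boldsymbol 0)}=f$, put $\|f\|_{\alpha,\lambda}=\big(\sum_{\boldsymbol\alpha\in\mathbb{Z}_{\le\alpha}^s}\|f^{(\boldsymbol\alpha)}\|_{\lambda,s}^2\big)^{1/2}$. The statement $\|f\|_{\alpha,\lambda}<\infty$ means that all $f^{(\boldsymbol\alpha)}$, $\boldsymbol\alpha\in\mathbb{Z}_{\le\alpha}^s$, exist and belong to $\mathcal H_{\lambda,s,p}$ for some $p\ge2$ with $p>\lambda^{-1}$, and this quantity is finite. *)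

(* Defs.v *)
From HB Require Import structures.
From mathcomp Require Import all_boot all_order all_algebra.
From mathcomp Require Import finmap.
From mathcomp Require Import all_classical all_reals all_analysis.

Set Implicit Arguments.
Unset Strict Implicit.
Unset Printing Implicit Defensive.

Import Order.TTheory GRing.Theory Num.Theory.
Import numFieldNormedType.Exports.

Local Open Scope classical_set_scope.
Local Open Scope ring_scope.

(* Points of [0,1]^s are row vectors, which carry the topology; integrals are
   taken over tuples, which carry the product sigma-algebra. *)

Section cube.
Variable R : realType.

Definition unit_cube (s : nat) : set 'rV[R]_s :=
  [set x | forall j, 0 <= x ord0 j <= 1].

Definition row_of_tuple (n : nat) (t : n.-tuple R) : 'rV[R]_n :=
  \row_j tnth t j.

End cube.

Section prob_power.
Context d (T : measurableType d) (R : realType).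

Definition cons_tuple n (x : T * n.-tuple T) : n.+1.-tuple T :=
  [tuple of x.1 :: x.2].

Lemma measurable_cons_tuple n : measurable_fun setT (@cons_tuple n).
Proof. by apply: measurable_cons; [exact: measurable_fst | exact: measurable_snd]. Qed.

HB.instance Definition _ n :=
  isMeasurableFun.Build _ _ _ _ (@cons_tuple n) (@measurable_cons_tuple n).

(* The n-fold product P \x ... \x P on n-tuples; for n = 0 it is the unit mass
   at the empty tuple. *)
Fixpoint prob_power (P : probability T R) n : probability (n.-tuple T) R :=
  match n with
  | 0 => dirac [tuple]
  | n'.+1 => distribution (P \x prob_power P n')%E (@cons_tuple n')
  end.

End prob_power.

(* Lebesgue measure of [0,1]^n, extended by 0 outside of the cube: uniform_prob
   ltr01 is the Lebesgue measure of [0,1] seen as a measure on R. *)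
Definition cube_measure (R : realType) (n : nat) :
    probability (n.-tuple (measurableTypeR R)) R :=
  prob_power (uniform_prob (@ltr01 R)) n.

Definition cube_integral (R : realType) (s : nat) (f : 'rV[R]_s -> R) : R :=
  \int[cube_measure R s]_(t in [set t | unit_cube (row_of_tuple t)])
    f (row_of_tuple t).

Section partial_derivatives.
Context (R : realType) (s : nat).
Implicit Types (f : 'rV[R]_s -> R) (x : 'rV[R]_s) (j : 'I_s) (a : 'I_s -> nat).

(* The increments h are restricted to those keeping x + h e_j in the cube, so
   that the derivatives are one-sided on the faces of the cube and do not depend
   on the values of f outside of it. *)
Definition increments x j : set_system R :=
  within [set h | unit_cube (x + h *: delta_mx ord0 j)] 0^'.

Definition diff_quotient f x j (h : R) : R :=
  (f (x + h *: delta_mx ord0 j) - f x) / h.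

Definition partial j f : 'rV[R]_s -> R :=
  fun x => lim (diff_quotient f x j h @[h --> increments x j]).

Definition partial_exists j f : Prop :=
  forall x, unit_cube x -> cvg (diff_quotient f x j h @[h --> increments x j]).

Definition mixed_seq (js : seq 'I_s) a f : 'rV[R]_s -> R :=
  foldr (fun j g => iter (a j) (partial j) g) f js.

Fixpoint mixed_seq_exists (js : seq 'I_s) a f : Prop :=
  match js with
  | [::] => True
  | j :: js' => mixed_seq_exists js' a f /\
      forall k, (k < a j)%N ->
        partial_exists j (iter k (partial j) (mixed_seq js' a f))
  end.

(* The operators act in the order of the symbol d^|a| / dx_1^a_1 ... dx_s^a_s:
   the derivatives in the last variable are taken first. *)
Definition mixed a f : 'rV[R]_s -> R := mixed_seq (enum 'I_s) a f.

Definition mixed_exists a f : Prop := mixed_seq_exists (enum 'I_s) a f.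

End partial_derivatives.

Section fractional_sobolev.
Context (R : realType) (s : nat).
Implicit Types (lambda p : R) (f : 'rV[R]_s -> R).

Definition Gamma lambda : R :=
  \int[lebesgue_measure]_(t in `]0, +oo[) (t `^ (lambda - 1) * expR (- t)).

(* (x - t)_+^(lambda - 1); the case split is needed because 0 `^ 0 = 1. *)
Definition frac_kernel lambda (x t : R) : R :=
  if t < x then (x - t) `^ (lambda - 1) else 0.

(* A family D_u indexed by the sets u of variables; the coordinate i of the
   argument of D_u corresponds to the variable enum_val i, the i-th element
   of u. *)
Definition frac_family := forall u : {set 'I_s}, #|u|.-tuple (measurableTypeR R) -> R.

Definition frac_integral lambda (D : frac_family) (x : 'rV[R]_s) : R :=
  \sum_(u : {set 'I_s}) Gamma lambda ^- #|u| *
    \int[cube_measure R #|u|]_t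
      (D u t * \prod_(i < #|u|) frac_kernel lambda (x ord0 (enum_val i)) (tnth t i)).

Definition is_frac_derivative lambda p f (D : frac_family) : Prop :=
  (forall u : {set 'I_s}, D u \in Lfun (cube_measure R #|u|) p%:E) /\
  (forall x, unit_cube x -> f x = frac_integral lambda D x).

Definition in_frac_sobolev lambda p f : Prop :=
  exists D, is_frac_derivative lambda p f D.

(* The fractional derivatives of f are unique up to a.e. equality, so that
   frac_norm does not depend on the choice made here. *)
Definition frac_derivative lambda p f : frac_family :=
  if pselect (in_frac_sobolev lambda p f) is left e then projT1 (cid e)
  else fun _ _ => 0.
Arguments frac_derivative : clear implicits.

Definition frac_norm lambda p f : \bar R :=
  ((\sum_(u : {set 'I_s})
     'N[cube_measure R #|u|]_2%:E [EFin \o frac_derivative lambda p f u] ^+ 2)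
   `^ 2^-1)%E.

Definition sobolev_norm (alpha : nat) lambda p f : \bar R :=
  ((\sum_(a : {ffun 'I_s -> 'I_alpha.+1})
     frac_norm lambda p (mixed (fun j => a j) f) ^+ 2) `^ 2^-1)%E.

Definition finite_sobolev_norm (alpha : nat) lambda f : Prop :=
  exists p, [/\ 2 <= p, lambda^-1 < p,
    (forall a : {ffun 'I_s -> 'I_alpha.+1},
      mixed_exists (fun j => a j) f /\
      in_frac_sobolev lambda p (mixed (fun j => a j) f)) &
    (sobolev_norm alpha lambda p f < +oo)%E].

End fractional_sobolev.

Section independence.
Context d (T : measurableType d) (R : realType) (P : probability T R).

Definition mutually_independent d' (T' : measurableType d') (I : choiceType)
    (X : I -> T -> T') : Prop :=
  forall (J : {fset I}) (B : I -> set T'), (forall i, measurable (B i)) ->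
    P (\bigcap_(i in [set` J]) (X i @^-1` B i)) =
    (\prod_(i <- J) P (X i @^-1` B i))%E.

Definition sigma_generated d' (T' : measurableType d') (I : Type)
    (X : I -> T -> T') : set (set T) :=
  <<s [set A | exists i B, measurable B /\ A = X i @^-1` B] >>.

Definition independent_families d1 (T1 : measurableType d1) (I1 : Type)
    (X : I1 -> T -> T1) d2 (T2 : measurableType d2) (I2 : Type)
    (Y : I2 -> T -> T2) : Prop :=
  forall A B, sigma_generated X A -> sigma_generated Y B ->
    P (A `&` B) = (P A * P B)%E.

End independence.

(* Binary digits, rows of the matrices and entries of the shifts are numbered
   from 0: row l has weight 2^-(l+1), and bit i l is the digit of i of weight
   2^l. *)
Definition bit (i l : nat) : bool := odd (i %/ 2 ^ l).

Section digital_net.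
Context (R : realType) (s m : nat).

Definition net_digit (C : 'I_s -> nat -> 'I_m -> bool) (D : 'I_s -> nat -> bool)
    (i : nat) (j : 'I_s) (l : nat) : bool :=
  odd (\sum_(q < m) C j l q * bit i q + D j l)%N.

Definition net_point (C : 'I_s -> nat -> 'I_m -> bool) (D : 'I_s -> nat -> bool)
    (i : nat) : 'rV[R]_s :=
  \row_j limn (series (fun l => (net_digit C D i j l)%:R / 2 ^+ l.+1 : R)).

Definition net_estimator (f : 'rV[R]_s -> R) (C : 'I_s -> nat -> 'I_m -> bool)
    (D : 'I_s -> nat -> bool) : R :=
  (2 ^+ m)^-1 * \sum_(i < 2 ^ m) f (net_point C D i).

(* sum_j k_j^T C_j = 0 mod 2. The digits of k_j of index l >= k_j vanish, so the
   inner sum ranges over all the nonzero digits of k_j. *)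
Definition net_dual (C : 'I_s -> nat -> 'I_m -> bool) (k : 'I_s -> nat) : Prop :=
  forall q : 'I_m, ~~ odd (\sum_(j < s) \sum_(l < k j) bit (k j) l * C j l q)%N.

Definition randomized_net d (T : measurableType d) (P : probability T R)
    (C : T -> 'I_s -> nat -> 'I_m -> bool) (D : T -> 'I_s -> nat -> bool) : Prop :=
  let Cent := fun (x : 'I_s * nat * 'I_m) w => C w x.1.1 x.1.2 x.2 in
  let Dent := fun (x : 'I_s * nat) w => D w x.1 x.2 in
  [/\ forall x, measurable_fun setT (Cent x),
      forall x, measurable_fun setT (Dent x),
      mutually_independent P Dent,
      forall x b, P (Dent x @^-1` [set b]) = (2^-1)%:E &
      independent_families P Cent Dent].

End digital_net.

Definition asymptotically_full_rank (R : realType) (s : nat)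
    (d : nat -> measure_display) (T : forall m, measurableType (d m))
    (P : forall m, probability (T m) R)
    (C : forall m, T m -> 'I_s -> nat -> 'I_m -> bool) : Prop :=
  exists K : R, forall (m : nat) (k : 'I_s -> nat), (0 < m)%N ->
    (exists j, k j <> 0%N) ->
    (P m [set w | net_dual (C m w) k] <= (2 `^ (K - m%:R))%:E)%E.

Definition iid_copies (R : realType) d (T : measurableType d)
    (P : probability T R) (X : T -> R) d' (T' : measurableType d')
    (Q : probability T' R) (n : nat) (Y : 'I_n -> T' -> R) : Prop :=
  [/\ forall i, measurable_fun setT (Y i),
      mutually_independent Q Y &
      forall i (B : set R), measurable B -> Q (Y i @^-1` B) = P (X @^-1` B)].

(* For odd n, the middle one of the n sorted values. *)
Definition sample_median (R : realType) (n : nat) (x : 'I_n -> R) : R :=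
  nth 0 (sort <=%R [seq x i | i <- enum 'I_n]) n./2.

(* Main.v *)
(** Fix an upper part of the digits of [k], namely for each coordinate the [alpha]
    largest positions of nonzero digits and the next one. The sum of the squared Walsh
    coefficients of [f] over the [k] with this upper part is the mean square of an
    iterated dyadic difference of [f]: the differences along the first [alpha] positions
    are turned into derivatives by the mean value theorem, and Schur's test bounds the
    increments of the fractional integral representing that derivative along the last
    position. The result is of order [4^(- T k)], where [T k] adds the [alpha] largest
    positions and [lambda] times the next one, over all coordinates.
    There are about [2^(tau / (alpha + lambda))] vectors with [T k <= tau]. For [tau]
    slightly less than [(alpha + lambda) m], full rank implies that with large
    probability none of them is in the dual net, and the variance over the shifts is then
    governed by the coefficients with [T k > tau], each kept with probability [O(2^-m)].
    Chebyshev's inequality shows that one estimator errs by more than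
    [n^(- alpha - lambda - 1/2 + epsilon)] with small probability [p0]; the median of
    [2 r - 1] copies does so only if [r] of them do, which has probability at most
    [(4 p0)^r <= (4 p0)^m].
    To avoid infinite Walsh series, all this is done for the first [N] digits, on the
    finite group of dyadic grid points, and [N] tends to infinity for each fixed [m]. *)

Require Import Defs.
From HB Require Import structures.
From mathcomp Require Import all_boot all_order all_algebra.
From mathcomp Require Import finmap.
From mathcomp Require Import ring lra zify.
From mathcomp Require Import all_classical all_reals all_analysis.
From mathcomp Require Import measurable_realfun.

Set Implicit Arguments.
Unset Strict Implicit.
Unset Printing Implicit Defensive.

Import Order.TTheory GRing.Theory Num.Theory.
Import numFieldNormedType.Exports.

Local Open Scope classical_set_scope.
Local Open Scope ring_scope.

(** * The fractional kernel *)

Section capped_kernel.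
Context (R : realType).
Implicit Types (lambda delta x y z : R) (n k : nat).

(** The condition [p > 1 / lambda] says that the kernel lies in the space [L^q] dual to [L^p]. This
    makes the fractional integrals converge absolutely and gives a power rate for the error made by
    capping the kernel at the grid mesh; [p >= 2] supplies the square integrable density for Schur's
    test. The capping error is exponentially small in [N], while there are only polynomially many
    upper parts of digits, so its total contribution vanishes. This forces the order of choices:
    [m], then the weight threshold and the tolerance, and [N] last. Of the matrices only the
    probability of each single dual event is used, never a joint law: orthogonality in the uniform
    shift removes all cross terms. The loss [epsilon] comes from one slack parameter [nu], needed to
    sum geometric series over the upper parts, both in the count of small weights and in the tail of
    large ones. The failure probability [p0] of one estimator can stay constant, because the median
    turns it into a power of [n]; on the failure event boundedness of [f] is then enough. *)

Lemma ler_powR_neg (r x y : R) : r <= 0 -> 0 < x -> x <= y -> y `^ r <= x `^ r.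
Proof.
move=> r0 x0 xy; rewrite -(opprK r) !(powRN _ (- r)).
have y0 : 0 < y by exact: lt_le_trans xy.
rewrite lef_pV2 ?posrE ?powR_gt0//.
by apply: ge0_ler_powR; rewrite ?nnegrE ?oppr_ge0 ?(ltW x0) ?(ltW y0).
Qed.

(** Concavity of the power, obtained without derivatives: Young's inequality for [u = x / (x + 1)]
    gives [u^lambda <= 1 - lambda + lambda u], which is then scaled by [(x + 1)^lambda]. The case
    [lambda = 1] is separate because the conjugate exponent is infinite. *)
Lemma powR_increment lambda x : 0 < lambda <= 1 -> 0 <= x ->
  lambda * (x + 1) `^ (lambda - 1) <= (x + 1) `^ lambda - x `^ lambda.
Proof.
move=> /andP[l0 l1] x0.
have x1 : 0 < x + 1 by rewrite ltr_wpDl.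
have E : (x + 1) `^ lambda = (x + 1) * (x + 1) `^ (lambda - 1).
  by rewrite mulr_powRB1 ?ltW.
set u := x / (x + 1).
have u0 : 0 <= u by rewrite divr_ge0 ?(ltW x1).
have Ex : x `^ lambda = u `^ lambda * (x + 1) `^ lambda.
  by rewrite -powRM ?(ltW x1)// /u divfK// gt_eqF.
have Hu : u `^ lambda <= 1 - lambda + lambda * u.
  move: l1; rewrite le_eqVlt => /predU1P[->|l1].
    by rewrite powRr1// subrr add0r mul1r.
  have := @conjugate_powR R (u `^ lambda) 1 (lambda^-1) ((1 - lambda)^-1).
  rewrite mulr1 -powRrM divff ?gt_eqF// powRr1// powR1/= mul1r !invrK.
  rewrite (addrC (1 - lambda)) (mulrC lambda) => H; apply: H.
- exact: powR_ge0.
- by [].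
- by rewrite invr_gt0.
- by rewrite invr_gt0 subr_gt0.
- by rewrite addrC subrK.
have x1E : 1 - lambda + lambda * u = 1 - lambda / (x + 1).
  by rewrite /u; field; rewrite gt_eqF.
rewrite Ex -{1}(mul1r (_ `^ lambda)) -mulrBl E mulrA.
apply: ler_wpM2r; first exact: powR_ge0.
have -> : lambda = lambda / (x + 1) * (x + 1) by rewrite divfK// gt_eqF.
apply: ler_wpM2r; first exact: ltW.
by rewrite divfK ?gt_eqF//; move: Hu; rewrite x1E; lra.
Qed.

(* The cap makes the sums over a grid of mesh [delta] comparable to integrals; sums of the
   kernel itself are unbounded because of the singularity. *)
Definition capped_kernel lambda delta y : R :=
  if 0 < y then (Num.max y delta) `^ (lambda - 1) else 0.

Lemma capped_kernel_ge0 lambda delta y : 0 <= capped_kernel lambda delta y.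
Proof. by rewrite /capped_kernel; case: ifP => // _; exact: powR_ge0. Qed.

Lemma capped_kernel_le lambda delta x y : lambda <= 1 -> 0 < x -> x <= y ->
  capped_kernel lambda delta y <= capped_kernel lambda delta x.
Proof.
move=> l1 x0 xy; rewrite /capped_kernel x0 (lt_le_trans x0 xy).
apply: ler_powR_neg; first by rewrite subr_le0.
  by rewrite lt_max x0.
by rewrite ge_max le_max xy /= le_max lexx orbT.
Qed.

Lemma sum_powR lambda n : 0 < lambda <= 1 ->
  \sum_(i < n) i.+1%:R `^ (lambda - 1) <= n%:R `^ lambda / lambda.
Proof.
move=> l01; have /andP[l0 l1] := l01; elim: n => [|n IH].
  by rewrite big_ord0 divr_ge0 ?powR_ge0 ?ltW.
rewrite big_ord_recr/=.
have := powR_increment l01 (ler0n R n); rewrite natr1 => H.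
move: IH; rewrite !ler_pdivlMr// mulrDl (mulrC _ lambda) => IH; lra.
Qed.

(** The cap bounds the first term by [delta^lambda]; the later ones are compared with [sum_powR].
    The factor 2 absorbs the first term, since [1 <= 1 / lambda]. *)
Lemma sum_capped_kernel_pos lambda delta z n : 0 < lambda <= 1 -> 0 < delta ->
  0 < z -> \sum_(i < n) delta * capped_kernel lambda delta (z + i%:R * delta) <=
    2 / lambda * (n%:R * delta) `^ lambda.
Proof.
move=> l01 d0 z0; have /andP[l0 l1] := l01.
case: n => [|n].
  by rewrite big_ord0 mulr_ge0 ?powR_ge0// divr_ge0 ?ltW.
rewrite big_ord_recl mul0r addr0.
have dl : delta * delta `^ (lambda - 1) = delta `^ lambda.
  by rewrite mulr_powRB1 ?ltW.
have first_term : delta * capped_kernel lambda delta z <= delta `^ lambda.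
  rewrite -dl ler_pM2l// /capped_kernel z0 ler_powR_neg ?subr_le0//.
  by rewrite le_max lexx orbT.
have rest : \sum_(i < n) delta * capped_kernel lambda delta (z + (lift ord0 i)%:R * delta)
    <= delta `^ lambda * (n%:R `^ lambda / lambda).
  apply: le_trans (ler_wpM2l (powR_ge0 _ _) (sum_powR n l01)).
  rewrite mulr_sumr; apply: ler_sum => i _.
  rewrite -dl -mulrA ler_pM2l// -powRM ?(ltW d0)// /capped_kernel.
  rewrite lift0 [0 < _](_ : _ = true); last by rewrite ltr_pwDl ?mulr_ge0 ?(ltW d0).
  rewrite ler_powR_neg ?subr_le0 ?mulr_gt0//.
  by rewrite le_max mulrC lerDr ltW.
apply: le_trans (lerD first_term rest) _.
rewrite (powRM _ (ler0n R n.+1) (ltW d0)).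
set D := delta `^ lambda; set a := n%:R `^ lambda; set b := n.+1%:R `^ lambda.
have ab : a <= b by apply: ge0_ler_powR; rewrite ?nnegrE ?ler_nat// ltW.
have b1 : 1 <= b.
  have -> : 1 = 1 `^ lambda :> R by rewrite powR1.
  by apply: ge0_ler_powR; rewrite ?nnegrE ?ler1n// ltW.
have D0 : 0 <= D by exact: powR_ge0.
have il : 1 <= lambda^-1 by rewrite invf_ge1.
rewrite [leRHS](_ : _ = D * (2 * (b / lambda))); last by field; rewrite gt_eqF.
rewrite -{1}(mulr1 D) -mulrDr; apply: ler_wpM2l => //.
have : 1 <= b / lambda by rewrite (le_trans il)// ler_peMl// ltW// invr_gt0.
have : a / lambda <= b / lambda by rewrite ler_pM2r// invr_gt0.
lra.
Qed.

(** Terms at nonpositive arguments vanish, so the start [y] can be moved forward until it is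
    positive; the bound is therefore uniform in [y]. *)
Lemma sum_capped_kernel lambda delta y n : 0 < lambda <= 1 -> 0 < delta ->
  \sum_(i < n) delta * capped_kernel lambda delta (y + i%:R * delta) <=
    2 / lambda * (n%:R * delta) `^ lambda.
Proof.
move=> l01 d0; have /andP[l0 _] := l01; elim: n y => [|n IH] y.
  by rewrite big_ord0 mulr_ge0 ?powR_ge0// divr_ge0 ?ltW.
have [y0|y0] := ltP 0 y; first exact: sum_capped_kernel_pos.
rewrite big_ord_recl mul0r addr0 {1}/capped_kernel ltNge y0/= mulr0 add0r.
rewrite (eq_bigr (fun i : 'I_n =>
    delta * capped_kernel lambda delta (y + delta + i%:R * delta))); last first.
  by move=> i _; congr (_ * capped_kernel _ _ _); rewrite /bump leq0n add1n -natr1; ring.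
apply: le_trans (IH _) _; apply: ler_wpM2l; first by rewrite divr_ge0 ?ltW.
apply: ge0_ler_powR; rewrite ?nnegrE ?mulr_ge0 ?(ltW l0) ?(ltW d0)//.
by rewrite ler_pM2r// ler_nat.
Qed.

Lemma sum_shift_sub (G : nat -> R) n k :
  \sum_(i < n) (G (i + k)%N - G i) = \sum_(i < k) G (n + i)%N - \sum_(i < k) G i.
Proof.
elim: n => [|n IH].
  by rewrite big_ord0; under [X in _ = X - _]eq_bigr do rewrite add0n; rewrite subrr.
rewrite big_ord_recr /= IH.
have E : \sum_(i < k) G (n.+1 + i)%N = \sum_(i < k) G (n + i)%N + G (n + k)%N - G n.
  rewrite -[X in _ = X - _](big_ord_recr k (fun i : 'I_k.+1 => G (n + i)%N)).
  rewrite big_ord_recl/= addn0 addrAC subrr add0r.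
  by apply: eq_bigr => i _; rewrite /bump leq0n add1n addnS.
rewrite E; ring.
Qed.

(** On the positive half-line the kernel decreases, so the negative part is the whole decrement and
    the sum telescopes to at most its first [k] values. From a nonpositive argument the kernel can
    only go up, and that term drops out. *)
Lemma sum_neg_increment_capped_kernel lambda delta y n k :
  0 < lambda <= 1 -> 0 < delta ->
  \sum_(i < n) delta * Num.max 0
     (capped_kernel lambda delta (y + i%:R * delta) -
      capped_kernel lambda delta (y + (i + k)%:R * delta))
  <= 2 / lambda * (k%:R * delta) `^ lambda.
Proof.
move=> l01 d0; have /andP[l0 l1] := l01; elim: n y => [|n IH] y.
  by rewrite big_ord0 mulr_ge0 ?powR_ge0// divr_ge0 ?ltW.
have [y0|y0] := ltP 0 y.
  apply: le_trans (sum_capped_kernel y k l01 d0).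
  rewrite (eq_bigr (fun i : 'I_n.+1 => delta *
    (capped_kernel lambda delta (y + i%:R * delta) -
      capped_kernel lambda delta (y + (i + k)%:R * delta)))); last first.
    move=> i _; rewrite (max_idPr _)// subr_ge0 capped_kernel_le//.
      by rewrite ltr_pwDl ?mulr_ge0 ?(ltW d0).
    by rewrite lerD2l ler_pM2r// ler_nat leq_addr.
  have H := sum_shift_sub (fun i => delta * capped_kernel lambda delta (y + i%:R * delta)) n.+1 k.
  have : 0 <= \sum_(i < k) delta * capped_kernel lambda delta (y + (n.+1 + i)%:R * delta).
    by apply: sumr_ge0 => i _; rewrite mulr_ge0 ?capped_kernel_ge0 ?ltW.
  rewrite sumrB in H; under [X in _ -> X <= _]eq_bigr do rewrite mulrBr.
  by rewrite sumrB; lra.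
rewrite big_ord_recl mul0r addr0 {1}/capped_kernel ltNge y0/= sub0r (max_idPl _); last first.
  by rewrite oppr_le0 capped_kernel_ge0.
rewrite mulr0 add0r; apply: le_trans (IH (y + delta)).
apply: ler_sum => i _; rewrite /bump leq0n add1n addSn -!natr1 !mulrDl !mul1r -!addrA.
by rewrite !(addrC delta).
Qed.

(** An absolute value is the signed increment plus twice its negative part. The signed sum
    telescopes and costs [2 / lambda], the negative parts cost [2 (2 / lambda)], hence the 6. *)
Lemma sum_increment_capped_kernel lambda delta y n k :
  0 < lambda <= 1 -> 0 < delta ->
  \sum_(i < n) delta * `|capped_kernel lambda delta (y + i%:R * delta + k%:R * delta) -
      capped_kernel lambda delta (y + i%:R * delta)|
  <= 6 / lambda * (k%:R * delta) `^ lambda.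
Proof.
move=> l01 d0; have /andP[l0 l1] := l01.
pose G i := delta * capped_kernel lambda delta (y + i%:R * delta).
rewrite (eq_bigr (fun i : 'I_n => (G (i + k)%N - G i) + 2 * (delta * Num.max 0
     (capped_kernel lambda delta (y + i%:R * delta) -
      capped_kernel lambda delta (y + (i + k)%:R * delta))))); last first.
  move=> i _; rewrite /G -addrA -mulrDl -natrD -mulrBr mulrCA -mulrDr; congr (_ * _).
  set a := capped_kernel _ _ _; set b := capped_kernel _ _ _.
  have [ab|ab] := leP b a; first by rewrite ger0_norm ?subr_ge0// (max_idPl _) ?subr_le0//; ring.
  by rewrite ltr0_norm ?subr_lt0// (max_idPr _) ?subr_ge0 ?ltW//; ring.
rewrite big_split/= sum_shift_sub -[X in _ + X]mulr_sumr.
have := sum_neg_increment_capped_kernel y n k l01 d0.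
have : 0 <= \sum_(i < k) G i.
  by apply: sumr_ge0 => i _; rewrite mulr_ge0 ?capped_kernel_ge0 ?ltW.
have : \sum_(i < k) G (n + i)%N <= 2 / lambda * (k%:R * delta) `^ lambda.
  apply: le_trans (sum_capped_kernel (y + n%:R * delta) k l01 d0).
  by apply: ler_sum => i _; rewrite /G natrD mulrDl addrA.
have -> : 6 / lambda = 2 / lambda + 2 * (2 / lambda) :> R by field; rewrite gt_eqF.
set A := 2 / lambda; set X := _ `^ _; have -> : (A + 2 * A) * X = A * X + 2 * (A * X) by ring.
lra.
Qed.

End capped_kernel.

(** * Integrals over product measures and over translates *)

Section prob_power_integral.
Context d (T : measurableType d) (R : realType) (P : probability T R).

Lemma measurable_prod_tnth n (g : 'I_n -> T -> R) :
  (forall i, measurable_fun setT (g i)) ->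
  measurable_fun setT (fun t : n.-tuple T => \prod_(i < n) g i (tnth t i)).
Proof.
move=> mg; apply: (@measurable_prod _ _ _ _ 'I_n (index_enum _)
    (fun i (t : n.-tuple T) => g i (tnth t i))) => i _.
by apply: measurableT_comp => //; exact: measurable_tnth.
Qed.

Lemma ge0_integral_prob_power n (g : 'I_n -> T -> R) :
  (forall i, measurable_fun setT (g i)) -> (forall i x, 0 <= g i x) ->
  (\int[prob_power P n]_t (\prod_(i < n) g i (tnth t i))%:E =
   \prod_(i < n) \int[P]_x (g i x)%:E)%E.
Proof.
elim: n g => [|n IH] g mg g0.
  rewrite big_ord0 [prob_power _ _]/= integral_dirac//; last first.
    by apply/measurable_EFinP; exact: measurable_prod_tnth.
  by rewrite diracT mul1e big_ord0.
have mG : measurable_fun setT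
    (fun t : n.+1.-tuple T => (\prod_(i < n.+1) g i (tnth t i))%:E).
  by apply/measurable_EFinP; exact: measurable_prod_tnth.
have G0 t : (0 <= (\prod_(i < n.+1) g i (tnth t i))%:E)%E.
  by rewrite lee_fin prodr_ge0.
rewrite [prob_power _ _]/= ge0_integral_distribution//.
rewrite fubini_tonelli1//=; last first.
  by apply: measurableT_comp => //; exact: Defs.measurable_cons_tuple.
rewrite /fubini_F/=.
have E x : (\int[prob_power P n]_y (\prod_(i < n.+1) g i (tnth (Defs.cons_tuple (x, y)) i))%:E =
    (g ord0 x)%:E * \prod_(i < n) \int[P]_x (g (lift ord0 i) x)%:E)%E.
  rewrite -IH//.
  rewrite -ge0_integralZl//.
  - apply: eq_integral => y _; rewrite -EFinM big_ord_recl; congr ((_ * _)%:E).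
    by apply: eq_bigr => i _; congr (g _ _); rewrite /Defs.cons_tuple (tnth_nth x)/= (tnth_nth x).
  - apply/measurable_EFinP.
    exact: (measurable_prod_tnth (g := fun i => g (lift ord0 i))).
  - by move=> y _; rewrite lee_fin prodr_ge0.
  - by rewrite lee_fin.
under eq_integral do rewrite E.
rewrite ge0_integralZr//.
- by rewrite big_ord_recl.
- by apply/measurable_EFinP; exact: mg.
- by move=> x _; rewrite lee_fin.
- by apply: prode_ge0 => i _; apply: integral_ge0 => x _; rewrite lee_fin.
Qed.

End prob_power_integral.

Section translation.
Context (R : realType).
Notation mu := (@lebesgue_measure R).

Definition translate (a : R) : measurableTypeR R -> measurableTypeR R := fun x => x + a.

Lemma measurable_translate a : measurable_fun setT (translate a).
Proof. by apply: measurable_funD; [exact: measurable_id|exact: measurable_cst]. Qed.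

HB.instance Definition _ a :=
  isMeasurableFun.Build _ _ _ _ (translate a) (measurable_translate a).

Lemma lebesgue_measure_translate a (A : set (measurableTypeR R)) : measurable A ->
  mu A = pushforward mu (translate a) A.
Proof.
apply: lebesgue_measure_unique => X [[x y] /= _ <-].
rewrite /pushforward.
have -> : translate a @^-1` `]x, y] = `]x - a, y - a]%classic.
  by apply/seteqP; split => z /=; rewrite /translate !in_itv/= ltrBlDr lerBrDr.
rewrite !lebesgue_measure_itv/= !lte_fin ltrD2r.
case: ifP => // _; rewrite -!EFinD; congr _%:E; ring.
Qed.

Lemma ge0_integral_translate a (F : measurableTypeR R -> R) : measurable_fun setT F ->
  (forall x, 0 <= F x) ->
  (\int[mu]_x (F (x + a))%:E = \int[mu]_x (F x)%:E)%E.
Proof.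
move=> mF F0.
rewrite [RHS](eq_measure_integral (pushforward mu (translate a))); last first.
  by move=> A mA _; exact: lebesgue_measure_translate.
rewrite ge0_integral_pushforward//; last first.
- by move=> x _; rewrite lee_fin.
- exact/measurable_EFinP.
Qed.

(** Folding [[0,1]] onto [[0,1/n]] writes the integral as an average over [z] of sums along
    [z + c/n]. Thus the discrete kernel sums already bounded also give the integral bounds, and no
    antiderivative has to be computed. *)
Lemma integral_uniform_le_average (F : measurableTypeR R -> R) (B : R) n : (0 < n)%N ->
  measurable_fun setT F -> (forall x, 0 <= F x) ->
  (forall z, \sum_(c < n) n%:R^-1 * F (z + c%:R / n%:R) <= B) ->
  (\int[uniform_prob (@ltr01 R)]_x (F x)%:E <= B%:E)%E.
Proof.
move=> n0 mF F0 FB.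
have nR : 0 < n%:R :> R by rewrite ltr0n.
have mFE : measurable_fun setT (EFin \o F) by exact/measurable_EFinP.
rewrite integral_uniform//=.
rewrite subr0 invr1 mul1e.
pose I0 := `[0, n%:R^-1]%classic : set (measurableTypeR R).
have mI0 : measurable I0 by exact: measurable_itv.
pose G c (x : measurableTypeR R) := \1_I0 x * F (x + c%:R / n%:R).
have G0 c x : 0 <= G c x by rewrite mulr_ge0.
have mG c : measurable_fun setT (G c).
  apply: measurable_funM; first exact: measurable_indic.
  exact: (measurableT_comp mF (measurable_translate _)).
rewrite integral_mkcond.
(* The closed cells cover [[0,1]]; their overlaps only increase the right-hand side. The point 1 has
   truncated index [n], outside the range, and is assigned to the last cell. *)
apply: (@le_trans _ _ (\int[mu]_x (\sum_(c < n) (G c (x - c%:R / n%:R))%:E))%E).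
  apply: ge0_le_integral => //.
  - by move=> x _; rewrite /patch; case: ifP => // _; rewrite lee_fin.
  - apply/(measurable_restrict _ _ _) => //; exact: measurable_funTS.
  - apply: emeasurable_sum => c; apply/measurable_EFinP.
    apply: (measurableT_comp (mG c)); exact: (measurable_translate (- (c%:R / n%:R))).
  - move=> x _; rewrite /patch; case: ifP => [|_]; last first.
      by rewrite sumEFin lee_fin sumr_ge0.
    rewrite inE/= in_itv/= => /andP[x0 x1].
    have [c Hc] : exists c : 'I_n, 0 <= x - c%:R / n%:R <= n%:R^-1.
      have k0 : 0 <= x * n%:R by rewrite mulr_ge0// ltW.
      have /andP[k1 k2] := truncn_itv k0.
      have [kn|kn] := ltnP (Num.truncn (x * n%:R)) n.
        exists (Ordinal kn) => /=; apply/andP; split.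
          by rewrite subr_ge0 ler_pdivrMr.
        rewrite lerBlDr -[X in _ <= X + _]mul1r -mulrDl ler_pdivlMr//.
        by rewrite addrC natr1 ltW.
      have -> : x = 1.
        apply/eqP; rewrite eq_le x1/= -(ler_pM2r nR) mul1r (le_trans _ k1)//.
        by rewrite ler_nat.
      have n1 : (n.-1 < n)%N by rewrite prednK.
      exists (Ordinal n1) => /=.
      have -> : 1 - n.-1%:R / n%:R = n%:R^-1 :> R.
        have E : n%:R = n.-1%:R + 1 :> R by rewrite natr1 prednK.
        by apply: (mulIf (lt0r_neq0 nR)); rewrite mulrBl divfK ?mulVf ?lt0r_neq0// E; ring.
      by rewrite lexx andbT invr_ge0 ltW.
    rewrite (bigD1 c)//= -[leLHS]adde0; apply: leeD; last first.
      by rewrite sumEFin lee_fin sumr_ge0.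
    by rewrite /G subrK lee_fin indicE mem_set ?mul1r.
rewrite ge0_integral_sum//; last 2 first.
- move=> c; apply/measurable_EFinP.
  apply: (measurableT_comp (mG c)); exact: (measurable_translate (- (c%:R / n%:R))).
- by move=> c x _; rewrite lee_fin.
under eq_bigr => c _ do rewrite (ge0_integral_translate (- (c%:R / n%:R)) (mG c) (G0 c)).
rewrite -ge0_integral_sum//; last 2 first.
- by move=> c; exact/measurable_EFinP.
- by move=> c x _; rewrite lee_fin.
apply: (@le_trans _ _ (\int[mu]_x ((B * n%:R)%:E * (\1_I0 x)%:E))%E).
  apply: ge0_le_integral => //.
  - by move=> x _; rewrite sumEFin lee_fin sumr_ge0.
  - by apply: emeasurable_sum => c; apply/measurable_EFinP.
  - apply/measurable_EFinP; apply: measurable_funM => //; exact: measurable_indic.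
  - move=> x _; rewrite sumEFin -EFinM lee_fin -mulr_sumr mulrC.
    rewrite indicE; case: (x \in I0); rewrite ?mulr0// !mulr1.
    by rewrite -ler_pdivrMr// mulrC mulr_sumr.
have B0 : 0 <= B.
  by apply: le_trans (FB 0); apply: sumr_ge0 => c _; rewrite mulr_ge0// invr_ge0 ltW.
rewrite ge0_integralZl//.
- have -> : (\int[mu]_x (\1_I0 x)%:E = mu I0)%E by rewrite integral_indic// setIT.
  have -> : mu I0 = (n%:R^-1)%:E.
    have := @lebesgue_measure_itv R `[0, n%:R^-1].
    by rewrite /= lte_fin invr_gt0 nR -EFinB subr0.
  by rewrite -EFinM mulfK// gt_eqF.
- by apply/measurable_EFinP; exact: measurable_indic.
- by rewrite lee_fin mulr_ge0// ltW.
Qed.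

End translation.

Section normr_Rintegral.
Context d (T : measurableType d) (R : realType) (mu : {measure set T -> \bar R}).

(** Integrability is not assumed: when the extended integral is infinite, its real version is 0 by
    the convention on [fine]. *)
Lemma normr_Rintegral_le (g : T -> R) : measurable_fun setT g ->
  ((`|\int[mu]_t g t|)%:E <= \int[mu]_t (`|g t|)%:E)%E.
Proof.
move=> mg; apply: (@le_trans _ _ `|\int[mu]_x (g x)%:E|%E); last first.
  by apply: le_abse_integral => //; exact/measurable_EFinP.
by rewrite /Rintegral; case: (\int[mu]_x (g x)%:E)%E => [r| |]//=; rewrite normr0 leey.
Qed.

End normr_Rintegral.

Section kernel_integrals.
Context (R : realType).
Implicit Types (lambda x t : R).
Notation U := (uniform_prob (@ltr01 R)).

Lemma measurable_capped_kernel lambda delta :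
  measurable_fun setT (capped_kernel lambda delta : measurableTypeR R -> R).
Proof.
apply: measurable_fun_ifT => //.
- exact: measurable_fun_ltr.
- apply: (@measurableT_comp _ _ _ (measurableTypeR R) (measurableTypeR R) R
    (@powR R ^~ (lambda - 1)) _ (fun t => Num.max t delta)).
    exact: measurable_powR.
  exact: measurable_maxr.
Qed.

Lemma measurable_reflect x :
  measurable_fun setT ((fun t => x - t) : measurableTypeR R -> measurableTypeR R).
Proof. exact: measurable_funB. Qed.

Lemma measurable_capped_kernelB lambda delta x :
  measurable_fun setT ((fun t => capped_kernel lambda delta (x - t)) : measurableTypeR R -> R).
Proof.
exact: (measurableT_comp (measurable_capped_kernel lambda delta) (measurable_reflect x)).
Qed.

Lemma measurable_frac_kernel lambda x :
  measurable_fun setT (frac_kernel lambda x : measurableTypeR R -> R).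
Proof.
apply: measurable_fun_ifT => //.
- exact: measurable_fun_ltr.
- apply: (@measurableT_comp _ _ _ (measurableTypeR R) (measurableTypeR R) R
    (@powR R ^~ (lambda - 1)) _ (fun t => x - t)).
    exact: measurable_powR.
  exact: measurable_reflect.
Qed.

Lemma frac_kernel_ge0 lambda x t : 0 <= frac_kernel lambda x t.
Proof. by rewrite /frac_kernel; case: ifP => // _; exact: powR_ge0. Qed.

Lemma capped_kernel_le_frac lambda delta x t : lambda <= 1 ->
  capped_kernel lambda delta (x - t) <= frac_kernel lambda x t.
Proof.
move=> l1; rewrite /capped_kernel /frac_kernel subr_gt0; case: ifPn => // tx.
by apply: ler_powR_neg; rewrite ?subr_le0 ?subr_gt0// le_max lexx.
Qed.

Lemma capped_kernel_eq_frac lambda delta x t : delta <= x - t ->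
  capped_kernel lambda delta (x - t) = frac_kernel lambda x t.
Proof.
by move=> dx; rewrite /capped_kernel /frac_kernel subr_gt0 (max_idPl _).
Qed.

(** The variable of integration enters the kernel with a minus sign, so sums along decreasing
    progressions have to be read backwards. *)
Lemma sum_reflect (F : R -> R) (y : R) n : (0 < n)%N ->
  \sum_(c < n) n%:R^-1 * F (y - c%:R / n%:R) =
  \sum_(c < n) n%:R^-1 * F (y - n.-1%:R / n%:R + c%:R * n%:R^-1).
Proof.
move=> n0; rewrite (reindex_inj rev_ord_inj)/=; apply: eq_bigr => i _.
congr (_ * F _).
have -> : (n - i.+1)%N = (n.-1 - i)%N by case: n n0 i => // n _ i; rewrite subSS.
have il : (i <= n.-1)%N by rewrite -ltnS prednK.
rewrite natrB// mulrBl; ring.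
Qed.

Lemma integral_capped_kernel lambda x n : 0 < lambda <= 1 -> (0 < n)%N ->
  (\int[U]_t (capped_kernel lambda n%:R^-1 (x - t))%:E <= (2 / lambda)%:E)%E.
Proof.
move=> l01 n0; apply: (integral_uniform_le_average n0).
- exact: measurable_capped_kernelB.
- by move=> t; exact: capped_kernel_ge0.
move=> z; under eq_bigr do rewrite opprD addrA.
rewrite (sum_reflect (capped_kernel lambda n%:R^-1))//.
have n0' : 0 < n%:R^-1 :> R by rewrite invr_gt0 ltr0n.
apply: le_trans (sum_capped_kernel _ _ l01 n0') _.
by rewrite mulfV ?powR1 ?mulr1// lt0r_neq0// ltr0n.
Qed.

Lemma integral_increment_capped_kernel lambda x n k : 0 < lambda <= 1 -> (0 < n)%N ->
  (\int[U]_t (`|capped_kernel lambda n%:R^-1 (x + k%:R / n%:R - t) -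
     capped_kernel lambda n%:R^-1 (x - t)|)%:E
   <= (6 / lambda * (k%:R / n%:R) `^ lambda)%:E)%E.
Proof.
move=> l01 n0.
pose F y := `|capped_kernel lambda n%:R^-1 (y + k%:R / n%:R) -
     capped_kernel lambda n%:R^-1 y|.
rewrite [leLHS](_ : _ = \int[U]_t (F (x - t))%:E)%E; last first.
  by apply: eq_integral => t _; rewrite /F addrAC.
apply: (integral_uniform_le_average n0).
- rewrite (_ : (fun _ => _) = fun t : measurableTypeR R =>
      `|capped_kernel lambda n%:R^-1 (x + k%:R / n%:R - t) -
        capped_kernel lambda n%:R^-1 (x - t)|); last first.
    by apply/funext => t; rewrite /F addrAC.
  apply: (@measurableT_comp _ _ _ _ _ _ (@Num.norm R R)) => //.
  by apply: measurable_funB; exact: measurable_capped_kernelB.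
- by move=> t; exact: normr_ge0.
move=> z; under eq_bigr do rewrite opprD addrA.
rewrite (sum_reflect F)//.
have n0' : 0 < n%:R^-1 :> R by rewrite invr_gt0 ltr0n.
exact: le_trans (sum_increment_capped_kernel _ _ _ l01 n0') _.
Qed.

Lemma cvg_capped_kernel lambda x t :
  capped_kernel lambda n.+1%:R^-1 (x - t) @[n --> \oo] --> frac_kernel lambda x t.
Proof.
have [tx|tx] := ltP t x; last first.
  rewrite (_ : (fun _ => _) = fun=> frac_kernel lambda x t); first exact: cvg_cst.
  by apply/funext => n; rewrite /capped_kernel /frac_kernel subr_gt0 ltNge tx.
apply: cvg_near_cst; near=> n; apply: capped_kernel_eq_frac.
have xt : 0 < x - t by rewrite subr_gt0.
rewrite invf_ple ?posrE//; near: n.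
by exists (Num.truncn (x - t)^-1) => // n /= ln; apply: le_trans (ltW (truncnS_gt _)) _;
  rewrite ler_nat ltnS.
Unshelve. all: by end_near. Qed.

(** Lowering the cap to 0 increases the capped kernel to the singular one, and monotone convergence
    carries the uniform bound over. *)
Lemma integral_frac_kernel lambda x : 0 < lambda <= 1 ->
  (\int[U]_t (frac_kernel lambda x t)%:E <= (2 / lambda)%:E)%E.
Proof.
move=> l01; have /andP[l0 l1] := l01.
pose f n t := (capped_kernel lambda n.+1%:R^-1 (x - t))%:E : \bar R.
have mf n : measurable_fun (setT : set (measurableTypeR R)) (f n).
  by apply/measurable_EFinP; exact: measurable_capped_kernelB.
have f0 n (t : measurableTypeR R) : setT t -> (0 <= f n t)%E.
  by move=> _; rewrite lee_fin capped_kernel_ge0.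
have nd (t : measurableTypeR R) : setT t -> nondecreasing_seq (f ^~ t).
  move=> _ a b ab; rewrite lee_fin /capped_kernel; case: ifP => // xt.
  apply: ler_powR_neg; rewrite ?subr_le0 ?lt_max ?xt//.
  rewrite ge_max !le_max lexx/=; apply/orP; right.
  by rewrite lef_pV2 ?posrE// ler_nat.
have := @cvg_monotone_convergence _ _ _ U setT measurableT f mf f0 nd.
rewrite (_ : (fun t => limn (f ^~ t)) = fun t => (frac_kernel lambda x t)%:E); last first.
  apply/funext => t; apply/cvg_lim => //; apply/cvg_EFin; first exact: nearW.
  exact: cvg_capped_kernel.
move=> /cvg_lim <-//; apply: lime_le; last first.
  by apply: nearW => n; exact: integral_capped_kernel.
apply: ereal_nondecreasing_is_cvgn => a b ab; apply: ge0_le_integral => //.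
  by move=> t _; exact: f0.
by move=> t _; exact: nd.
Qed.

End kernel_integrals.

(** * Products of kernels and the error of capping *)

Section kernel_products.
Context (R : realType).
Implicit Types (lambda p q tau delta : R).

Definition frac_kernel_prod lambda n (x : 'I_n -> R) (t : n.-tuple (measurableTypeR R)) : R :=
  \prod_(i < n) frac_kernel lambda (x i) (tnth t i).

Definition capped_kernel_prod lambda delta n (x : 'I_n -> R)
    (t : n.-tuple (measurableTypeR R)) : R :=
  \prod_(i < n) capped_kernel lambda delta (x i - tnth t i).

Lemma frac_kernel_prod_ge0 lambda n x t : 0 <= @frac_kernel_prod lambda n x t.
Proof. by apply: prodr_ge0 => i _; exact: frac_kernel_ge0. Qed.

Lemma capped_kernel_prod_ge0 lambda delta n x t :
  0 <= @capped_kernel_prod lambda delta n x t.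
Proof. by apply: prodr_ge0 => i _; exact: capped_kernel_ge0. Qed.

Lemma capped_kernel_prod_le lambda delta n x t : lambda <= 1 ->
  @capped_kernel_prod lambda delta n x t <= frac_kernel_prod lambda x t.
Proof.
by move=> l1; apply: ler_prod => i _; rewrite capped_kernel_ge0 capped_kernel_le_frac.
Qed.

Lemma measurable_frac_kernel_prod lambda n (x : 'I_n -> R) :
  measurable_fun setT (frac_kernel_prod lambda x).
Proof.
by apply: (measurable_prod_tnth (g := fun i => frac_kernel lambda (x i))) => i;
  exact: measurable_frac_kernel.
Qed.

Lemma measurable_capped_kernel_prod lambda delta n (x : 'I_n -> R) :
  measurable_fun setT (capped_kernel_prod lambda delta x).
Proof.
by apply: (@measurable_prod_tnth _ (measurableTypeR R) R n
    (fun i t => capped_kernel lambda delta (x i - t))) => i;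
  exact: measurable_capped_kernelB.
Qed.

(** Powers of a fractional kernel are fractional kernels, so the bound on integrals applies to
    [q]-th powers as long as the new parameter stays positive. The condition on [q] is due to
    [0^0 = 1]. *)
Lemma frac_kernel_powR lambda q x t : q != 0 ->
  frac_kernel lambda x t `^ q = frac_kernel (1 + (lambda - 1) * q) x t.
Proof.
move=> q0; rewrite /frac_kernel; case: ifP => _; last by rewrite powR0.
by rewrite -powRrM addrAC subrr add0r.
Qed.

Lemma frac_kernel_prod_powR lambda q n (x : 'I_n -> R) t : q != 0 ->
  frac_kernel_prod lambda x t `^ q = frac_kernel_prod (1 + (lambda - 1) * q) x t.
Proof.
move=> q0; rewrite /frac_kernel_prod.
under [RHS]eq_bigr do rewrite -frac_kernel_powR//.
have : 0 <= \prod_(i < n) frac_kernel lambda (x i) (tnth t i) /\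
  (\prod_(i < n) frac_kernel lambda (x i) (tnth t i)) `^ q =
   \prod_(i < n) frac_kernel lambda (x i) (tnth t i) `^ q; last by case.
elim/big_rec2 : _ => [|i a b _ [b0 <-]]; first by rewrite powR1.
by rewrite powRM ?mulr_ge0 ?frac_kernel_ge0.
Qed.

(* Where the products differ, some [x_i - t_i < delta], so that
   [1 <= (delta / (x_i - t_i)) ^ tau]. *)
Lemma kernel_prod_gap_powR lambda q tau delta n (x : 'I_n -> R) t :
  lambda <= 1 -> 1 <= q -> 0 <= tau -> 0 < delta ->
  (frac_kernel_prod lambda x t - capped_kernel_prod lambda delta x t) `^ q <=
  \sum_(i < n) \prod_(l < n)
    (if l == i then delta `^ tau * frac_kernel (1 + (lambda - 1) * q - tau) (x l) (tnth t l)
     else frac_kernel (1 + (lambda - 1) * q) (x l) (tnth t l)).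
Proof.
move=> l1 q1 tau0 d0.
have q0 : q != 0 by rewrite gt_eqF// (lt_le_trans _ q1).
have T0 i : 0 <= \prod_(l < n)
    (if l == i then delta `^ tau * frac_kernel (1 + (lambda - 1) * q - tau) (x l) (tnth t l)
     else frac_kernel (1 + (lambda - 1) * q) (x l) (tnth t l)).
  by apply: prodr_ge0 => l _; case: ifP => _; rewrite ?mulr_ge0 ?frac_kernel_ge0 ?powR_ge0.
(* If no coordinate has [0 < x_i - t_i < delta], the cap is inactive in every nonzero factor and the
   two products agree. *)
have [/forallP H|] := boolP [forall i, ~~ (0 < x i - tnth t i < delta)].
  have -> : capped_kernel_prod lambda delta x t = frac_kernel_prod lambda x t.
    apply: eq_bigr => i _; have := H i; rewrite negb_and -!leNgt => /orP[xt|].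
      by rewrite /capped_kernel /frac_kernel -(subr_gt0 (tnth t i)) ltNge xt.
    exact: capped_kernel_eq_frac.
  by rewrite subrr powR0// sumr_ge0.
rewrite negb_forall => /existsP[i]; rewrite negbK => /andP[xt0 xtd].
rewrite (bigD1 i)//= -[leLHS]addr0; apply: lerD; last exact: sumr_ge0.
apply: (@le_trans _ _ (frac_kernel_prod lambda x t `^ q)).
  apply: ge0_ler_powR; rewrite ?nnegrE; first exact: le_trans q1.
  - by rewrite subr_ge0 capped_kernel_prod_le.
  - exact: frac_kernel_prod_ge0.
  - by rewrite gerBl capped_kernel_prod_ge0.
rewrite frac_kernel_prod_powR//; apply: ler_prod => l _.
rewrite frac_kernel_ge0/=; case: eqP => // ->.
rewrite /frac_kernel -subr_gt0 xt0.
have -> : 1 + (lambda - 1) * q - 1 = tau + (1 + (lambda - 1) * q - tau - 1) by ring.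
rewrite powRD; last by rewrite (gt_eqF xt0) implybT.
by rewrite ler_wpM2r ?powR_ge0// ge0_ler_powR ?nnegrE ?(ltW d0) ?(ltW xt0) ?(ltW xtd).
Qed.

Lemma integral_prod_tnth_le d (T : measurableType d) (P : probability T R) n
    (g : 'I_n -> T -> R) (b : 'I_n -> R) :
  (forall i, measurable_fun setT (g i)) -> (forall i x, 0 <= g i x) ->
  (forall i, (\int[P]_x (g i x)%:E <= (b i)%:E)%E) ->
  (\int[prob_power P n]_t (\prod_(i < n) g i (tnth t i))%:E <= (\prod_(i < n) b i)%:E)%E.
Proof.
move=> mg g0 gb; rewrite ge0_integral_prob_power//.
suff [_] : (0 <= \prod_(i < n) \int[P]_x (g i x)%:E)%E /\
  (\prod_(i < n) \int[P]_x (g i x)%:E <= (\prod_(i < n) b i)%:E)%E by [].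
elim/big_rec2 : _ => [|i r s _ [s0 sr]]; first by split.
have I0 : (0 <= \int[P]_x (g i x)%:E)%E by apply: integral_ge0 => x _; rewrite lee_fin.
by split; [exact: mule_ge0|rewrite EFinM; exact: lee_pmul].
Qed.

Lemma integral_frac_kernel_prod lambda n (x : 'I_n -> R) : 0 < lambda <= 1 ->
  (\int[cube_measure R n]_t (frac_kernel_prod lambda x t)%:E <= ((2 / lambda) ^+ n)%:E)%E.
Proof.
move=> l01; have -> : (2 / lambda) ^+ n = \prod_(i < n) (2 / lambda).
  by rewrite prodr_const card_ord.
apply: (@integral_prod_tnth_le _ (measurableTypeR R) _ n (fun i => frac_kernel lambda (x i))) => i.
- exact: measurable_frac_kernel.
- by move=> t; exact: frac_kernel_ge0.
- exact: integral_frac_kernel.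
Qed.

(** Here [tau] is half of the available exponent [l' = 1 + (lambda - 1) q]: one half becomes the
    power of [delta], the other half keeps the kernel integrable, with constant
    [2 / (l' / 2) = 4 / l']. *)
Lemma integral_kernel_prod_gap lambda q delta n (x : 'I_n -> R) :
  lambda <= 1 -> 1 <= q -> 0 < 1 + (lambda - 1) * q -> 0 < delta ->
  (\int[cube_measure R n]_t
     ((frac_kernel_prod lambda x t - capped_kernel_prod lambda delta x t) `^ q)%:E
   <= (n%:R * (4 / (1 + (lambda - 1) * q)) ^+ n *
       delta `^ ((1 + (lambda - 1) * q) / 2))%:E)%E.
Proof.
move=> l1 q1 l0 d0; set l' := 1 + _ in l0 *.
have l'1 : l' <= 1 by rewrite gerDl mulr_le0_ge0 ?subr_le0// (le_trans ler01).
pose g (i l : 'I_n) (t : measurableTypeR R) :=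
  if l == i then delta `^ (l' / 2) * frac_kernel (l' - l' / 2) (x l) t
  else frac_kernel l' (x l) t.
have g0 i l t : 0 <= g i l t.
  by rewrite /g; case: ifP => _; rewrite ?mulr_ge0 ?frac_kernel_ge0 ?powR_ge0.
have mg i l : measurable_fun setT (g i l).
  case E : (l == i); rewrite /g E; last exact: measurable_frac_kernel.
  by apply: measurable_funM => //; exact: measurable_frac_kernel.
apply: (@le_trans _ _ (\int[cube_measure R n]_t
    (\sum_(i < n) (\prod_(l < n) g i l (tnth t l))%:E)%E)%E).
  apply: ge0_le_integral => //.
  - by move=> t _; rewrite lee_fin powR_ge0.
  - apply/measurable_EFinP.
    apply: (@measurableT_comp _ _ _ _ (measurableTypeR R) R (@powR R ^~ q) _
      (fun t => frac_kernel_prod lambda x t - capped_kernel_prod lambda delta x t)).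
      exact: measurable_powR.
    apply: measurable_funB; first exact: measurable_frac_kernel_prod.
    exact: measurable_capped_kernel_prod.
  - apply: emeasurable_sum => i; apply/measurable_EFinP; exact: measurable_prod_tnth.
  - move=> t _; rewrite sumEFin lee_fin.
    by apply: kernel_prod_gap_powR => //; rewrite divr_ge0// ltW.
rewrite ge0_integral_sum//; last 2 first.
- by move=> i; apply/measurable_EFinP; exact: measurable_prod_tnth.
- by move=> i t _; rewrite lee_fin prodr_ge0.
have -> : n%:R * (4 / l') ^+ n * delta `^ (l' / 2) =
   \sum_(i < n) (4 / l') ^+ n * delta `^ (l' / 2).
  rewrite sumr_const card_ord -mulr_natl; ring.
rewrite -sumEFin; apply: lee_sum => i _.
have -> : (4 / l') ^+ n * delta `^ (l' / 2) =
    \prod_(l < n) (if l == i then delta `^ (l' / 2) * (4 / l') else 4 / l').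
  rewrite (bigD1 i)//= eqxx (eq_bigr (fun=> 4 / l')); last by move=> l /negbTE ->.
  rewrite prodr_const cardC1 card_ord -mulrA -exprS prednK 1?mulrC//.
  exact: leq_ltn_trans (ltn_ord i).
apply: (integral_prod_tnth_le (g := g i)) => // l.
have two : 2 / (l' - l' / 2) = 4 / l' by field; rewrite gt_eqF.
have half01 : 0 < l' - l' / 2 <= 1.
  by apply/andP; split; lra.
rewrite /g; case: ifP => _; last first.
  apply: le_trans (integral_frac_kernel _ _) _; first by rewrite l0.
  by rewrite lee_fin ler_pM2r ?invr_gt0// ler_nat.
under eq_integral do rewrite EFinM.
rewrite ge0_integralZl//.
- rewrite EFinM -two; apply: lee_pmul => //; rewrite ?lee_fin ?powR_ge0//.
    by apply: integral_ge0 => t _; rewrite lee_fin frac_kernel_ge0.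
  exact: integral_frac_kernel.
- by apply/measurable_EFinP; exact: measurable_frac_kernel.
- by move=> t _; rewrite lee_fin frac_kernel_ge0.
- by rewrite lee_fin powR_ge0.
Qed.

(** The free [theta] replaces the normalization in Hölder's inequality, so that integrals are only
    added, never raised to powers. *)
Lemma young_powR p q (a b theta : R) : 1 <= p -> 1 <= q -> p^-1 + q^-1 = 1 ->
  0 <= a -> 0 <= b -> 0 < theta ->
  a * b <= theta `^ p * a `^ p + theta `^ (- q) * b `^ q.
Proof.
move=> p1 q1 pq a0 b0 th0.
have p0 : 0 < p by exact: lt_le_trans p1.
have q0 : 0 < q by exact: lt_le_trans q1.
have -> : a * b = (theta * a) * (theta^-1 * b) by field; rewrite gt_eqF.
have th1 : 0 < theta^-1 by rewrite invr_gt0.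
apply: le_trans (conjugate_powR _ _ p0 q0 pq) _; rewrite ?mulr_ge0 ?(ltW th0) ?(ltW th1)//.
rewrite !powRM ?(ltW th0) ?(ltW th1)// -powR_inv1 ?(ltW th0)// -powRrM mulN1r.
apply: lerD; rewrite ler_pdivrMr// ler_peMr// mulr_ge0 ?powR_ge0//.
Qed.

Section frac_potential.
Context (n : nat) (lambda p : R) (phi : n.-tuple (measurableTypeR R) -> R).
Hypotheses (l01 : 0 < lambda <= 1) (p2 : 2 <= p) (lp : lambda^-1 < p).
Hypothesis phip : phi \in Lfun (cube_measure R n) p%:E.

Let q := p / (p - 1).

Let p1 : 1 < p. Proof. by rewrite (lt_le_trans _ p2)// ltr1n. Qed.

Let q1 : 1 <= q.
Proof. by rewrite /q ler_pdivlMr ?subr_gt0// mul1r gerBl. Qed.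

Let pq : p^-1 + q^-1 = 1.
Proof.
by rewrite /q; field; rewrite subr_eq0 !gt_eqF// (lt_trans _ p1).
Qed.

(** This is where [p > 1 / lambda] enters: the parameter equals [(lambda p - 1) / (p - 1)]. *)
Let l'0 : 0 < 1 + (lambda - 1) * q.
Proof.
have [/andP[l0 l1] p0] : 0 < lambda <= 1 /\ 0 < p by rewrite (lt_trans _ p1).
have -> : 1 + (lambda - 1) * q = (lambda * p - 1) / (p - 1).
  by rewrite /q; field; rewrite subr_eq0 gt_eqF.
by rewrite divr_gt0 ?subr_gt0// -ltr_pdivrMl// mulr1.
Qed.

Let l'1 : 1 + (lambda - 1) * q <= 1.
Proof.
by have /andP[_ l1] := l01; rewrite gerDl mulr_le0_ge0 ?subr_le0// (le_trans ler01).
Qed.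

Lemma measurable_frac_density : measurable_fun setT phi.
Proof. by move: phip; rewrite inE => /andP[/[!inE]]. Qed.

Lemma integrable_frac_density_powR :
  (cube_measure R n).-integrable setT (fun t => (`|phi t| `^ p)%:E).
Proof. exact: (Lfun_integrable (ltW p1)). Qed.

Let measurable_powR_comp (r : R) (g : n.-tuple (measurableTypeR R) -> R) :
  measurable_fun setT g -> measurable_fun setT (fun t => g t `^ r).
Proof.
move=> mg; apply: (@measurableT_comp _ _ _ _ (measurableTypeR R) R (@powR R ^~ r) _ g) => //.
Qed.

Lemma integrable_frac_potential (x : 'I_n -> R) :
  (cube_measure R n).-integrable setT (fun t => (phi t * frac_kernel_prod lambda x t)%:E).
Proof.
have K : (cube_measure R n).-integrable setT
    (fun t => (frac_kernel_prod lambda x t `^ q)%:E).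
  apply/integrableP; split.
    apply/measurable_EFinP.
    by apply: measurable_powR_comp; exact: measurable_frac_kernel_prod.
  under eq_integral do rewrite gee0_abs ?lee_fin ?powR_ge0//.
  under eq_integral do rewrite frac_kernel_prod_powR ?gt_eqF ?(lt_le_trans _ q1)//.
  apply: le_lt_trans (integral_frac_kernel_prod _ _) (ltry _).
  by rewrite l'0.
apply: (le_integrable measurableT _ _ (integrableD measurableT integrable_frac_density_powR K)).
  apply/measurable_EFinP; apply: measurable_funM; first exact: measurable_frac_density.
  exact: measurable_frac_kernel_prod.
move=> t _ /=; rewrite lee_fin normrM (ger0_norm (frac_kernel_prod_ge0 _ _ _)).
rewrite [leRHS]ger0_norm ?addr_ge0 ?powR_ge0//.
have := young_powR (ltW p1) q1 pq (normr_ge0 (phi t)) (frac_kernel_prod_ge0 lambda x t) ltr01.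
by rewrite !powR1 !mul1r.
Qed.

Lemma integrable_capped_potential delta (x : 'I_n -> R) :
  (cube_measure R n).-integrable setT
    (fun t => (phi t * capped_kernel_prod lambda delta x t)%:E).
Proof.
apply: (le_integrable measurableT _ _ (integrable_frac_potential x)).
  apply/measurable_EFinP; apply: measurable_funM; first exact: measurable_frac_density.
  exact: measurable_capped_kernel_prod.
move=> t _ /=; rewrite lee_fin !normrM ler_wpM2l// !ger0_norm.
- by apply: capped_kernel_prod_le; case/andP: l01.
- exact: frac_kernel_prod_ge0.
- exact: capped_kernel_prod_ge0.
Qed.

Lemma capped_potential_approx : exists C omega : R, [/\ 0 <= C, 0 < omega &
  forall delta (x : 'I_n -> R), 0 < delta <= 1 ->
  `|\int[cube_measure R n]_t (phi t * frac_kernel_prod lambda x t) -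
    \int[cube_measure R n]_t (phi t * capped_kernel_prod lambda delta x t)|
  <= C * delta `^ omega].
Proof.
have /andP[l0 l1] := l01.
pose l' := 1 + (lambda - 1) * q.
have l0' : 0 < l' by exact: l'0.
have q0 : 0 < q by exact: lt_le_trans q1.
have p0 : 0 < p by exact: lt_trans p1.
pose Phi := fine (\int[cube_measure R n]_t (`|phi t| `^ p)%:E)%E.
have PhiE : (\int[cube_measure R n]_t (`|phi t| `^ p)%:E)%E = Phi%:E.
  rewrite /Phi fineK//; apply: integrable_fin_num => //.
  exact: integrable_frac_density_powR.
have Phi0 : 0 <= Phi.
  by rewrite fine_ge0//; apply: integral_ge0 => t _; rewrite lee_fin powR_ge0.
pose B := n%:R * (4 / l') ^+ n.
have B0 : 0 <= B by rewrite mulr_ge0// exprn_ge0// divr_ge0// ltW.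
(* With [theta = delta^(l' / (4 q))], the density term carries [theta^p = delta^(l' p / (4 q))], and
   the gap term carries [theta^(-q) delta^(l' / 2) = delta^(l' / 4)]. Both exponents are positive
   and the smaller one is kept. *)
pose om := Num.min (l' / (4 * q) * p) (l' / 4).
have om0 : 0 < om.
  have q4 : 0 < (4 * q)^-1 by rewrite invr_gt0 mulr_gt0.
  by rewrite lt_min; apply/andP; split; repeat (apply: mulr_gt0 || by rewrite ?invr_gt0).
exists (Phi + B), om; split => //; first exact: addr_ge0.
move=> delta x /andP[d0 d1].
rewrite -RintegralB//; last 2 first.
- exact: integrable_frac_potential.
- exact: integrable_capped_potential.
pose gap t := frac_kernel_prod lambda x t - capped_kernel_prod lambda delta x t.
have gap0 t : 0 <= gap t by rewrite subr_ge0 capped_kernel_prod_le.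
have mgap : measurable_fun setT gap.
  apply: measurable_funB; first exact: measurable_frac_kernel_prod.
  exact: measurable_capped_kernel_prod.
rewrite -lee_fin; apply: le_trans (normr_Rintegral_le _ _) _.
  apply: measurable_funB; apply: measurable_funM; try exact: measurable_frac_density.
    exact: measurable_frac_kernel_prod.
  exact: measurable_capped_kernel_prod.
pose theta := delta `^ (l' / (4 * q)).
have th0 : 0 < theta by exact: powR_gt0.
apply: (@le_trans _ _ (\int[cube_measure R n]_t
   ((theta `^ p)%:E * (`|phi t| `^ p)%:E + (theta `^ (- q))%:E * (gap t `^ q)%:E))%E).
  apply: ge0_le_integral => //.
  - apply/measurable_EFinP; apply: (@measurableT_comp _ _ _ _ _ _ (@Num.norm R R)) => //.
    apply: measurable_funB; apply: measurable_funM; try exact: measurable_frac_density.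
      exact: measurable_frac_kernel_prod.
    exact: measurable_capped_kernel_prod.
  - apply: emeasurable_funD; apply: measurable_funeM; apply/measurable_EFinP;
      apply: measurable_powR_comp => //.
    exact: (measurableT_comp _ measurable_frac_density).
  - move=> t _; rewrite -!EFinM -EFinD lee_fin -mulrBr normrM (ger0_norm (gap0 t)).
    exact: young_powR (ltW p1) q1 pq (normr_ge0 _) (gap0 t) th0.
rewrite ge0_integralD//; last 4 first.
- by move=> t _; rewrite -EFinM lee_fin mulr_ge0 ?powR_ge0.
- apply: measurable_funeM; apply/measurable_EFinP; apply: measurable_powR_comp => //.
  exact: (measurableT_comp _ measurable_frac_density).
- by move=> t _; rewrite -EFinM lee_fin mulr_ge0 ?powR_ge0.
- by apply: measurable_funeM; apply/measurable_EFinP; exact: measurable_powR_comp.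
have mphip : measurable_fun setT (fun t => (`|phi t| `^ p)%:E).
  apply/measurable_EFinP; apply: measurable_powR_comp => //.
  exact: (measurableT_comp _ measurable_frac_density).
have mgapq : measurable_fun setT (fun t => (gap t `^ q)%:E).
  by apply/measurable_EFinP; exact: measurable_powR_comp.
rewrite (ge0_integralZl _ measurableT mphip) ?lee_fin ?powR_ge0//.
rewrite (ge0_integralZl _ measurableT mgapq) ?lee_fin ?powR_ge0//.
rewrite PhiE.
have H := @integral_kernel_prod_gap lambda q delta n x l1 q1 l'0 d0.
apply: (@le_trans _ _ ((theta `^ p)%:E * Phi%:E + (theta `^ (- q))%:E * (B * delta `^ (l' / 2))%:E)%E).
  by apply: leeD => //; apply: lee_pmul => //; rewrite ?lee_fin ?powR_ge0//;
    apply: integral_ge0 => t _; rewrite lee_fin powR_ge0.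
rewrite -!EFinM -EFinD lee_fin [leRHS]mulrDl; apply: lerD.
  rewrite mulrC ler_wpM2l// /theta -powRrM.
  by apply: ger_powR; rewrite ?d0 ?d1//= ge_min lexx.
rewrite mulrCA ler_wpM2l// /theta -powRrM -powRD; last by rewrite (gt_eqF d0) implybT.
have -> : l' / (4 * q) * - q + l' / 2 = l' / 4 by field; rewrite gt_eqF.
by apply: ger_powR; rewrite ?d0 ?d1//= ge_min lexx orbT.
all: by move=> t _; rewrite lee_fin powR_ge0.
Qed.

End frac_potential.

End kernel_products.

(** * Dyadic grids *)

Lemma bit0 i : bit i 0 = odd i.
Proof. by rewrite /bit expn0 divn1. Qed.

Lemma bitS i l : bit i l.+1 = bit i./2 l.
Proof. by rewrite /bit expnS divnMA divn2. Qed.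

Lemma bit_small i l : (i < 2 ^ l)%N -> bit i l = false.
Proof. by move=> il; rewrite /bit divn_small. Qed.

Lemma bit_sum N (b : nat -> bool) l :
  bit (\sum_(i < N) b i * 2 ^ i) l = (l < N)%N && b l.
Proof.
elim: N b l => [|N IH] b l; first by rewrite big_ord0 /bit div0n.
have E : (\sum_(i < N.+1) b i * 2 ^ i = b 0 + (\sum_(i < N) b i.+1 * 2 ^ i).*2)%N.
  rewrite big_ord_recl expn0 muln1 -muln2 big_distrl/=; congr addn.
  by apply: eq_bigr => i _; rewrite /bump leq0n add1n expnSr mulnA.
rewrite E; case: l => [|l].
  by rewrite bit0 oddD odd_double addbF oddb.
by rewrite bitS half_bit_double (IH (fun i => b i.+1)).
Qed.

Lemma sum_bit_lt N (b : nat -> bool) : (\sum_(i < N) b i * 2 ^ i < 2 ^ N)%N.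
Proof.
elim: N => [|N IH]; first by rewrite big_ord0.
rewrite big_ord_recr/= expnS mul2n -addnn -addSn leq_add//.
by case: (b N); rewrite ?mul1n ?mul0n.
Qed.

Definition nat_of_bits N (b : {ffun 'I_N -> bool}) : nat :=
  (\sum_(i < N) b i * 2 ^ i)%N.

Definition bits_ext N (b : {ffun 'I_N -> bool}) (i : nat) : bool :=
  oapp b false (insub i).

Lemma bits_extE N (b : {ffun 'I_N -> bool}) (i : 'I_N) : bits_ext b i = b i.
Proof. by rewrite /bits_ext valK. Qed.

Lemma nat_of_bitsE N (b : {ffun 'I_N -> bool}) :
  nat_of_bits b = (\sum_(i < N) bits_ext b i * 2 ^ i)%N.
Proof. by apply: eq_bigr => i _; rewrite bits_extE. Qed.

Lemma nat_of_bits_lt N (b : {ffun 'I_N -> bool}) : (nat_of_bits b < 2 ^ N)%N.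
Proof. by rewrite nat_of_bitsE; exact: sum_bit_lt. Qed.

Lemma bit_nat_of_bits N (b : {ffun 'I_N -> bool}) (l : 'I_N) :
  bit (nat_of_bits b) l = b l.
Proof. by rewrite nat_of_bitsE bit_sum ltn_ord bits_extE. Qed.

Lemma bit_nat_of_bits_ge N (b : {ffun 'I_N -> bool}) l : (N <= l)%N ->
  bit (nat_of_bits b) l = false.
Proof. by move=> Nl; rewrite nat_of_bitsE bit_sum ltnNge Nl. Qed.

Definition ord_of_bits N (b : {ffun 'I_N -> bool}) : 'I_(2 ^ N) :=
  Ordinal (nat_of_bits_lt b).

Lemma ord_of_bits_bij N : bijective (@ord_of_bits N).
Proof.
apply: inj_card_bij; last by rewrite card_ord card_ffun card_bool card_ord.
move=> b b' /(congr1 val)/= E; apply/ffunP => l.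
by rewrite -!bit_nat_of_bits E.
Qed.

Section grid.
Context (R : realType).

Definition dyadic_pt N (b : {ffun 'I_N -> bool}) : R :=
  \sum_(l < N) (b l)%:R / 2 ^+ l.+1.

(** Digit 0 of a point has weight 1/2 but bit 0 of an integer has weight 1, hence the reversal of
    indices. *)
Lemma dyadic_ptE N (b : {ffun 'I_N -> bool}) :
  dyadic_pt b = (nat_of_bits [ffun l => b (rev_ord l)])%:R / 2 ^+ N.
Proof.
rewrite /dyadic_pt /nat_of_bits natr_sum mulr_suml (reindex_inj rev_ord_inj)/=.
apply: eq_bigr => l _; rewrite ffunE natrM natrX -mulrA; congr (_ * _).
have -> : (N - l.+1).+1 = (N - l)%N by rewrite subnSK.
have lN : (l <= N)%N by rewrite ltnW.
have n0 k : (2 : R) ^+ k != 0 by rewrite expf_neq0// pnatr_eq0.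
have -> : 2 ^+ N = 2 ^+ (N - l) * 2 ^+ l :> R by rewrite -exprD subnK.
by rewrite invfM mulrCA divff ?mulr1.
Qed.

Lemma sum_dyadic_pt N (F : R -> R) :
  \sum_(b : {ffun 'I_N -> bool}) F (dyadic_pt b) = \sum_(c < 2 ^ N) F (c%:R / 2 ^+ N).
Proof.
rewrite [RHS](reindex (@ord_of_bits N)); last exact/onW_bij/ord_of_bits_bij.
have rev_inv : involutive (fun b : {ffun 'I_N -> bool} => [ffun l => b (rev_ord l)]).
  by move=> b; apply/ffunP => l; rewrite !ffunE rev_ordK.
rewrite [RHS](reindex_inj (inv_inj rev_inv))/=.
by apply: eq_bigr => b _; rewrite dyadic_ptE.
Qed.

Definition grid_pt s N (x : {ffun 'I_s * 'I_N -> bool}) : 'rV[R]_s :=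
  \row_j \sum_(l < N) (x (j, l))%:R / 2 ^+ l.+1.

(** The grid is a product of one-dimensional grids. This factorization serves both the column sums
    in Schur's test and the partition of the cube into cells. *)
Lemma sum_grid_prod s N (F : 'I_s -> R -> R) :
  \sum_(x : {ffun 'I_s * 'I_N -> bool}) \prod_(j < s) F j (grid_pt x ord0 j) =
  \prod_(j < s) \sum_(c < 2 ^ N) F j (c%:R / 2 ^+ N).
Proof.
under [RHS]eq_bigr do rewrite -sum_dyadic_pt.
rewrite bigA_distr_bigA/=.
rewrite (reindex (fun y : {ffun 'I_s -> {ffun 'I_N -> bool}} =>
   [ffun a => y a.1 a.2] : {ffun 'I_s * 'I_N -> bool}))/=; last first.
  exists (fun x => [ffun j => [ffun l => x (j, l)]]) => [y _|x _].
    by apply/ffunP => j; rewrite ffunE; apply/ffunP => l; rewrite !ffunE.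
  by apply/ffunP => -[j l]; rewrite !ffunE.
apply: eq_bigr => y _; apply: eq_bigr => j _; congr (F _ _).
by rewrite mxE; apply: eq_bigr => l _; rewrite ffunE.
Qed.

End grid.

(** * Increments of fractional integrals *)

Section schur_test.
Context d (T : measurableType d) (R : realType) (mu : {measure set T -> \bar R}).

(* Schur's test in dual form; [theta] is the parameter of the AM-GM inequality
   [2 |eps| |phi| <= theta phi^2 + eps^2 / theta], so that no square root is needed. *)
Lemma schur_test (I : finType) (phi : T -> R) (w eps : I -> R)
    (K : I -> T -> R) (A B Phi theta : R) :
  measurable_fun setT phi -> (\int[mu]_t (phi t ^+ 2)%:E <= Phi%:E)%E ->
  (forall i, measurable_fun setT (K i)) -> (forall i, 0 <= w i) -> 0 < theta ->
  (forall i, (\int[mu]_t (`|K i t|)%:E <= A%:E)%E) ->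
  (forall t, \sum_(i : I) w i * `|K i t| <= B) -> 0 <= B ->
  `|\sum_(i : I) w i * eps i * \int[mu]_t (phi t * K i t)| <=
  (theta * B * Phi + A / theta * \sum_(i : I) w i * eps i ^+ 2) / 2.
Proof.
move=> mphi Phi_ub mK w0 th0 KA KB B0.
apply: le_trans (ler_norm_sum _ _ _) _.
rewrite -lee_fin -sumEFin.
have mphiK i : measurable_fun setT (fun t => phi t * K i t) by exact: measurable_funM.
have mKn i : measurable_fun setT (fun t => `|K i t|).
  exact: (@measurableT_comp _ _ _ _ _ _ (@Num.norm R R)).
have mphi2 : measurable_fun setT (fun t => (phi t ^+ 2)%:E).
  by apply/measurable_EFinP; exact: measurable_funX.
apply: (@le_trans _ _ (\int[mu]_t (\sum_(i : I)
    (w i * `|eps i|)%:E * (`|phi t * K i t|)%:E))%E).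
  rewrite ge0_integral_sum//; last 2 first.
  - move=> i; apply: measurable_funeM; apply/measurable_EFinP.
    exact: (@measurableT_comp _ _ _ _ _ _ (@Num.norm R R)).
  - by move=> i t _; rewrite -EFinM lee_fin mulr_ge0 ?mulr_ge0.
  apply: lee_sum => i _; rewrite ge0_integralZl//; last 2 first.
  - apply/measurable_EFinP; exact: (@measurableT_comp _ _ _ _ _ _ (@Num.norm R R)).
  - by rewrite lee_fin mulr_ge0.
  rewrite !normrM (ger0_norm (w0 i)) EFinM lee_wpmul2l ?lee_fin ?mulr_ge0//.
  exact: normr_Rintegral_le.
apply: (@le_trans _ _ (\int[mu]_t ((theta * B / 2)%:E * (phi t ^+ 2)%:E +
    \sum_(i : I) (w i * eps i ^+ 2 / (2 * theta))%:E * (`|K i t|)%:E))%E).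
  apply: ge0_le_integral => //.
  - by move=> t _; apply: sume_ge0 => i _; rewrite -EFinM lee_fin mulr_ge0 ?mulr_ge0.
  - apply: emeasurable_sum => i; apply: measurable_funeM; apply/measurable_EFinP.
    exact: (@measurableT_comp _ _ _ _ _ _ (@Num.norm R R)).
  - apply: emeasurable_funD; first exact: measurable_funeM.
    by apply: emeasurable_sum => i; apply: measurable_funeM; exact/measurable_EFinP.
  - move=> t _; under eq_bigr do rewrite -EFinM.
    under [X in (_ <= _ + X)%E]eq_bigr do rewrite -EFinM.
    rewrite !sumEFin -EFinM -EFinD lee_fin.
    (* The [phi^2] half of the AM-GM bound is summed over [i] first, where the column bound [B]
       applies; the [eps^2] half is integrated over [t] later, where the row bound [A] applies. *)
    have B2 : \sum_(i : I) theta / 2 * phi t ^+ 2 * (w i * `|K i t|) <=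
        theta * B / 2 * phi t ^+ 2.
      rewrite -mulr_sumr (_ : theta * B / 2 * _ = theta / 2 * phi t ^+ 2 * B); last by ring.
      by rewrite ler_wpM2l// mulr_ge0 ?sqr_ge0// divr_ge0// ltW.
    apply: le_trans (lerD B2 (lexx _)); rewrite -big_split/=; apply: ler_sum => i _.
    rewrite normrM.
    have -> : theta / 2 * phi t ^+ 2 * (w i * `|K i t|) +
        w i * eps i ^+ 2 / (2 * theta) * `|K i t| =
        w i * `|K i t| * ((theta * phi t ^+ 2 + eps i ^+ 2 / theta) / 2).
      by field; rewrite gt_eqF.
    rewrite (_ : w i * `|eps i| * _ = w i * `|K i t| * (`|eps i| * `|phi t|)); last by ring.
    rewrite ler_wpM2l ?mulr_ge0// ler_pdivlMr//.
    have : 0 <= (theta * `|phi t| - `|eps i|) ^+ 2 / theta.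
      by rewrite divr_ge0 ?sqr_ge0// ltW.
    have -> : (theta * `|phi t| - `|eps i|) ^+ 2 / theta =
       theta * `|phi t| ^+ 2 + `|eps i| ^+ 2 / theta - `|eps i| * `|phi t| * 2.
      by field; rewrite gt_eqF.
    by rewrite !real_normK ?num_real// subr_ge0.
rewrite ge0_integralD//; last 4 first.
- by move=> t _; rewrite -EFinM lee_fin mulr_ge0 ?sqr_ge0// divr_ge0// mulr_ge0// ltW.
- exact: measurable_funeM.
- move=> t _; apply: sume_ge0 => i _; rewrite -EFinM lee_fin mulr_ge0// divr_ge0//.
    by rewrite mulr_ge0 ?sqr_ge0.
  by rewrite mulr_ge0// ltW.
- by apply: emeasurable_sum => i; apply: measurable_funeM; exact/measurable_EFinP.
rewrite [(_ + _) / 2]mulrDl EFinD; apply: leeD.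
  rewrite ge0_integralZl//; last 2 first.
  - by move=> t _; rewrite lee_fin sqr_ge0.
  - by rewrite lee_fin divr_ge0// mulr_ge0// ltW.
  rewrite [theta * B * Phi / 2]mulrAC [leRHS]EFinM lee_wpmul2l// lee_fin divr_ge0// mulr_ge0// ltW//.
rewrite ge0_integral_sum//; last 2 first.
- by move=> i; apply: measurable_funeM; exact/measurable_EFinP.
- move=> i t _; rewrite -EFinM lee_fin mulr_ge0// divr_ge0//.
    by rewrite mulr_ge0 ?sqr_ge0.
  by rewrite mulr_ge0// ltW.
have -> : A / theta * (\sum_(i : I) w i * eps i ^+ 2) / 2 =
    \sum_(i : I) w i * eps i ^+ 2 / (2 * theta) * A.
  rewrite mulr_sumr mulr_suml; apply: eq_bigr => i _; field; rewrite gt_eqF//.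
rewrite -sumEFin; apply: lee_sum => i _.
have c0 : 0 <= w i * eps i ^+ 2 / (2 * theta).
  by rewrite divr_ge0// mulr_ge0 ?sqr_ge0// ltW.
rewrite ge0_integralZl ?lee_fin//; last exact/measurable_EFinP.
by rewrite [leRHS]EFinM lee_wpmul2l.
Qed.

End schur_test.

Section frac_density.
Context (R : realType) (n : nat) (p : R) (phi : n.-tuple (measurableTypeR R) -> R).
Hypotheses (p2 : 2 <= p) (phip : phi \in Lfun (cube_measure R n) p%:E).

Let fin_cube : cube_measure R n [set: _] \is a fin_num.
Proof. by rewrite [X in X \is a fin_num]probability_setT. Qed.

Let phi2 : phi \in Lfun (cube_measure R n) 2%:E.
Proof.
have p1 : (1 <= p%:E)%E by rewrite lee_fin (le_trans _ p2)// ler1n.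
have two1 : (1 <= 2%:E :> \bar R)%E by rewrite lee_fin ler1n.
have le2p : (2%:E <= p%:E)%E by rewrite lee_fin.
exact: (Lfun_subset two1 p1 fin_cube le2p phip).
Qed.

Lemma integrable_frac_density : (cube_measure R n).-integrable setT (EFin \o phi).
Proof. by apply/Lfun1_integrable; apply: Lfun_subset12 fin_cube _ phi2. Qed.

Lemma frac_density_sqr_bound : exists Phi : R, 0 <= Phi /\
  (\int[cube_measure R n]_t (phi t ^+ 2)%:E <= Phi%:E)%E.
Proof.
have I := Lfun2_integrable_sqr phi2.
exists (fine (\int[cube_measure R n]_t (phi t ^+ 2)%:E)); split.
  by rewrite fine_ge0//; apply: integral_ge0 => t _; rewrite lee_fin sqr_ge0.
by rewrite fineK//; exact: integrable_fin_num.
Qed.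

Lemma integrable_frac_densityM (K : n.-tuple (measurableTypeR R) -> R) (M : R) :
  measurable_fun setT K -> (forall t, `|K t| <= M) ->
  (cube_measure R n).-integrable setT (fun t => (phi t * K t)%:E).
Proof.
move=> mK KM.
have M0 : 0 <= M by apply: le_trans (KM [tuple of nseq n 0]).
have mphi : measurable_fun setT phi by move: phip; rewrite inE => /andP[/[!inE]].
apply: (le_integrable measurableT _ _ (integrableZl measurableT M integrable_frac_density)).
  by apply/measurable_EFinP; exact: measurable_funM.
move=> t _ /=; rewrite lee_fin !normrM mulrC ler_wpM2r// (le_trans (KM t))//.
exact: ler_norm.
Qed.

End frac_density.

Section increments_of_potentials.
Context (R : realType) (s : nat) (lambda : R).
Hypothesis l01 : 0 < lambda <= 1.
Implicit Types (l : seq ('I_s * R)) (delta : R) (z xi : 'rV[R]_s).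

Definition diff_op l (f : 'rV[R]_s -> R) : 'rV[R]_s -> R :=
  foldr (fun a phi z => phi (z + a.2 *: delta_mx ord0 a.1) - phi z) f l.

(** The effect of [diff_op l] on the factor of coordinate [j] in a product of kernels: steps in
    other coordinates leave this factor alone. *)
Definition diff_kernel delta l (j : 'I_s) : R -> R :=
  foldr (fun a kappa y => if a.1 == j then kappa (y + a.2) - kappa y else kappa y)
    (capped_kernel lambda delta) l.

Lemma diff_kernel_bounded delta l j : 0 < delta ->
  exists M, forall y, `|diff_kernel delta l j y| <= M.
Proof.
move=> d0; have /andP[_ l1] := l01.
elim: l => [|a l [M HM]] /=.
  exists (delta `^ (lambda - 1)) => y; rewrite ger0_norm ?capped_kernel_ge0//.
  rewrite /capped_kernel; case: ifP => _; last exact: powR_ge0.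
  by apply: ler_powR_neg; rewrite ?subr_le0// le_max lexx orbT.
exists (M + M) => y; case: ifP => _; last first.
  by rewrite (le_trans (HM y))// lerDl (le_trans _ (HM y)).
by rewrite (le_trans (ler_normB _ _))// lerD.
Qed.

Lemma measurable_diff_kernel delta l j :
  measurable_fun setT (diff_kernel delta l j : measurableTypeR R -> R).
Proof.
elim: l => [|a l IH] /=; first exact: measurable_capped_kernel.
case: (a.1 == j) => //; apply: measurable_funB => //.
exact: (measurableT_comp IH (measurable_translate a.2)).
Qed.

Lemma measurable_diff_kernelB delta l j y :
  measurable_fun setT ((fun t => diff_kernel delta l j (y - t)) : measurableTypeR R -> R).
Proof. exact: (measurableT_comp (measurable_diff_kernel delta l j) (measurable_reflect y)). Qed.

Lemma diff_kernel_notin delta l j : j \notin unzip1 l ->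
  diff_kernel delta l j = capped_kernel lambda delta.
Proof.
elim: l => [//|a l IH] /=; rewrite in_cons negb_or => /andP[ja jl].
by apply/funext => y; rewrite eq_sym (negbTE ja) IH.
Qed.

Lemma diff_kernel_in delta l j h : uniq (unzip1 l) -> (j, h) \in l ->
  forall y, diff_kernel delta l j y =
    capped_kernel lambda delta (y + h) - capped_kernel lambda delta y.
Proof.
elim: l => [//|[i k] l IH] /= /andP[il ul]; rewrite in_cons => /orP[/eqP[ji hk]|jl] y.
  by rewrite ji hk eqxx diff_kernel_notin.
have ij : (i == j) = false.
  by apply: contraNF il => /eqP ->; apply/mapP; exists (j, h).
by rewrite ij IH.
Qed.

Section one_potential.
Context (u : {set 'I_s}) (p : R) (phi : #|u|.-tuple (measurableTypeR R) -> R).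
Hypotheses (p2 : 2 <= p) (phip : phi \in Lfun (cube_measure R #|u|) p%:E).

Definition diff_kernel_prod delta l z (t : #|u|.-tuple (measurableTypeR R)) : R :=
  \prod_(i < #|u|) diff_kernel delta l (enum_val i) (z ord0 (enum_val i) - tnth t i).

Definition capped_potential delta z : R :=
  \int[cube_measure R #|u|]_t
    (phi t * capped_kernel_prod lambda delta (fun i => z ord0 (enum_val i)) t).

Lemma measurable_diff_kernel_prod delta l z : measurable_fun setT (diff_kernel_prod delta l z).
Proof.
by apply: (@measurable_prod_tnth _ (measurableTypeR R) R #|u|
    (fun i t => diff_kernel delta l (enum_val i) (z ord0 (enum_val i) - t))) => i;
  exact: measurable_diff_kernelB.
Qed.

Lemma diff_kernel_prod_bounded delta l z : 0 < delta ->
  exists M, forall t, `|diff_kernel_prod delta l z t| <= M.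
Proof.
move=> d0.
have [M HM] := boolp.choice (fun j => diff_kernel_bounded l j d0).
exists (\prod_(i < #|u|) M (enum_val i)) => t; rewrite normr_prod.
by apply: ler_prod => i _; rewrite normr_ge0 HM.
Qed.

Lemma integrable_diff_kernel_prod delta l z : 0 < delta ->
  (cube_measure R #|u|).-integrable setT
    (fun t => (phi t * diff_kernel_prod delta l z t)%:E).
Proof.
move=> d0; have [M HM] := diff_kernel_prod_bounded l z d0.
apply: (integrable_frac_densityM p2 phip _ HM).
exact: measurable_diff_kernel_prod.
Qed.

(** A potential indexed by [u] does not depend on the coordinates outside [u], so one step along
    such a coordinate annihilates it. All other steps pass under the integral to the factor of their
    own coordinate; the cap makes every integrand integrable. *)
Lemma diff_op_capped_potential delta l z : 0 < delta ->
  diff_op l (capped_potential delta) z =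
  if all (fun a => a.1 \in u) l then
    \int[cube_measure R #|u|]_t (phi t * diff_kernel_prod delta l z t) else 0.
Proof.
move=> d0; elim: l z => [|[j h] l IH] z /=; first by [].
rewrite !IH; case: (all _ l); last by rewrite subrr andbF.
have coord i : (z + h *: delta_mx ord0 j) ord0 i = z ord0 i + h * (i == j)%:R.
  by rewrite !mxE eqxx.
rewrite andbT; case: ifPn => ju; last first.
  have -> : diff_kernel_prod delta l (z + h *: delta_mx ord0 j) = diff_kernel_prod delta l z.
    apply/funext => t; apply: eq_bigr => i _; rewrite coord.
    by case: eqP => [ij|_]; rewrite ?mulr0 ?addr0//; rewrite -ij enum_valP in ju.
  by rewrite subrr.
rewrite -RintegralB//; last 2 first.
- exact: integrable_diff_kernel_prod.
- exact: integrable_diff_kernel_prod.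
apply: eq_Rintegral => t _; rewrite -mulrBr; congr (_ * _).
pose i0 := enum_rank_in ju j.
have i0E : enum_val i0 = j by rewrite enum_rankK_in.
rewrite /diff_kernel_prod (bigD1 i0)//= [X in _ - X](bigD1 i0)//= [RHS](bigD1 i0)//=.
rewrite coord i0E !eqxx mulr1.
have ne i : i != i0 -> (enum_val i == j) = false.
  by move=> ii0; apply: contraNF ii0 => /eqP; rewrite -{1}i0E => /enum_val_inj ->.
rewrite (eq_bigr (fun i => diff_kernel delta l (enum_val i) (z ord0 (enum_val i) - tnth t i)));
  last by move=> i /ne ij; rewrite coord ij mulr0 addr0.
rewrite [X in _ = _ * X](eq_bigr (fun i =>
    diff_kernel delta l (enum_val i) (z ord0 (enum_val i) - tnth t i))); last first.
  by move=> i /ne ij; rewrite eq_sym ij.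
by rewrite -mulrBl addrAC.
Qed.

End one_potential.

Section grid_steps.
Context (N : nat) (js : seq 'I_s) (k : 'I_s -> nat).
Hypothesis ujs : uniq js.
Let delta : R := (2 ^ N)%:R^-1.
Definition grid_steps : seq ('I_s * R) := [seq (j, (k j)%:R / (2 ^ N)%:R) | j <- js].
(** What differencing gains in coordinate [j], relative to the common constant [6 / lambda], which
    also dominates the bound [2 / lambda] of an undifferenced factor. *)
Definition step_gain j : R := if j \in js then ((k j)%:R / (2 ^ N)%:R) `^ lambda else 1.

Let unzip_steps : unzip1 grid_steps = js.
Proof. by rewrite /unzip1 -map_comp map_id. Qed.

Let delta0 : 0 < delta. Proof. by rewrite invr_gt0 ltr0n expn_gt0. Qed.

Let il0 : 0 < lambda^-1. Proof. by rewrite invr_gt0; case/andP: l01. Qed.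

Lemma step_gain_ge0 j : 0 <= step_gain j.
Proof. by rewrite /step_gain; case: ifP => // _; exact: powR_ge0. Qed.

Lemma integral_diff_kernel j y :
  (\int[uniform_prob (@ltr01 R)]_t (`|diff_kernel delta grid_steps j (y - t)|)%:E
   <= (6 / lambda * step_gain j)%:E)%E.
Proof.
have n0 : (0 < 2 ^ N)%N by rewrite expn_gt0.
rewrite /step_gain; case: ifPn => jjs.
  rewrite [leLHS](_ : _ = \int[uniform_prob (@ltr01 R)]_t
    (`|capped_kernel lambda delta (y + (k j)%:R / (2 ^ N)%:R - t) -
       capped_kernel lambda delta (y - t)|)%:E)%E.
    exact: integral_increment_capped_kernel.
  apply: eq_integral => t _; rewrite (@diff_kernel_in _ _ _ ((k j)%:R / (2 ^ N)%:R)).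
  - by rewrite addrAC.
  - by rewrite unzip_steps.
  - by apply/mapP; exists j.
rewrite diff_kernel_notin ?unzip_steps//.
under eq_integral do rewrite ger0_norm ?capped_kernel_ge0//.
apply: le_trans (integral_capped_kernel y l01 n0) _.
by rewrite lee_fin mulr1 ler_pM2r// ler_nat.
Qed.

Lemma sum_diff_kernel j y :
  \sum_(c < 2 ^ N) delta * `|diff_kernel delta grid_steps j (c%:R / 2 ^+ N + y)|
  <= 6 / lambda * step_gain j.
Proof.
have dN : (2 ^+ N)^-1 = delta by rewrite /delta natrX.
rewrite dN /step_gain; case: ifPn => jjs.
  rewrite (eq_bigr (fun c : 'I_(2 ^ N) => delta *
    `|capped_kernel lambda delta (y + c%:R * delta + (k j)%:R * delta) -
      capped_kernel lambda delta (y + c%:R * delta)|)).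
    exact: sum_increment_capped_kernel.
  move=> c _; rewrite (@diff_kernel_in _ _ _ ((k j)%:R / (2 ^ N)%:R)).
  - by rewrite (addrC y).
  - by rewrite unzip_steps.
  - by apply/mapP; exists j.
rewrite diff_kernel_notin ?unzip_steps//.
under eq_bigr do rewrite ger0_norm ?capped_kernel_ge0// addrC.
apply: le_trans (sum_capped_kernel y _ l01 delta0) _.
rewrite mulfV ?pnatr_eq0 ?expn_eq0// powR1.
by rewrite ler_wpM2r// ler_pM2r// ler_nat.
Qed.

Lemma prod_step_gain (u : {set 'I_s}) : all (fun a => a.1 \in u) grid_steps ->
  \prod_(i < #|u|) (6 / lambda * step_gain (enum_val i)) <=
  (6 / lambda) ^+ s * \prod_(j <- js) ((k j)%:R / (2 ^ N)%:R) `^ lambda.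
Proof.
move=> au; rewrite big_split/= prodr_const card_ord.
have -> : \prod_(i < #|u|) step_gain (enum_val i) =
    \prod_(j <- js) ((k j)%:R / (2 ^ N)%:R) `^ lambda.
  rewrite -(big_enum_val (fun j => step_gain j))/=.
  rewrite [RHS]big_uniq//= /step_gain.
  rewrite big_mkcond/= [RHS]big_mkcond/=; apply: eq_bigr => j _.
  case: ifPn => // ju; rewrite ifF//; apply: contraNF ju => jjs.
  by move/allP: au => /(_ (j, (k j)%:R / (2 ^ N)%:R)); apply; apply/mapP; exists j.
apply: ler_wpM2r; first by apply: prodr_ge0 => j _; exact: powR_ge0.
have /andP[l0 l1] := l01.
apply: ler_weXn2l; last by rewrite -[X in (_ <= X)%N]card_ord max_card.
by rewrite ler_pdivlMr// mul1r (le_trans l1)// ler1n.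
Qed.

(** The column bound in Schur's test. The sum over the grid factorizes; a coordinate outside [u]
    contributes [2^N] terms of size [delta], that is 1. The index of [j] in [enum u] locates its
    slot in the tuple [t]. *)
Lemma sum_diff_kernel_prod (u : {set 'I_s}) xi (t : #|u|.-tuple (measurableTypeR R)) :
  \sum_(x : {ffun 'I_s * 'I_N -> bool})
    delta ^+ s * `|diff_kernel_prod delta grid_steps (grid_pt R x + xi) t|
  <= \prod_(i < #|u|) (6 / lambda * step_gain (enum_val i)).
Proof.
pose F (j : 'I_s) (y : R) := delta * (if j \in u then
  `|diff_kernel delta grid_steps j (y + (xi ord0 j - nth 0 t (index j (enum u))))| else 1).
rewrite (eq_bigr (fun x => \prod_(j < s) F j (grid_pt R x ord0 j))); last first.
  move=> x _; rewrite big_split/= prodr_const card_ord; congr (_ * _).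
  rewrite normr_prod -[RHS](big_mkcond (fun j => j \in u) (fun j =>
    `|diff_kernel delta grid_steps j
       (grid_pt R x ord0 j + (xi ord0 j - nth 0 t (index j (enum u))))|)).
  rewrite [RHS]big_enum_val/=; apply: eq_bigr => i _.
  rewrite mxE addrA; congr (`|diff_kernel _ _ _ (_ - _)|).
  rewrite (tnth_nth 0); congr (nth _ _ _).
  by rewrite (enum_val_nth (enum_val i)) index_uniq ?enum_uniq// -cardE.
rewrite sum_grid_prod.
rewrite [leRHS](_ : _ = \prod_(j < s) (if j \in u then 6 / lambda * step_gain j else 1)); last first.
  rewrite -[RHS](big_mkcond (fun j => j \in u) (fun j => 6 / lambda * step_gain j)).
  by rewrite [RHS]big_enum_val.
apply: ler_prod => j _; apply/andP; split.
  by apply: sumr_ge0 => c _; rewrite mulr_ge0 ?(ltW delta0)//; case: ifP.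
rewrite /F; case: ifPn => ju; first exact: sum_diff_kernel.
rewrite sumr_const card_ord mulr1 -[leLHS]mulr_natr mulVf//.
Qed.

(** Schur's test with one constant for rows and columns, since the continuous and the discrete
    kernel bounds coincide. The shift [xi] is harmless because both bounds are uniform in
    translations. *)
Lemma sum_diff_op_capped_potential (u : {set 'I_s}) (p Phi : R)
    (phi : #|u|.-tuple (measurableTypeR R) -> R) xi
    (eps : {ffun 'I_s * 'I_N -> bool} -> R) (theta : R) :
  2 <= p -> phi \in Lfun (cube_measure R #|u|) p%:E ->
  (\int[cube_measure R #|u|]_t (phi t ^+ 2)%:E <= Phi%:E)%E -> 0 < theta -> 0 <= Phi ->
  `|\sum_x delta ^+ s * eps x *
     diff_op grid_steps (capped_potential phi delta) (grid_pt R x + xi)| <=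
  (6 / lambda) ^+ s * (\prod_(j <- js) ((k j)%:R / (2 ^ N)%:R) `^ lambda) *
  (theta * Phi + theta^-1 * \sum_x delta ^+ s * eps x ^+ 2).
Proof.
move=> p2 phip PhiE th0 Phi0.
set W := _ * \prod_(_ <- _) _.
have W0 : 0 <= W.
  rewrite mulr_ge0 ?exprn_ge0 ?mulr_ge0 ?(ltW il0)//.
  by apply: prodr_ge0 => j _; exact: powR_ge0.
set S := \sum_x delta ^+ s * eps x ^+ 2.
have S0 : 0 <= S.
  by apply: sumr_ge0 => x _; rewrite mulr_ge0 ?sqr_ge0// exprn_ge0// ltW.
under eq_bigr do rewrite (diff_op_capped_potential p2 phip)//.
have [au|_] := boolP (all (fun a => a.1 \in u) grid_steps); last first.
  under eq_bigr do rewrite mulr0.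
  rewrite big1// normr0 mulr_ge0// addr_ge0 ?mulr_ge0 ?invr_ge0//; exact: ltW.
have A0 : 0 <= \prod_(i < #|u|) (6 / lambda * step_gain (enum_val i)).
  by apply: prodr_ge0 => i _; rewrite !mulr_ge0 ?step_gain_ge0// ltW.
have AW := prod_step_gain au.
set A := \prod_(i < #|u|) _ in A0 AW.
have mphi : measurable_fun setT phi by move: phip; rewrite inE => /andP[/[!inE]].
apply: le_trans (@schur_test _ _ R (cube_measure R #|u|) _ phi (fun=> delta ^+ s) eps
  (fun x => diff_kernel_prod delta grid_steps (grid_pt R x + xi)) A A Phi theta
  mphi PhiE _ _ th0 _ _ A0) _.
- by move=> x; exact: measurable_diff_kernel_prod.
- by move=> x; rewrite exprn_ge0// ltW.
- move=> x; under eq_integral do rewrite normr_prod.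
  apply: (@integral_prod_tnth_le R _ (measurableTypeR R) _ _
    (fun i t => `|diff_kernel delta grid_steps (enum_val i)
       ((grid_pt R x + xi) ord0 (enum_val i) - t)|)).
  + move=> i; apply: (@measurableT_comp _ _ _ _ _ _ (@Num.norm R R)) => //.
    exact: measurable_diff_kernelB.
  + by move=> i t; exact: normr_ge0.
  + by move=> i; exact: integral_diff_kernel.
- by move=> t; exact: sum_diff_kernel_prod.
rewrite -/S.
apply: (@le_trans _ _ (A * (theta * Phi + theta^-1 * S))).
  rewrite (_ : _ / 2 = A * (theta * Phi + theta^-1 * S) / 2); last by ring.
  rewrite ler_pdivrMr// ler_peMr ?ler1n// mulr_ge0// addr_ge0 ?mulr_ge0 ?invr_ge0//;
  exact: ltW.
by apply: ler_wpM2r => //; rewrite addr_ge0 ?mulr_ge0 ?invr_ge0//; exact: ltW.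
Qed.

End grid_steps.

Lemma diff_opD l f g z :
  diff_op l (fun z => f z + g z) z = diff_op l f z + diff_op l g z.
Proof. by elim: l z => [//|a l IH] z /=; rewrite !IH; ring. Qed.

Lemma diff_op_lin (I : finType) (c : I -> R) (f : I -> 'rV[R]_s -> R) l z :
  diff_op l (fun z => \sum_i c i * f i z) z = \sum_i c i * diff_op l (f i) z.
Proof.
elim: l z => [//|a l IH] z /=; rewrite !IH -sumrB.
by apply: eq_bigr => i _; rewrite mulrBr.
Qed.

Lemma normr_diff_op_le l f M z : (forall z, `|f z| <= M) ->
  `|diff_op l f z| <= 2 ^+ size l * M.
Proof.
move=> fM; elim: l z => [|a l IH] z /=; first by rewrite mul1r.
rewrite exprS -mulrA mulr_natl mulr2n (le_trans (ler_normB _ _))//.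
by rewrite lerD.
Qed.

Lemma exists_pos_lower_bound (I : finType) (w : I -> R) : (forall i, 0 < w i) ->
  exists omega, 0 < omega /\ forall i, omega <= w i.
Proof.
move=> w0; have S0 : 0 <= \sum_i (w i)^-1.
  by apply: sumr_ge0 => i _; rewrite invr_ge0 ltW.
have S1 : 0 < \sum_i (w i)^-1 + 1 by rewrite ltr_wpDl.
exists (\sum_i (w i)^-1 + 1)^-1; rewrite invr_gt0; split => // i.
rewrite invf_ple ?posrE// (bigD1 i)//= -addrA lerDl.
by rewrite addr_ge0// sumr_ge0// => j _; rewrite invr_ge0 ltW.
Qed.

(* The last term is the price of replacing the fractional kernels by the capped ones; it
   is harmless since [N] tends to infinity. *)
Lemma frac_integral_increment_bound (p : R) (D : frac_family R s) :
  2 <= p -> lambda^-1 < p ->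
  (forall u : {set 'I_s}, D u \in Lfun (cube_measure R #|u|) p%:E) ->
  exists C omega : R, [/\ 0 <= C, 0 < omega &
    forall N (js : seq 'I_s) (k : 'I_s -> nat) xi
      (eps : {ffun 'I_s * 'I_N -> bool} -> R) theta, uniq js -> 0 < theta ->
    `|\sum_x (2 ^ N)%:R^-1 ^+ s * eps x *
       diff_op (grid_steps N js k) (frac_integral lambda D) (grid_pt R x + xi)| <=
    C * (\prod_(j <- js) ((k j)%:R / (2 ^ N)%:R) `^ lambda) *
      (theta + theta^-1 * \sum_x (2 ^ N)%:R^-1 ^+ s * eps x ^+ 2) +
    C * (2 ^ N)%:R^-1 `^ omega * \sum_x (2 ^ N)%:R^-1 ^+ s * `|eps x|].
Proof.
move=> p2 lp HD.
have [Phi HPhi] := boolp.choice (fun u => frac_density_sqr_bound p2 (HD u)).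
have /boolp.choice[Cw HCw] (u : {set 'I_s}) : exists c : R * R, [/\ 0 <= c.1, 0 < c.2 &
  forall delta (x : 'I_#|u| -> R), 0 < delta <= 1 ->
  `|\int[cube_measure R #|u|]_t (D u t * frac_kernel_prod lambda x t) -
    \int[cube_measure R #|u|]_t (D u t * capped_kernel_prod lambda delta x t)|
  <= c.1 * delta `^ c.2].
  have [C [w [C0 w0 H]]] := capped_potential_approx l01 p2 lp (HD u).
  by exists (C, w).
have Cw0 u : 0 < (Cw u).2 by have [] := HCw u.
have [om [om0 omw]] := exists_pos_lower_bound Cw0.
pose c (u : {set 'I_s}) := Gamma lambda ^- #|u|.
pose C1 := \sum_u `|c u| * (6 / lambda) ^+ s * (Phi u + 1).
pose C2 := 2 ^+ s * \sum_u `|c u| * (Cw u).1.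
have il0 : 0 <= lambda^-1 by rewrite invr_ge0; case/andP: l01 => /ltW.
have Phi0 u : 0 <= Phi u by have [] := HPhi u.
have C10 : 0 <= C1.
  by apply: sumr_ge0 => u _; rewrite !mulr_ge0 ?exprn_ge0 ?mulr_ge0// addr_ge0.
have C20 : 0 <= C2.
  by rewrite mulr_ge0 ?exprn_ge0// sumr_ge0// => u _; rewrite mulr_ge0//; have [] := HCw u.
exists (C1 + C2), om; split => //; first exact: addr_ge0.
move=> N js k xi eps theta ujs th0.
have N0 : 0 < (2 ^ N)%:R :> R by rewrite ltr0n expn_gt0.
set delta := (2 ^ N)%:R^-1.
have d0 : 0 < delta by rewrite invr_gt0.
have d1 : delta <= 1 by rewrite invf_le1// ler1n expn_gt0.
pose Q z := \sum_u c u * capped_potential (D u) delta z.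
(* The capping error is bounded at every point, inside or outside the cube, so its differences are
   estimated by brute force with a factor 2 for each of at most [s] steps. *)
pose r z := frac_integral lambda D z - Q z.
have rM z : `|r z| <= delta `^ om * \sum_u `|c u| * (Cw u).1.
  rewrite /r /frac_integral /Q -sumrB mulr_sumr; apply: le_trans (ler_norm_sum _ _ _) _.
  apply: ler_sum => u _; rewrite -mulrBr normrM mulrCA ler_wpM2l//.
  have [C0 w0 H] := HCw u.
  have /= := H delta (fun i => z ord0 (enum_val i)).
  rewrite d0 d1 => /(_ isT) H'; apply: le_trans H' _; rewrite mulrC ler_wpM2r//.
  by apply: ger_powR; rewrite ?d0 ?d1.
have E z : diff_op (grid_steps N js k) (frac_integral lambda D) z =
    \sum_u c u * diff_op (grid_steps N js k) (capped_potential (D u) delta) z +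
    diff_op (grid_steps N js k) r z.
  rewrite -diff_op_lin -diff_opD; congr (diff_op _ _ _).
  by apply/funext => y; rewrite /r /Q addrC subrK.
have szl : (size (grid_steps N js k) <= s)%N.
  rewrite size_map -[X in (_ <= X)%N]card_ord -(card_uniqP ujs); exact: max_card.
set W := \prod_(j <- js) _; set S := \sum_x delta ^+ s * eps x ^+ 2.
have W0 : 0 <= W by apply: prodr_ge0 => j _; exact: powR_ge0.
have S0 : 0 <= S.
  by apply: sumr_ge0 => x _; rewrite mulr_ge0 ?sqr_ge0// exprn_ge0// ltW.
set S1 := \sum_x delta ^+ s * `|eps x|.
have S10 : 0 <= S1.
  by apply: sumr_ge0 => x _; rewrite mulr_ge0 ?normr_ge0// exprn_ge0// ltW.
have ithS : 0 <= theta^-1 * S by rewrite mulr_ge0 ?invr_ge0// ltW.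
under eq_bigr do rewrite E mulrDr.
rewrite big_split/=; apply: le_trans (ler_normD _ _) _; apply: lerD.
  apply: (@le_trans _ _ (C1 * W * (theta + theta^-1 * S))); last first.
    by rewrite ler_wpM2r ?addr_ge0 ?(ltW th0)// ler_wpM2r// lerDl.
  under eq_bigr do rewrite mulr_sumr.
  rewrite exchange_big/=; apply: le_trans (ler_norm_sum _ _ _) _.
  rewrite -mulrA mulr_suml; apply: ler_sum => u _.
  under eq_bigr do rewrite mulrCA.
  rewrite -mulr_sumr normrM -[leRHS]mulrA -[leRHS]mulrA ler_wpM2l//.
  have [P0 HP] := HPhi u.
  apply: le_trans (sum_diff_op_capped_potential k ujs xi eps p2 (HD u) HP th0 P0) _.
  rewrite -/delta -/S -/W -mulrA ler_wpM2l ?exprn_ge0 ?mulr_ge0//.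
  rewrite [leRHS]mulrCA ler_wpM2l//.
  have -> : (Phi u + 1) * (theta + theta^-1 * S) =
      theta * Phi u + theta^-1 * S + (Phi u * (theta^-1 * S) + theta) by ring.
  by rewrite lerDl addr_ge0 ?(ltW th0)// mulr_ge0.
apply: (@le_trans _ _ (C2 * delta `^ om * S1)); last first.
  by rewrite ler_wpM2r// ler_wpM2r ?powR_ge0// lerDr.
apply: le_trans (ler_norm_sum _ _ _) _.
rewrite mulr_sumr; apply: ler_sum => x _.
rewrite !normrM (ger0_norm (exprn_ge0 _ (ltW d0))) mulrC ler_wpM2r//.
  by rewrite mulr_ge0 ?exprn_ge0// ltW.
apply: le_trans (normr_diff_op_le _ _ rM) _.
rewrite /C2 -mulrA (mulrC (\sum_u _)).
apply: ler_wpM2r; last by apply: ler_weXn2l => //; rewrite ler1n.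
by rewrite mulr_ge0 ?powR_ge0// sumr_ge0// => u _; rewrite mulr_ge0//; have [] := HCw u.
Qed.

End increments_of_potentials.

(** * Mixed derivatives *)

Section mean_value.
Context (R : realType) (s : nat).
Implicit Types (z xi : 'rV[R]_s) (j : 'I_s) (f g : 'rV[R]_s -> R) (L : seq (R * 'rV[R]_s)).

Local Notation "z +_ j h" := (z + h *: delta_mx ord0 j)
  (at level 50, j at level 2, h at level 10).

Lemma unit_cube_segment z j (h t : R) : unit_cube z -> unit_cube (z +_j h) ->
  0 <= t <= h -> unit_cube (z +_j t).
Proof.
move=> cz czh /andP[t0 th] i; have := cz i; have := czh i; rewrite !mxE eqxx/=.
case: (i == j); rewrite ?mulr0 ?addr0//= !mulr1 => /andP[a b] /andP[c d].
by apply/andP; split; lra.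
Qed.

Lemma diff_quotient_near f z j (t l e : R) : 0 < e ->
  diff_quotient f (z +_j t) j h @[h --> increments (z +_j t) j] --> l ->
  exists2 d : R, 0 < d & forall h, h != 0 -> `|h| < d -> unit_cube (z +_j (t + h)) ->
    `|l - (f (z +_j (t + h)) - f (z +_j t)) / h| < e.
Proof.
move=> e0 /cvgrPdist_lt /(_ e e0).
rewrite /increments /within/= => -[d /= d0 H].
exists d => // h h0 hd ch.
have E : z +_j t + h *: delta_mx ord0 j = z +_j (t + h) by rewrite scalerDl addrA.
have := H h; rewrite /diff_quotient E; apply => //.
by rewrite /ball/= sub0r normrN.
Qed.

(** A difference quotient with a finite limit stays bounded, by [|l| + 1], and this forces
    continuity along the line. One-sided limits suffice at the ends of the segment, which is what
    the mean value theorem asks for. *)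
Lemma partial_continuous f z j (h : R) : partial_exists j f ->
  unit_cube z -> unit_cube (z +_j h) ->
  {within `[0, h], continuous (fun t => f (z +_j t))}.
Proof.
move=> pf cz czh; apply/subspace_continuousP => t; rewrite /= in_itv/= => th.
have ct : unit_cube (z +_j t) by exact: unit_cube_segment th.
have /cvg_ex[l] := pf _ ct => /(diff_quotient_near ltr01)[d d0 H].
apply/cvgrPdist_lt => e e0; rewrite near_withinE.
have l1 : 0 < `|l| + 1 by rewrite ltr_wpDl.
exists (Num.min d (e / (`|l| + 1))) => /=; first by rewrite lt_min d0 divr_gt0.
move=> y; rewrite /ball/= lt_min => /andP[yd ye]; rewrite in_itv/= => yh.
have [->|yt] := eqVneq y t; first by rewrite subrr normr0.
have tyE : t + (y - t) = y by rewrite addrC subrK.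
have cy : unit_cube (z +_j (t + (y - t))) by rewrite tyE; exact: unit_cube_segment yh.
have yt0 : y - t != 0 by rewrite subr_eq0.
have := H _ yt0; rewrite distrC => /(_ yd cy); rewrite tyE => Hy.
set q := (_ / _) in Hy.
have -> : f (z +_j t) - f (z +_j y) = - (q * (y - t)) by rewrite /q divfK// opprB.
rewrite normrN normrM (distrC y t) -ltr_pdivlMr//.
rewrite distrC in ye *; rewrite (distrC y t) in ye *.
have q1 : `|q| < `|l| + 1.
  by rewrite -(subrK l q) (le_lt_trans (ler_normD _ _))// addrC ltrD2l distrC.
rewrite ltr_pdivlMr ?normr_gt0 1?distrC//.
apply: (@le_lt_trans _ _ ((`|l| + 1) * `|y - t|)).
  by rewrite ler_wpM2r// ltW.
  by rewrite mulrC -ltr_pdivlMr// distrC.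
all: by rewrite ?normr_gt0 subr_eq0 eq_sym.
Qed.

(** At an interior [t] all small increments stay in the cube, so the restricted limit is an ordinary
    derivative. *)
Lemma partial_is_derive f z j (h t : R) : partial_exists j f ->
  unit_cube z -> unit_cube (z +_j h) -> t \in `]0, h[%R ->
  is_derive t 1 (fun t => f (z +_j t)) (partial j f (z +_j t)).
Proof.
move=> pf cz czh; rewrite in_itv/= => /andP[t0 th].
have t0h : 0 <= t <= h by rewrite !ltW.
have ct : unit_cube (z +_j t) by exact: unit_cube_segment t0h.
have cv : diff_quotient f (z +_j t) j h @[h --> increments (z +_j t) j] -->
    partial j f (z +_j t) by exact: pf.
have D : (fun k => k^-1 *: (f (z +_j (k *: 1 + t)) - f (z +_j t))) @ 0^' -->
    partial j f (z +_j t).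
  apply/cvgrPdist_lt => e e0.
  have [d d0 H] := diff_quotient_near e0 cv.
  rewrite near_withinE.
  exists (Num.min d (Num.min t (h - t))) => /=; first by rewrite !lt_min d0 t0 subr_gt0.
  move=> k; rewrite /ball/= sub0r normrN !lt_min => /andP[kd /andP[kt kh]] k0.
  have := H k k0 kd; rewrite [k *: 1]mulr1 (addrC k) [_^-1 *: _]mulrC; apply.
  apply: (unit_cube_segment cz czh); move: kt kh; rewrite !ltr_norml.
  by move=> /andP[a b] /andP[c e']; apply/andP; split; lra.
apply: DeriveDef; first by apply/cvg_ex; eexists; exact: D.
exact: cvg_lim D.
Qed.

(** A list of weighted points rather than a sum over the grid: a difference operator can then be
    absorbed by duplicating the points with opposite weights, and the mean value theorem is used
    again on the longer list. *)
Definition cube_sum L (phi : 'rV[R]_s -> R) : R := \sum_(a <- L) a.1 * phi a.2.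

(* The mean value theorem is applied to the whole weighted sum, so that a single shift [t]
   serves all the points; sums of squares are reached by letting the weights be the
   differences themselves. *)
Lemma cube_sum_MVT L f j (h : R) : 0 <= h -> partial_exists j f ->
  (forall a, a \in L -> unit_cube a.2 /\ unit_cube (a.2 +_j h)) ->
  exists2 t : R, 0 <= t <= h &
    cube_sum L (fun z => f (z +_j h) - f z) =
    h * cube_sum L (fun z => partial j f (z +_j t)).
Proof.
move=> h0 pf HL.
pose F (t : R) := cube_sum L (fun z => f (z +_j t)).
pose dF (t : R) := cube_sum L (fun z => partial j f (z +_j t)).
have [dFP cF] : (forall t : R, t \in `]0, h[%R -> is_derive t 1 F (dF t)) /\
    {within `[0, h], continuous F}.
  rewrite /F /dF /cube_sum; elim: L HL {F dF} => [|a L IH] HL.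
    split=> [t _|].
      under eq_fun do rewrite big_nil; rewrite big_nil; exact: is_derive_cst.
    rewrite (_ : (fun _ => _) = fun=> 0); first by move=> t; exact: cvg_cst.
    by apply/funext => t; rewrite big_nil.
  have [ca cah] : unit_cube a.2 /\ unit_cube (a.2 +_j h) by apply: HL; rewrite mem_head.
  have [IHd IHc] := IH (fun b bL => HL b (mem_behead (s := a :: L) bL)).
  split=> [t th|].
    under eq_fun do rewrite big_cons; rewrite big_cons.
    have D1 := partial_is_derive pf ca cah th.
    have D2 := IHd t th.
    have D3 : is_derive t 1 (a.1 \*: (fun t => f (a.2 +_j t))) (a.1 *: partial j f (a.2 +_j t)).
      exact: is_deriveZ.
    exact: is_deriveD.
  rewrite (_ : (fun _ => _) = fun t : R => a.1 * f (a.2 +_j t) +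
    \sum_(a <- L) a.1 * f (a.2 +_j t)); last by apply/funext => t; rewrite big_cons.
  move=> t; apply: cvgD; last exact: IHc.
  by apply: cvgM; [exact: cvg_cst|exact: (partial_continuous pf ca cah)].
have [c ch Hc] := MVT_segment h0 dFP cF.
exists c; first by move: ch; rewrite in_itv.
rewrite subr0 in Hc; rewrite mulrC [RHS](_ : _ = dF c * h)// -Hc.
rewrite /F /cube_sum -sumrB; apply: eq_bigr => a _.
by rewrite mulrBr scale0r addr0.
Qed.

Lemma diff_op_translate (l : seq ('I_s * R)) f xi z :
  diff_op l (fun z => f (z + xi)) z = diff_op l f (z + xi).
Proof. by elim: l z => [//|a l IH] z /=; rewrite !IH addrAC. Qed.

Definition steps_total (l : seq ('I_s * R)) i : R := \sum_(a <- l | a.1 == i) a.2.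

(** The second part records how far the new points may move, which keeps them in the cube when
    further operators are applied. *)
Lemma cube_sum_diff_op L (l : seq ('I_s * R)) : (forall a, a \in l -> 0 <= a.2) ->
  exists L', (forall phi, cube_sum L (diff_op l phi) = cube_sum L' phi) /\
    forall b, b \in L' -> exists2 a, a \in L &
      forall i, a.2 ord0 i <= b.2 ord0 i <= a.2 ord0 i + steps_total l i.
Proof.
elim: l L => [|[j h] l IH] L l0.
  exists L; split=> // b bL; exists b => // i.
  by rewrite /steps_total big_nil addr0 lexx.
pose L1 := [seq (a.1, a.2 +_j h) | a <- L] ++ [seq (- a.1, a.2) | a <- L].
have [L' [E H]] := IH L1 (fun a al => l0 a (mem_behead (s := (j, h) :: l) al)).
have h0 : 0 <= h by apply: (l0 (j, h)); rewrite mem_head.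
exists L'; split=> [phi|b /H[a + Ha]].
  rewrite -E /cube_sum /L1 big_cat/= !big_map -big_split/=; apply: eq_bigr => a _.
  by rewrite mulrBr mulNr.
have T i : steps_total ((j, h) :: l) i = (if j == i then h else 0) + steps_total l i.
  by rewrite /steps_total big_cons/=; case: ifP => _; rewrite ?add0r.
rewrite mem_cat => /orP[] /mapP[a' a'L aE]; exists a' => // i; have := Ha i;
  rewrite T aE/= ?mxE ?eqxx/= => /andP[b1 b2]; apply/andP; split.
- by rewrite (le_trans _ b1)// lerDl mulr_ge0.
- by rewrite (le_trans b2)// addrA lerD2r lerD2l eq_sym; case: eqP; rewrite ?mulr1 ?mulr0.
- by [].
- by rewrite (le_trans b2)// lerD2l lerDr; case: ifP.
Qed.

Lemma diff_op_cat (l l' : seq ('I_s * R)) f : diff_op (l ++ l') f = diff_op l (diff_op l' f).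
Proof. by rewrite /diff_op foldr_cat. Qed.

(** The outermost difference is absorbed in the list while the inner ones become derivatives; it is
    then restored and converted by one more mean value step. The successive shifts along [j] add up
    to a single [t]. *)
Lemma cube_sum_iter_partial L f j (hs : seq R) :
  (forall h, h \in hs -> 0 <= h) ->
  (forall i, (i < size hs)%N -> partial_exists j (iter i (partial j) f)) ->
  (forall a, a \in L -> unit_cube a.2 /\ unit_cube (a.2 +_j (\sum_(h <- hs) h))) ->
  exists2 t : R, 0 <= t <= \sum_(h <- hs) h &
    cube_sum L (diff_op [seq (j, h) | h <- hs] f) =
    (\prod_(h <- hs) h) * cube_sum L (fun z => iter (size hs) (partial j) f (z +_j t)).
Proof.
elim: hs L => [|h hs IH] L hs0 pf HL.
  exists 0; rewrite ?big_nil ?lexx// mul1r.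
  by rewrite /cube_sum; apply: eq_bigr => a _; rewrite scale0r addr0.
have h0 : 0 <= h by apply: hs0; rewrite mem_head.
have S0 : 0 <= \sum_(h <- hs) h.
  by rewrite big_seq; apply: sumr_ge0 => k khs; apply: hs0; rewrite in_cons khs orbT.
have cubes (t : R) a : a \in L -> 0 <= t <= h + \sum_(h <- hs) h -> unit_cube (a.2 +_j t).
  move=> aL th; have [c1 c2] := HL a aL; apply: (unit_cube_segment c1 c2).
  by rewrite big_cons.
pose L1 := [seq (a.1, a.2 +_j h) | a <- L] ++ [seq (- a.1, a.2) | a <- L].
have [||| t /andP[t0 tS] Ht] := IH L1.
- by move=> k khs; apply: hs0; rewrite in_cons khs orbT.
- by move=> i ihs; apply: pf; rewrite /= (ltn_trans ihs).
- move=> b; rewrite mem_cat => /orP[] /mapP[a aL ->]/=; split.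
  + by apply: cubes => //; rewrite h0/= lerDl.
  + by rewrite -addrA -scalerDl; apply: cubes => //; rewrite addr_ge0 ?lexx.
  + by have [] := HL a aL.
  + by apply: cubes => //; rewrite S0/= lerDr.
set g := iter (size hs) (partial j) f in Ht.
pose L2 := [seq (a.1, a.2 +_j t) | a <- L].
have [|| t' /andP[t'0 t'h] Ht'] := @cube_sum_MVT L2 g j h h0.
- by apply: pf => /=.
- move=> b /mapP[a aL ->]/=; split; first by apply: cubes => //; apply/andP; split; lra.
  by rewrite -addrA -scalerDl; apply: cubes => //; apply/andP; split; lra.
exists (t + t').
  by rewrite big_cons; apply/andP; split; lra.
rewrite big_cons [LHS](_ : _ = cube_sum L1 (diff_op [seq (j, k) | k <- hs] f)); last first.
  rewrite /cube_sum /L1 big_cat/= !big_map -big_split/=; apply: eq_bigr => a _.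
  by rewrite mulrBr mulNr.
rewrite Ht [cube_sum L1 _](_ : _ = cube_sum L2 (fun z => g (z +_j h) - g z)); last first.
  rewrite /cube_sum /L1 /L2 big_cat/= !big_map -big_split/=; apply: eq_bigr => a _.
  by rewrite mulrBr mulNr /= addrAC.
rewrite Ht' mulrA (mulrC _ h) -/g; congr (_ * _).
rewrite /cube_sum /L2 big_map; apply: eq_bigr => a _ /=.
by rewrite -addrA -scalerDl.
Qed.

Definition coord_steps (hss : 'I_s -> seq R) (js : seq 'I_s) : seq ('I_s * R) :=
  flatten [seq [seq (j, h) | h <- hss j] | j <- js].

Lemma steps_total_coord (hs : seq R) i j :
  steps_total [seq (j, h) | h <- hs] i = if i == j then \sum_(h <- hs) h else 0.
Proof.
by rewrite /steps_total big_map/=; have [ij|ij] := eqVneq i j; rewrite ?big_pred0_eq.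
Qed.

(** Derivatives exist only in the order fixed by [mixed_seq], and no commutation of partial
    derivatives is invoked. Differences commute with translations, so those along [j] wait in the
    list until the later variables of [js] have been differentiated. *)
Lemma cube_sum_mixed_seq L f (js : seq 'I_s) (hss : 'I_s -> seq R) :
  uniq js -> (forall j h, h \in hss j -> 0 <= h) ->
  mixed_seq_exists js (fun j => size (hss j)) f ->
  (forall a i, a \in L -> 0 <= a.2 ord0 i /\
     a.2 ord0 i + (if i \in js then \sum_(h <- hss i) h else 0) <= 1) ->
  exists2 xi : 'rV[R]_s,
    (forall i, 0 <= xi ord0 i <= if i \in js then \sum_(h <- hss i) h else 0) &
    cube_sum L (diff_op (coord_steps hss js) f) =
    (\prod_(j <- js) \prod_(h <- hss j) h) *
    cube_sum L (fun z => mixed_seq js (fun j => size (hss j)) f (z + xi)).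
Proof.
move=> + hss0; elim: js L => [|j js IH] L.
  move=> _ _ _; exists 0; first by move=> i; rewrite mxE lexx.
  rewrite big_nil mul1r /cube_sum /=; apply: eq_bigr => a _.
  by rewrite /coord_steps/= addr0.
move=> /= /andP[jjs ujs] [mf pf] HL.
have [L' [E H]] := cube_sum_diff_op L (l := [seq (j, h) | h <- hss j])
  (fun a => ltac:(by move=> /mapP[h hj ->]; exact: hss0 hj)).
have S0 : 0 <= \sum_(h <- hss j) h.
  by rewrite big_seq; apply: sumr_ge0 => h; exact: hss0.
have [|xi xiP Hxi] := IH L' ujs mf.
  move=> b i /H[a aL Hab]; have [a0 a1] := HL a i aL.
  have := Hab i; rewrite steps_total_coord => /andP[b0 b1].
  split; first exact: le_trans b0.
  move: a1; rewrite in_cons; have [ij|ij] := eqVneq i j.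
    by rewrite ij (negbTE jjs) addr0 => a1; move: b1; rewrite ij eqxx => b1; apply: le_trans b1 a1.
  move=> /= a1; apply: le_trans a1; rewrite lerD2r.
  by move: b1; rewrite (negbTE ij) addr0.
pose L2 := [seq (a.1, a.2 + xi) | a <- L].
set g := mixed_seq js (fun j => size (hss j)) f in pf Hxi.
have xij : xi ord0 j = 0.
  by apply/le_anti; rewrite andbC; have := xiP j; rewrite (negbTE jjs).
have [| t /andP[t0 tS] Ht] := @cube_sum_iter_partial L2 g j (hss j) (hss0 j) pf.
  move=> b /mapP[a aL ->]/=.
  split=> i; have [a0 a1] := HL a i aL; rewrite !mxE ?eqxx/=; move: a0 a1 (xiP i);
    rewrite in_cons; have [->|ij] := eqVneq i j; rewrite /= ?(negbTE jjs) ?xij ?mulr1 ?mulr0 ?addr0;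
    move=> a0 a1 /andP[x0 x1]; apply/andP; split; rewrite ?addr_ge0//.
  - by apply: le_trans a1; rewrite lerDl.
  - by apply: le_trans a1; rewrite lerD2l.
  - by apply: le_trans a1; rewrite lerD2l.
exists (xi +_j t).
  move=> i; have := xiP i; rewrite in_cons !mxE eqxx/=.
  have [->|ij] := eqVneq i j; last by rewrite mulr0 addr0.
  by rewrite xij add0r mulr1 t0 tS.
rewrite big_cons [coord_steps _ _](_ : _ = [seq (j, h) | h <- hss j] ++ coord_steps hss js)//.
have EL : cube_sum L (fun z => iter (size (hss j)) (partial j) g (z + (xi +_j t))) =
    cube_sum L2 (fun z => iter (size (hss j)) (partial j) g (z +_j t)).
  by rewrite /cube_sum /L2 big_map; apply: eq_bigr => a _; rewrite addrA.
(* The differences along [j], absorbed in [L'] for the induction, are given back to the function,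
   now to the derivative [g] in the other variables. *)
have EL' : cube_sum L' (fun z => g (z + xi)) =
    cube_sum L2 (diff_op [seq (j, h) | h <- hss j] g).
  rewrite -(E (fun z => g (z + xi))) /cube_sum /L2 big_map.
  by apply: eq_bigr => a _; rewrite diff_op_translate.
by rewrite diff_op_cat E Hxi EL' Ht -/g EL mulrA (mulrC (\prod_(i <- js) _)).
Qed.

(** The extra steps [l] are not converted: they remain as differences of the mixed derivative and
    are later estimated through its fractional integral. *)
Lemma cube_sum_mixed L f (hss : 'I_s -> seq R) (l : seq ('I_s * R)) :
  (forall j h, h \in hss j -> 0 <= h) -> (forall a, a \in l -> 0 <= a.2) ->
  mixed_exists (fun j => size (hss j)) f ->
  (forall a i, a \in L -> 0 <= a.2 ord0 i /\
     a.2 ord0 i + steps_total l i + \sum_(h <- hss i) h <= 1) ->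
  exists2 xi : 'rV[R]_s, (forall i, 0 <= xi ord0 i <= \sum_(h <- hss i) h) &
    cube_sum L (diff_op (l ++ coord_steps hss (enum 'I_s)) f) =
    (\prod_(j < s) \prod_(h <- hss j) h) *
    cube_sum L (fun z => diff_op l (mixed (fun j => size (hss j)) f) (z + xi)).
Proof.
move=> hss0 l0 mf HL.
have [L' [E H]] := cube_sum_diff_op L l0.
have [|xi xiP Hxi] := cube_sum_mixed_seq (L := L') (enum_uniq 'I_s) hss0 mf.
  move=> b i /H[a aL Hab]; have [a0 a1] := HL a i aL; rewrite mem_enum/=.
  by have /andP[b0 b1] := Hab i; split; [exact: le_trans b0|rewrite (le_trans _ a1)// lerD2r].
exists xi; first by move=> i; have := xiP i; rewrite mem_enum.
rewrite diff_op_cat E Hxi big_enum/=; congr (_ * _).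
rewrite -(E (fun z => mixed (fun j => size (hss j)) f (z + xi))).
by rewrite /cube_sum; apply: eq_bigr => a _; rewrite diff_op_translate.
Qed.

End mean_value.

(** * Walsh coefficients *)

Section walsh.
Context (R : realType) (J : finType).
Implicit Types (k x y : {ffun J -> bool}) (F G : {ffun J -> bool} -> R) (a b : J) (l : seq J).

Definition xor_bits x y : {ffun J -> bool} := [ffun j => x j (+) y j].
Definition flip a x : {ffun J -> bool} := [ffun j => (j == a) (+) x j].
(** The characters of the group of bit vectors under [xor_bits]; [cells] below is the order of this
    group. *)
Definition walsh k x : R := \prod_(j : J) (-1) ^+ (k j && x j).
Definition zero_bits : {ffun J -> bool} := [ffun=> false].
Definition cells : R := 2 ^+ #|J|.

Lemma card_bits : #|{ffun J -> bool}|%:R = cells :> R.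
Proof. by rewrite card_ffun card_bool natrX. Qed.

Lemma cells_gt0 : 0 < cells. Proof. by rewrite exprn_gt0. Qed.

Lemma flipK a : involutive (flip a).
Proof. by move=> x; apply/ffunP => j; rewrite !ffunE addbA addbb. Qed.

Lemma flipC a b x : flip a (flip b x) = flip b (flip a x).
Proof. by apply/ffunP => j; rewrite !ffunE addbCA. Qed.

Lemma walsh_xorr k x y : walsh k (xor_bits x y) = walsh k x * walsh k y.
Proof.
rewrite /walsh -big_split/=; apply: eq_bigr => j _; rewrite ffunE.
by case: (k j); case: (x j); case: (y j); rewrite /= ?expr0 ?expr1 ?mulr1 ?mul1r ?mulrNN ?mulr1.
Qed.

Lemma walshC k x : walsh k x = walsh x k.
Proof. by apply: eq_bigr => j _; rewrite andbC. Qed.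

Lemma walsh_xorl k y x : walsh (xor_bits k y) x = walsh k x * walsh y x.
Proof. by rewrite walshC walsh_xorr !(walshC x). Qed.

Lemma walsh_flip k a x : walsh k (flip a x) = (-1) ^+ (k a) * walsh k x.
Proof.
have -> : flip a x = xor_bits [ffun j => j == a] x by apply/ffunP => j; rewrite !ffunE.
rewrite walsh_xorr; congr (_ * _); rewrite /walsh (bigD1 a)//= ffunE eqxx andbT.
by rewrite big1 ?mulr1// => j /negbTE ja; rewrite ffunE ja andbF.
Qed.

Lemma walsh0 x : walsh zero_bits x = 1.
Proof. by rewrite /walsh big1// => j _; rewrite ffunE. Qed.

Lemma sum_walsh k : \sum_x walsh k x = if k == zero_bits then cells else 0.
Proof.
rewrite /walsh -(bigA_distr_bigA (fun j (b : bool) => (-1) ^+ (k j && b) : R)).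
under eq_bigr => j _ do rewrite big_bool andbT andbF expr0.
case: eqP => [->|/eqP k0].
  rewrite (eq_bigr (fun=> 2)); first by rewrite prodr_const.
  by move=> j _; rewrite ffunE.
have [j kj] : exists j, k j.
  apply/existsP; apply: contraNT k0; rewrite negb_exists => /forallP H.
  by apply/eqP/ffunP => j; rewrite ffunE; apply/negbTE/H.
by rewrite (bigD1 j)//= kj expr1 addNr mul0r.
Qed.

Lemma sum_walshM k y : \sum_x walsh k x * walsh y x = if k == y then cells else 0.
Proof.
under eq_bigr do rewrite -walsh_xorl.
rewrite sum_walsh; congr (if _ then _ else _); apply/eqP/eqP => [E|->].
  by apply/ffunP => j; move/ffunP/(_ j): E; rewrite !ffunE; case: (k j); case: (y j).
by apply/ffunP => j; rewrite !ffunE addbb.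
Qed.

Definition walsh_coef F k : R := cells^-1 * \sum_x F x * walsh k x.

Lemma walsh_expansion F x : F x = \sum_k walsh_coef F k * walsh k x.
Proof.
rewrite /walsh_coef; under eq_bigr do rewrite -mulrA mulr_suml.
rewrite -mulr_sumr exchange_big/=.
rewrite (eq_bigr (fun y => F y * (if y == x then cells else 0))); last first.
  move=> y _; rewrite -sum_walshM mulr_sumr; apply: eq_bigr => k _.
  by rewrite -mulrA !(walshC k).
rewrite (bigD1 x)//= eqxx big1 ?addr0; last by move=> y /negbTE ->; rewrite mulr0.
by rewrite mulrC mulfK// gt_eqF// cells_gt0.
Qed.

Lemma parseval F : cells^-1 * \sum_x F x ^+ 2 = \sum_k walsh_coef F k ^+ 2.
Proof.
under eq_bigr => x _ do rewrite expr2 {2}(walsh_expansion F x) mulr_sumr.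
rewrite exchange_big mulr_sumr/=; apply: eq_bigr => k _.
under eq_bigr do rewrite mulrCA.
by rewrite -mulr_sumr mulrCA expr2.
Qed.

(** Halving makes this the orthogonal projection onto the characters with [k a] true, hence the
    exact selection of coefficients below. *)
Definition half_diff a F x : R := (F x - F (flip a x)) / 2.
Definition half_diffs l F : {ffun J -> bool} -> R := foldr half_diff F l.

Lemma walsh_coef_half_diff a F k :
  walsh_coef (half_diff a F) k = if k a then walsh_coef F k else 0.
Proof.
rewrite /walsh_coef /half_diff.
under eq_bigr do rewrite mulrAC mulrBl.
rewrite -mulr_suml sumrB [X in _ - X](reindex_inj (inv_inj (flipK a)))/=.
under [X in _ - X]eq_bigr do rewrite flipK walsh_flip mulrCA.
rewrite -mulr_sumr; case: (k a); rewrite ?expr1 ?expr0 ?mul1r ?subrr ?mul0r ?mulr0//.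
by congr (_ * _); rewrite mulN1r opprK; field.
Qed.

Lemma walsh_coef_half_diffs l F k :
  walsh_coef (half_diffs l F) k = if all k l then walsh_coef F k else 0.
Proof.
elim: l => [//|a l IH] /=; rewrite walsh_coef_half_diff IH.
by case: (k a).
Qed.

Lemma sum_walsh_coef_sqr l F :
  \sum_(k : {ffun J -> bool} | all k l) walsh_coef F k ^+ 2 = cells^-1 * \sum_x half_diffs l F x ^+ 2.
Proof.
rewrite parseval big_mkcond/=; apply: eq_bigr => k _; rewrite walsh_coef_half_diffs.
by case: ifP => // _; rewrite expr0n.
Qed.

Lemma half_diffs_flip l F a x : a \in l ->
  half_diffs l F (flip a x) = - half_diffs l F x.
Proof.
elim: l x => [//|b l IH] x; rewrite in_cons /= /half_diff => al.
have [->|ab] := eqVneq a b; first by rewrite flipK; lra.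
move: al; rewrite (negbTE ab)/= => al.
by rewrite flipC !IH//; lra.
Qed.

Definition clear_bits l x : {ffun J -> bool} := [ffun j => (j \notin l) && x j].

Lemma clear_bits_cons a l x :
  clear_bits (a :: l) x = (if clear_bits l x a then flip a else id) (clear_bits l x).
Proof.
apply/ffunP => j; case: ifP; rewrite !ffunE in_cons negb_or.
  by move=> /andP[al xa]; case: eqP => [->|_]//=; rewrite al xa.
by case: eqP => [->|//] /= /negbT; rewrite negb_and negbK => /orP[->|/negbTE ->];
  rewrite ?andbF.
Qed.

(** Each flip at a position of [l'] only changes the sign. Squares can thus be evaluated at points
    with cleared digits, where all flips are forward steps. *)
Lemma half_diffs_clear_bits l l' F x : {subset l <= l'} ->
  half_diffs l' F (clear_bits l x) ^+ 2 = half_diffs l' F x ^+ 2.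
Proof.
elim: l => [|a l IH] ll'.
  by congr (half_diffs _ _ _ ^+ 2); apply/ffunP => j; rewrite ffunE.
have sl : {subset l <= l'} by move=> b bl; apply: ll'; rewrite in_cons bl orbT.
rewrite clear_bits_cons; case: ifP => _; last exact: IH.
by rewrite half_diffs_flip ?sqrrN ?IH// ll'// mem_head.
Qed.

(** Clearing the digits in [l] merges the flips at those positions; each position costs at most a
    factor 2, through [G <= G + G \o flip a]. *)
Lemma sum_clear_bits l G : (forall x, 0 <= G x) ->
  \sum_x G (clear_bits l x) <= 2 ^+ size l * \sum_x G x.
Proof.
elim: l G => [|a l IH] G G0.
  rewrite mul1r le_eqVlt; apply/orP; left; apply/eqP/eq_bigr => x _; congr G.
  by apply/ffunP => j; rewrite ffunE.
apply: (@le_trans _ _ (\sum_x (G (clear_bits l x) + G (flip a (clear_bits l x))))).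
  by apply: ler_sum => x _; rewrite clear_bits_cons; case: ifP => _; rewrite ?lerDr ?lerDl.
rewrite big_split/= exprS -mulrA mulr_natl mulr2n; apply: lerD; first exact: IH.
apply: le_trans (IH (fun x => G (flip a x)) _) _; first by move=> x.
by rewrite [X in _ <= _ * X](reindex_inj (inv_inj (flipK a))).
Qed.

End walsh.

(** * Walsh coefficients of smooth functions *)

Section walsh_coefficients_of_smooth_functions.
Context (R : realType) (s : nat).
Implicit Types (f g : 'rV[R]_s -> R) (z : 'rV[R]_s).

Definition dyadic_step N (a : 'I_s * 'I_N) : 'I_s * R := (a.1, (2 ^+ a.2.+1)^-1).

Lemma grid_pt_flip N (x : {ffun 'I_s * 'I_N -> bool}) (a : 'I_s * 'I_N) : ~~ x a ->
  grid_pt R (flip a x) =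
  grid_pt R x + (dyadic_step a).2 *: delta_mx ord0 (dyadic_step a).1.
Proof.
case: a => j b xa; apply/rowP => i; rewrite !mxE eqxx/=.
have [->|ij] := eqVneq i j; last first.
  rewrite mulr0 addr0; apply: eq_bigr => l _; rewrite !ffunE.
  by rewrite -pair_eqE/= (negbTE ij).
rewrite mulr1 (bigD1 b)//= [X in _ = X + _](bigD1 b)//= !ffunE eqxx (negbTE xa)/=.
rewrite mul0r add0r mul1r addrC; congr (_ + _); apply: eq_bigr => l lb.
by rewrite !ffunE -pair_eqE/= eqxx (negbTE lb).
Qed.

Lemma half_diffs_diff_op N f (l : seq ('I_s * 'I_N)) (x : {ffun 'I_s * 'I_N -> bool}) :
  uniq l -> all (fun a => ~~ x a) l ->
  half_diffs l (f \o @grid_pt R s N) x =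
  (- 2^-1) ^+ size l * diff_op (map (@dyadic_step N) l) f (grid_pt R x).
Proof.
elim: l x => [|a l IH] x; first by rewrite mul1r.
move=> /= /andP[al ul] /andP[xa xl]; rewrite /half_diff !IH//; last first.
  apply/allP => b bl; rewrite ffunE; have [ba|ba] := eqVneq b a.
    by rewrite -ba bl in al.
  by move/allP: xl => /(_ b bl); rewrite /=.
by rewrite (grid_pt_flip xa) exprS; field.
Qed.

Lemma sum_dyadic_steps N : \sum_(b < N) (2 ^+ b.+1)^-1 <= 1 :> R.
Proof.
suff -> : \sum_(b < N) (2 ^+ b.+1)^-1 = 1 - (2 ^+ N)^-1 :> R.
  by rewrite gerBl invr_ge0 exprn_ge0.
elim: N => [|N IH]; first by rewrite big_ord0 invr1 subrr.
rewrite big_ord_recr/= IH exprS invfM.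
have : (2 ^+ N)^-1 = 2^-1 * (2 ^+ N)^-1 + 2^-1 * (2 ^+ N)^-1 :> R by field; rewrite expf_neq0.
lra.
Qed.

(** The steps in [l] have distinct positions at which [x] has digit 0, so the point and all its
    steps together use each weight [2^-(b+1)] at most once. *)
Lemma grid_pt_box N (l : seq ('I_s * 'I_N)) (x : {ffun 'I_s * 'I_N -> bool}) i :
  uniq l -> all (fun a => ~~ x a) l ->
  0 <= grid_pt R x ord0 i /\
  grid_pt R x ord0 i + steps_total (map (@dyadic_step N) l) i <= 1.
Proof.
move=> ul xl; rewrite mxE; split.
  by apply: sumr_ge0 => b _; rewrite divr_ge0 ?exprn_ge0.
apply: le_trans (sum_dyadic_steps N).
have -> : steps_total (map (@dyadic_step N) l) i =
    \sum_(b < N) (if (i, b) \in l then (2 ^+ b.+1)^-1 else 0).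
  rewrite /steps_total big_map/= -big_filter.
  rewrite -big_mkcond/=.
  rewrite -[RHS](big_map (fun b : 'I_N => (i, b)) (fun a => a \in l) (fun a => (2 ^+ a.2.+1)^-1)).
  rewrite -[RHS]big_filter; apply: perm_big; apply: uniq_perm.
  - exact: filter_uniq.
  - by rewrite filter_uniq// map_inj_uniq ?index_enum_uniq// => b c [].
  - move=> [j b]; rewrite !mem_filter/= andbC; congr (_ && _).
    apply/eqP/mapP => [->|[c _ [->]]]//.
    by exists b => //; rewrite mem_index_enum.
rewrite -big_split/=; apply: ler_sum => b _.
case: ifPn => bl; last first.
  by rewrite addr0; case: (x _); rewrite ?mul1r// mul0r invr_ge0 exprn_ge0.
by move/allP: xl => /(_ _ bl) /negbTE ->; rewrite mul0r add0r.
Qed.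

Lemma eq_diff_op_cube f g (l : seq ('I_s * R)) z : (forall z, unit_cube z -> f z = g z) ->
  (forall a, a \in l -> 0 <= a.2) ->
  (forall i, 0 <= z ord0 i /\ z ord0 i + steps_total l i <= 1) ->
  diff_op l f z = diff_op l g z.
Proof.
move=> fg; elim: l z => [|[j h] l IH] z l0 Hz /=.
  by apply: fg => i; have [-> /=] := Hz i; rewrite /steps_total big_nil addr0.
have h0 : 0 <= h by apply: (l0 (j, h)); rewrite mem_head.
have l0' a : a \in l -> 0 <= a.2 by move=> al; apply: l0; rewrite in_cons al orbT.
have T i : steps_total ((j, h) :: l) i = (if j == i then h else 0) + steps_total l i.
  by rewrite /steps_total big_cons/=; case: ifP => _; rewrite ?add0r.
congr (_ - _); apply: IH => // i; have [z0] := Hz i; rewrite T ?mxE ?eqxx/= => z1; split => //.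
- by rewrite addr_ge0// mulr_ge0.
- by apply: le_trans z1; rewrite addrA lerD2r lerD2l eq_sym; case: eqP; rewrite ?mulr1 ?mulr0.
- by apply: le_trans z1; rewrite lerD2l lerDr; case: ifP.
Qed.

Section one_class.
Context (N : nat) (js : seq 'I_s) (q : 'I_s -> 'I_N) (hl : 'I_s -> seq 'I_N).
Let l : seq ('I_s * 'I_N) :=
  [seq (j, q j) | j <- js] ++ flatten [seq [seq (j, b) | b <- hl j] | j <- enum 'I_s].
Let a j := size (hl j).
Hypothesis ul : uniq l.
Let delta : R := (2 ^ N)%:R^-1.
Let hss j : seq R := [seq (2 ^+ b.+1)^-1 | b : 'I_N <- hl j].
Let kk j := (2 ^ (N - (q j).+1))%N.

Lemma dyadic_steps_class :
  map (@dyadic_step N) l = grid_steps R N js kk ++ coord_steps hss (enum 'I_s).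
Proof.
rewrite /l map_cat; congr (_ ++ _).
  rewrite /grid_steps -map_comp; apply: eq_map => j /=.
  rewrite /dyadic_step/= /kk !natrX; congr (_, _).
  have n0 k : (2 : R) ^+ k != 0 by rewrite expf_neq0// pnatr_eq0.
  have -> : 2 ^+ N = 2 ^+ (N - (q j).+1) * 2 ^+ (q j).+1 :> R by rewrite -exprD subnK.
  by rewrite invfM mulrA divff ?mul1r.
rewrite /coord_steps map_flatten -map_comp; congr flatten; apply: eq_map => j /=.
by rewrite -!map_comp.
Qed.

(** A self-bounding argument: the quantity [V] to be estimated reappears on the right through
    [theta^-1 V], and a suitable [theta] allows it to be absorbed on the left. *)
Lemma sum_walsh_coef_class f (lambda : R) (D : frac_family R s) (C omega : R) :
  0 < C ->
  mixed_exists a f -> (forall z, unit_cube z -> mixed a f z = frac_integral lambda D z) ->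
  (forall xi (eps : {ffun 'I_s * 'I_N -> bool} -> R) theta, 0 < theta ->
    `|\sum_x delta ^+ s * eps x *
       diff_op (grid_steps R N js kk) (frac_integral lambda D) (grid_pt R x + xi)| <=
    C * (\prod_(j <- js) ((kk j)%:R / (2 ^ N)%:R) `^ lambda) *
      (theta + theta^-1 * \sum_x delta ^+ s * eps x ^+ 2) +
    C * delta `^ omega * \sum_x delta ^+ s * `|eps x|) ->
  \sum_(k : {ffun 'I_s * 'I_N -> bool} | all k l) walsh_coef (f \o @grid_pt R s N) k ^+ 2 <=
  8 * (C * (\prod_(j <- js) (2 ^+ (q j).+1)^-1 `^ lambda) *
       \prod_(j < s) \prod_(b <- hl j) (2 ^+ b.+1)^-1) ^+ 2 +
  4 * (C * delta `^ omega) ^+ 2.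
Proof.
move=> C0 mf mfD HC.
have d0 : 0 < delta by rewrite invr_gt0 ltr0n expn_gt0.
(* By oddness under flips, the points whose digits along [l] vanish suffice; [eps] is the
   difference at these points, so that the bound [HC] estimates its square. *)
pose Y : {pred {ffun 'I_s * 'I_N -> bool}} := fun x => all (fun a => ~~ x a) l.
pose Df (x : {ffun 'I_s * 'I_N -> bool}) := diff_op (map (@dyadic_step N) l) f (grid_pt R x).
pose eps x := if x \in Y then Df x else 0.
pose V := \sum_x delta ^+ s * eps x ^+ 2.
have w0 : 0 <= delta ^+ s by rewrite exprn_ge0// ltW.
have cE : (cells R ('I_s * 'I_N)%type)^-1 = delta ^+ s.
  by rewrite /cells card_prod !card_ord mulnC exprM /delta natrX exprVn.
have sumw : \sum_(x : {ffun 'I_s * 'I_N -> bool}) delta ^+ s = 1.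
  rewrite sumr_const -mulr_natl card_bits -cE mulfV// gt_eqF//; exact: cells_gt0.
rewrite sum_walsh_coef_sqr cE.
(* Each position gives a factor 1/4 from the squared halving and at most 2 from clearing the digit,
   in total at most 1. *)
have S_le_V : delta ^+ s * \sum_x half_diffs l (f \o @grid_pt R s N) x ^+ 2 <= V.
  rewrite /V -mulr_sumr ler_wpM2l//.
  under eq_bigr do rewrite -(half_diffs_clear_bits _ _ (l := l))//.
  pose G x := 4^-1 ^+ size l * eps x ^+ 2.
  rewrite (eq_bigr (fun x => G (clear_bits l x))); last first.
    move=> x _; have cY : clear_bits l x \in Y.
      by apply/allP => b bl; rewrite ffunE bl.
    rewrite half_diffs_diff_op// /G /eps cY exprMn -exprM mulnC exprM; congr (_ ^+ _ * _).
    by rewrite sqrrN expr2; field.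
  apply: le_trans (sum_clear_bits _ _) _.
    by move=> x; rewrite mulr_ge0 ?sqr_ge0// exprn_ge0// invr_ge0.
  rewrite /G -mulr_sumr mulrA -exprMn ler_piMl ?sumr_ge0//.
    by move=> x _; exact: sqr_ge0.
  apply: exprn_ile1; first by rewrite divr_ge0.
  by lra.
apply: le_trans S_le_V _.
pose L := [seq (delta ^+ s * eps x, grid_pt R x) | x : {ffun 'I_s * 'I_N -> bool} <- enum Y].
have LE phi : cube_sum L phi = \sum_x delta ^+ s * eps x * phi (grid_pt R x).
  rewrite /cube_sum /L big_map/= big_enum/= [RHS](bigID (mem Y))/=.
  rewrite [X in _ = _ + X]big1 ?addr0// => x xY.
  by rewrite /eps (negbTE xY) mulr0 mul0r.
have VE : V = cube_sum L (diff_op (grid_steps R N js kk ++ coord_steps hss (enum 'I_s)) f).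
  rewrite LE -dyadic_steps_class; apply: eq_bigr => x _; rewrite expr2 mulrA.
  by rewrite /eps; case: ifP => // _; rewrite !mulr0 mul0r.
have hss0 j h : h \in hss j -> 0 <= h.
  by move=> /mapP[b _ ->]; rewrite invr_ge0 exprn_ge0.
have gs0 b : b \in grid_steps R N js kk -> 0 <= b.2.
  by move=> /mapP[j _ ->]; rewrite divr_ge0.
have box b i : b \in L -> 0 <= b.2 ord0 i /\
    b.2 ord0 i + steps_total (grid_steps R N js kk) i + \sum_(h <- hss i) h <= 1.
  move=> /mapP[x]; rewrite mem_enum => xY ->/=.
  have [x0 x1] := grid_pt_box i ul xY; split => //; apply: le_trans x1.
  rewrite dyadic_steps_class -addrA lerD2l /steps_total big_cat/= lerD2l.
  rewrite /coord_steps big_flatten/= big_map big_enum/= (bigD1 i)//= big_map/= eqxx lerDl.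
  apply: sumr_ge0 => j _; rewrite big_map big_seq_cond; apply: sumr_ge0 => h /andP[/hss0]//.
have size_hss : (fun j => size (hss j)) = a by apply/funext => j; rewrite size_map.
(* The shift [xi] depends on the weights, hence on [eps]; this is why [HC] has to hold for every
   [xi]. *)
have [|xi xiP Hxi] := cube_sum_mixed hss0 gs0 _ box (f := f); first by rewrite size_hss.
rewrite size_hss in Hxi.
pose W := \prod_(j <- js) ((kk j)%:R / (2 ^ N)%:R : R) `^ lambda.
pose H := \prod_(j < s) \prod_(h <- hss j) h.
have H0 : 0 < H.
  apply: prodr_gt0 => j _; rewrite big_map; apply: prodr_gt0 => b _.
  by rewrite invr_gt0 exprn_gt0.
have H1 : H <= 1.
  apply: prodr_ile1 => j _; rewrite big_map prodr_ge0 ?prodr_ile1// => b _.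
    by rewrite invr_ge0 exprn_ge0// invf_le1 ?exprn_gt0// exprn_ege1// ler1n.
have W0 : 0 < W.
  by apply: prodr_gt0 => j _; rewrite powR_gt0// divr_gt0// ltr0n expn_gt0.
have V_le theta : 0 < theta -> V <= H * (C * W * (theta + theta^-1 * V) +
    C * delta `^ omega * \sum_x delta ^+ s * `|eps x|).
  move=> th0; rewrite {1}VE Hxi ler_wpM2l ?(ltW H0)//.
  apply: le_trans (HC xi eps theta th0); apply: le_trans (ler_norm _).
  rewrite LE le_eqVlt; apply/orP; left; apply/eqP; apply: eq_bigr => x _.
  rewrite /eps; case: ifPn => xY; last by rewrite mulr0 !mul0r.
  congr (_ * _); apply: eq_diff_op_cube => // i.
  have xL : (delta ^+ s * eps x, grid_pt R x) \in L.
    by apply/mapP; exists x; rewrite ?mem_enum.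
  have [b0 b1] := box _ i xL; have /andP[xi0 xi1] := xiP i.
  rewrite mxE; split; first exact: addr_ge0.
  by move: b1 => /=; lra.
have CW0 : 0 < H * (C * W) by rewrite !mulr_gt0.
(* With [A = H C W] and [theta = 2 A] the first part is [2 A^2 + V / 2]. The capping part is at most
   [E^2 + V / 4], so [V / 4 <= 2 A^2 + E^2]; this is the origin of the constants 8 and 4. *)
have := V_le (2 * (H * (C * W))); rewrite mulr_gt0// => /(_ isT).
have -> : 8 * (C * (\prod_(j <- js) (2 ^+ (q j).+1)^-1 `^ lambda) *
       \prod_(j < s) \prod_(b <- hl j) (2 ^+ b.+1)^-1) ^+ 2 = 8 * (H * (C * W)) ^+ 2.
  congr (_ * _ ^+ 2); rewrite [RHS]mulrC; congr (_ * _ * _); rewrite /H; last first.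
    by apply: eq_bigr => j _; rewrite big_map.
  apply: eq_bigr => j _; congr (_ `^ _); rewrite /kk !natrX.
  have n0 k : (2 : R) ^+ k != 0 by rewrite expf_neq0// pnatr_eq0.
  have -> : 2 ^+ N = 2 ^+ (N - (q j).+1) * 2 ^+ (q j).+1 :> R by rewrite -exprD subnK.
  by rewrite invfM mulrA divff ?mul1r.
have epsle : C * delta `^ omega * \sum_x delta ^+ s * `|eps x| <=
    (C * delta `^ omega) ^+ 2 + V / 4.
  have -> : (C * delta `^ omega) ^+ 2 + V / 4 =
      \sum_x (delta ^+ s * (C * delta `^ omega) ^+ 2 + delta ^+ s * eps x ^+ 2 / 4).
    by rewrite big_split/= -mulr_suml sumw mul1r /V mulr_suml.
  rewrite mulr_sumr; apply: ler_sum => x _.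
  rewrite (_ : _ + _ = delta ^+ s * ((C * delta `^ omega) ^+ 2 + eps x ^+ 2 / 4)); last by ring.
  rewrite mulrCA ler_wpM2l//; have := sqr_ge0 (C * delta `^ omega - `|eps x| / 2).
  rewrite -[eps x ^+ 2]real_normK ?num_real//; lra.
set A := H * (C * W) in CW0 *; set E := C * delta `^ omega in epsle *.
set S1 := E * _ in epsle *.
have -> : H * (C * W * (2 * A + (2 * A)^-1 * V) + S1) = 2 * A ^+ 2 + V / 2 + H * S1.
  by rewrite mulrDr; congr (_ + _); rewrite mulrA -/A; field; rewrite gt_eqF.
have : H * S1 <= S1.
  rewrite ler_piMl// mulr_ge0 ?sumr_ge0 ?mulr_ge0 ?powR_ge0 ?(ltW C0)// => x _.
  by rewrite mulr_ge0.
lra.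
Qed.

End one_class.
Definition bit_list N (js : seq 'I_s) (q : 'I_s -> 'I_N) (hl : 'I_s -> seq 'I_N) :
    seq ('I_s * 'I_N) :=
  [seq (j, q j) | j <- js] ++ flatten [seq [seq (j, b) | b <- hl j] | j <- enum 'I_s].

(** Only finitely many orders of differentiation occur, so one pair [C], [omega] serves all of them,
    independently of [N] and of the positions. *)
Lemma sum_walsh_coef_smooth alpha (lambda : R) f : 0 < lambda <= 1 ->
  finite_sobolev_norm alpha lambda f ->
  exists C omega : R, [/\ 0 < C, 0 < omega &
    forall N js (q : 'I_s -> 'I_N) (hl : 'I_s -> seq 'I_N), uniq js ->
      uniq (bit_list js q hl) -> (forall j, (size (hl j) <= alpha)%N) ->
    \sum_(k : {ffun 'I_s * 'I_N -> bool} | all k (bit_list js q hl))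
       walsh_coef (f \o @grid_pt R s N) k ^+ 2 <=
    8 * (C * (\prod_(j <- js) (2 ^+ (q j).+1)^-1 `^ lambda) *
         \prod_(j < s) \prod_(b <- hl j) (2 ^+ b.+1)^-1) ^+ 2 +
    4 * (C * (2 ^ N)%:R^-1 `^ omega) ^+ 2].
Proof.
move=> l01 [p [p2 lp Hf _]].
have /boolp.choice[c Hc] (a : {ffun 'I_s -> 'I_alpha.+1}) : exists c : frac_family R s * R * R,
    [/\ forall z, unit_cube z -> mixed (fun j => a j) f z = frac_integral lambda c.1.1 z,
      0 <= c.1.2, 0 < c.2 &
    forall N (js : seq 'I_s) (k : 'I_s -> nat) xi
      (eps : {ffun 'I_s * 'I_N -> bool} -> R) theta, uniq js -> 0 < theta ->
    `|\sum_x (2 ^ N)%:R^-1 ^+ s * eps x *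
       diff_op (grid_steps R N js k) (frac_integral lambda c.1.1) (grid_pt R x + xi)| <=
    c.1.2 * (\prod_(j <- js) ((k j)%:R / (2 ^ N)%:R) `^ lambda) *
      (theta + theta^-1 * \sum_x (2 ^ N)%:R^-1 ^+ s * eps x ^+ 2) +
    c.1.2 * (2 ^ N)%:R^-1 `^ c.2 * \sum_x (2 ^ N)%:R^-1 ^+ s * `|eps x|].
  have [_ [D [HD DE]]] := Hf a.
  have [C [om [C0 om0 H]]] := frac_integral_increment_bound l01 p2 lp HD.
  by exists (D, C, om).
have om0 a : 0 < (c a).2 by have [] := Hc a.
have [om [om_gt0 om_le]] := exists_pos_lower_bound om0.
have c0 a : 0 <= (c a).1.2 by have [] := Hc a.
pose C := 1 + \sum_a (c a).1.2.
have C0 : 0 < C by rewrite ltr_wpDr ?sumr_ge0// => a _.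
exists C, om; split => // N js q hl ujs ul hla.
pose a := [ffun j => inord (size (hl j))] : {ffun 'I_s -> 'I_alpha.+1}.
have aE : (fun j => a j : nat) = (fun j => size (hl j)).
  by apply/funext => j; rewrite ffunE inordK// ltnS.
have [DE _ _ H] := Hc a; have [mf _] := Hf a.
rewrite aE in DE mf.
have K := @sum_walsh_coef_class N js q hl ul f lambda (c a).1.1 C om C0 mf DE.
apply: K => xi eps theta th0; apply: le_trans (H _ _ _ _ _ _ ujs th0) _.
have d0 : 0 <= (2 ^ N)%:R^-1 :> R by rewrite invr_ge0.
have caC : (c a).1.2 <= C.
  by rewrite /C (bigD1 a)//= addrCA lerDl addr_ge0// sumr_ge0.
apply: lerD.
  rewrite ler_wpM2r//.
    rewrite addr_ge0 ?(ltW th0)// mulr_ge0 ?invr_ge0 ?(ltW th0)//.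
    by apply: sumr_ge0 => x _; rewrite mulr_ge0 ?sqr_ge0// exprn_ge0.
  by rewrite ler_wpM2r// prodr_ge0// => j _; exact: powR_ge0.
apply: ler_wpM2r.
  by apply: sumr_ge0 => x _; rewrite mulr_ge0// exprn_ge0.
apply: ler_pM => //.
apply: ger_powR => //.
by rewrite invr_gt0 ltr0n expn_gt0/= invf_le1 ?ltr0n ?expn_gt0// ler1n expn_gt0.
Qed.

End walsh_coefficients_of_smooth_functions.

(** * Counting by smoothness weight *)

Section signature.
Context (R : realType) (s alpha N : nat) (l0 : 'I_N) (lambda : R).
Hypothesis l01 : 0 < lambda <= 1.
Notation digits := {ffun 'I_s * 'I_N -> bool}.
Implicit Types (k : digits) (sigma : {ffun 'I_s * 'I_alpha.+1 -> 'I_N.+1}).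

Definition bits_of k (j : 'I_s) : seq 'I_N := [seq b <- rev (enum 'I_N) | k (j, b)].

Definition positions k j : seq nat := [seq (val b).+1 | b <- bits_of k j].

(* The [alpha + 1] largest positions of nonzero digits of [k_j], numbered from 1 and
   completed by 0. *)
Definition signature k : {ffun 'I_s * 'I_alpha.+1 -> 'I_N.+1} :=
  [ffun a : 'I_s * 'I_alpha.+1 => inord (nth 0 (positions k a.1) a.2)].

Definition slot_weight (i : nat) : R := if (i < alpha)%N then 1 else lambda.

(** The quantity [T] of the overview; padding zeros in the signature add nothing to it. *)
Definition smoothness_weight sigma : R :=
  \sum_(a : 'I_s * 'I_alpha.+1) slot_weight a.2 * (sigma a)%:R.

Lemma mem_bits_of k j b : (b \in bits_of k j) = k (j, b).
Proof. by rewrite mem_filter mem_rev mem_enum andbT. Qed.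

Lemma bits_of_uniq k j : uniq (bits_of k j).
Proof. by rewrite filter_uniq// rev_uniq enum_uniq. Qed.

Lemma positions_sorted k j : sorted gtn (positions k j).
Proof.
have tr : transitive gtn by move=> a b c ab bc; exact: ltn_trans bc ab.
have : subseq [seq (val b).+1 | b <- [seq b <- rev (enum 'I_N) | k (j, b)]]
   [seq (val b).+1 | b <- rev (enum 'I_N)] by apply/map_subseq/filter_subseq.
move=> H; apply: (subseq_sorted tr H).
rewrite map_rev rev_sorted (map_comp S val) val_enum_ord.
rewrite sorted_map.
by apply: sub_sorted (iota_ltn_sorted 0 N) => a b /=; rewrite ltnS.
Qed.

Lemma nth_positions_le k j i : (nth 0 (positions k j) i <= N)%N.
Proof.
have [im|im] := ltnP i (size (positions k j)); last by rewrite nth_default.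
by have /mapP[b _ ->] := mem_nth 0 im; exact: ltn_ord.
Qed.

Lemma signatureE k j (i : 'I_alpha.+1) :
  signature k (j, i) = nth 0 (positions k j) i :> nat.
Proof. by rewrite ffunE inordK// ltnS nth_positions_le. Qed.

Lemma nth_positions_gt0 k j i : (0 < nth 0 (positions k j) i)%N = (i < size (bits_of k j))%N.
Proof.
rewrite -(size_map (fun b : 'I_N => (val b).+1)) -/(positions k j).
have [im|im] := ltnP i (size (positions k j)); last by rewrite nth_default.
by have /mapP[b _ ->] := mem_nth 0 im.
Qed.

(** Positions are counted from 1, so a padding 0 is never a digit and the signature recovers the
    upper digits together with their number. *)
Lemma signature_take k k' j : signature k = signature k' ->
  take alpha.+1 (bits_of k j) = take alpha.+1 (bits_of k' j).
Proof.
move=> E.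
have nthE i : (i <= alpha)%N -> nth 0 (positions k j) i = nth 0 (positions k' j) i.
  by move=> ia; rewrite -[i]/(val (Ordinal (ia : (i < alpha.+1)%N))) -!signatureE E.
have szE i : (i <= alpha)%N -> (i < size (bits_of k j))%N = (i < size (bits_of k' j))%N.
  by move=> ia; rewrite -!nth_positions_gt0 nthE.
have tsz : size (take alpha.+1 (bits_of k j)) = size (take alpha.+1 (bits_of k' j)).
  rewrite !size_take_min.
  apply/eqP; rewrite eqn_leq !leq_min !geq_minl /=; apply/andP; split.
    set m := minn _ _; case mE: m => [//|m'].
    have m'a : (m' <= alpha)%N by rewrite -ltnS -mE geq_minl.
    by rewrite -szE// -mE geq_minr.
  set m := minn _ _; case mE: m => [//|m'].
  have m'a : (m' <= alpha)%N by rewrite -ltnS -mE geq_minl.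
  by rewrite szE// -mE geq_minr.
apply: (@eq_from_nth _ l0) => // i.
rewrite size_take_min leq_min => /andP[ia isz].
rewrite !nth_take//; apply: val_inj; apply: succn_inj.
have := nthE i ia; rewrite !(nth_map l0)//.
by rewrite -szE.
Qed.

(* The [alpha] largest positions in each coordinate are paired with derivatives, the next
   one, where it exists, with an increment of the fractional integral. *)
Definition deep_coords k : seq 'I_s := [seq j <- enum 'I_s | (alpha < size (bits_of k j))%N].
Definition deep_bit k j : 'I_N := nth l0 (bits_of k j) alpha.
Definition shallow_bits k j : seq 'I_N := take alpha (bits_of k j).

Lemma deep_coords_uniq k : uniq (deep_coords k).
Proof. by rewrite filter_uniq// enum_uniq. Qed.

Lemma size_shallow_bits k j : (size (shallow_bits k j) <= alpha)%N.
Proof. by rewrite size_take_min geq_minl. Qed.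

Lemma signature_bit_list_uniq k :
  uniq (bit_list (deep_coords k) (deep_bit k) (shallow_bits k)).
Proof.
rewrite /bit_list cat_uniq; apply/and3P; split.
- by rewrite map_inj_in_uniq ?deep_coords_uniq// => i j _ _ [].
- apply/hasPn => a /flattenP[u /mapP[j _ ->] /mapP[b bj ->]].
  apply/negP => /mapP[j' j'k [jj' bE]]; rewrite -{}jj' in j'k bE.
  move: j'k; rewrite mem_filter => /andP[asz _].
  have ub := bits_of_uniq k j; rewrite -(cat_take_drop alpha (bits_of k j)) cat_uniq in ub.
  have /and3P[_ /hasPn H _] := ub.
  have /H : b \in drop alpha (bits_of k j) by rewrite bE /deep_bit (drop_nth l0 asz) mem_head.
  by rewrite /= -/(shallow_bits k j) bj.
- apply: (@allpairs_uniq_dep 'I_s (fun=> 'I_N) ('I_s * 'I_N)%type (fun i b => (i, b))).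
  + exact: enum_uniq.
  + by move=> j _; rewrite take_uniq// bits_of_uniq.
  + by move=> [i b] [j c] _ _ /= [ij]; case: _ / ij => ->.
Qed.

(** A class of equal signature is contained in the set of [k'] having the listed digits. The bound
    for that larger set therefore covers the class. *)
Lemma signature_bit_list k k' : signature k = signature k' ->
  all k' (bit_list (deep_coords k) (deep_bit k) (shallow_bits k)).
Proof.
move=> E; apply/allP => -[j b].
suff H : b \in take alpha.+1 (bits_of k j) -> k' (j, b).
  rewrite mem_cat => /orP[/mapP[i]|/flattenP[u /mapP[i _ ->] /mapP[c ci [ji bc]]]].
    rewrite mem_filter => /andP[asz _] [ji bE]; apply: H.
    rewrite ji bE /deep_bit -(nth_take l0 (ltnSn alpha)) mem_nth//.
    by rewrite size_take_min leq_min ltnSn asz.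
  apply: H; rewrite ji bc.
  rewrite /shallow_bits -(take_takel (bits_of k i) (leqnSn alpha)) in ci.
  exact: mem_take ci.
by rewrite (signature_take j E) -mem_bits_of; exact: mem_take.
Qed.

Lemma smoothness_weight_coord sigma :
  smoothness_weight sigma =
  \sum_(j < s) \sum_(i < alpha.+1) slot_weight i * (sigma (j, i))%:R.
Proof. by rewrite pair_big; apply: eq_bigr => -[]. Qed.

Lemma bits_weight k j :
  \sum_(i < alpha.+1) slot_weight i * (signature k (j, i))%:R =
  \sum_(b <- shallow_bits k j) (val b).+1%:R +
  (if (alpha < size (bits_of k j))%N then lambda * (val (deep_bit k j)).+1%:R else 0).
Proof.
rewrite big_ord_recr/=; congr (_ + _); last first.
  rewrite /slot_weight ltnn signatureE; case: ifPn => asz.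
    by rewrite (nth_map l0).
  by rewrite nth_default ?size_map 1?leqNgt// mulr0.
rewrite (eq_bigr (fun i : 'I_alpha => (nth 0%N (positions k j) i)%:R)); last first.
  by move=> i _; rewrite /slot_weight ltn_ord mul1r signatureE.
have -> : \sum_(b <- shallow_bits k j) (val b).+1%:R =
    \sum_(c <- take alpha (positions k j)) c%:R :> R.
  by rewrite /positions -map_take big_map.
elim: alpha (positions k j) => [|n IH] [|a t]; rewrite ?big_ord0 ?big_nil//.
  by rewrite big1// => i _; rewrite nth_nil.
by rewrite big_ord_recl/= big_cons IH.
Qed.

Lemma pow2_powR (n : nat) : (2 ^+ n)^-1 = 2 `^ (- n%:R) :> R.
Proof. by rewrite powRN powR_mulrn. Qed.

Lemma powR2_sum (I : Type) (t : seq I) (P : pred I) (F : I -> R) :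
  \prod_(i <- t | P i) 2 `^ (F i) = 2 `^ (\sum_(i <- t | P i) F i) :> R.
Proof.
elim/big_rec2 : _ => [|i x y _ ->]; first by rewrite powRr0.
by rewrite powRD// pnatr_eq0 implybT.
Qed.

(** Translates the class bound into the weight: a derivative step at position [b] gives [2^-b], a
    fractional step gives [2^-(lambda b)]. *)
Lemma prod_steps_signature k :
  (\prod_(j <- deep_coords k) (2 ^+ (deep_bit k j).+1)^-1 `^ lambda) *
  (\prod_(j < s) \prod_(b <- shallow_bits k j) (2 ^+ b.+1)^-1) =
  2 `^ (- smoothness_weight (signature k)) :> R.
Proof.
rewrite smoothness_weight_coord.
under [in RHS]eq_bigr do rewrite bits_weight.
rewrite big_split/= opprD addrC powRD; last by rewrite pnatr_eq0 implybT.
congr (_ * _).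
  rewrite /deep_coords big_filter big_enum_cond/= -big_mkcond -sumrN -powR2_sum/=.
  by apply: eq_bigr => j _; rewrite pow2_powR -powRrM mulNr mulrC.
rewrite -sumrN -powR2_sum; apply: eq_bigr => j _.
by rewrite -sumrN -powR2_sum; apply: eq_bigr => b _; rewrite pow2_powR.
Qed.

Definition deep_total sigma : nat := (\sum_(j < s) sigma (j, ord_max))%N.

Lemma nth_positions_anti k j i i' : (i <= i')%N ->
  (nth 0 (positions k j) i' <= nth 0 (positions k j) i)%N.
Proof.
move=> ii'; have [i'm|i'm] := ltnP i' (size (positions k j)); last by rewrite nth_default.
move: ii'; rewrite leq_eqVlt => /orP[/eqP ->//|ii'].
have tr : transitive gtn by move=> a b c ab bc; exact: ltn_trans bc ab.
have := sorted_ltn_nth tr 0%N (positions_sorted k j) i i'.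
by rewrite !inE (ltn_trans ii' i'm) i'm => /(_ isT isT ii') /ltnW.
Qed.

(** In each coordinate the last recorded position is at most each of the [alpha] positions recorded
    before it. *)
Lemma deep_total_le k :
  (alpha%:R + lambda) * (deep_total (signature k))%:R <= smoothness_weight (signature k).
Proof.
have /andP[l0' _] := l01.
rewrite smoothness_weight_coord /deep_total natr_sum mulr_sumr; apply: ler_sum => j _.
rewrite big_ord_recr/= /slot_weight ltnn mulrDl lerD//.
rewrite mulr_natl -[X in _ *+ X]card_ord -sumr_const; apply: ler_sum => i _.
rewrite ltn_ord mul1r ler_nat !signatureE nth_positions_anti//.
exact: ltnW (ltn_ord i).
Qed.

(** Digits at or above the last recorded position are fixed by the signature; those below, the set
    [U], are free. If fewer than [alpha + 1] digits occur in a coordinate, the recorded value is 0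
    and nothing is free there. *)
Lemma card_signature sigma :
  (#|[set k | signature k == sigma]%SET| <= 2 ^ deep_total sigma)%N.
Proof.
have [U UE] : exists U : {set 'I_s * 'I_N}, forall a, (a \in U) = (a.2.+1 < sigma (a.1, ord_max))%N.
  by exists [set a : 'I_s * 'I_N | (a.2.+1 < sigma (a.1, ord_max))%N]%SET => a; rewrite inE.
pose low (k : digits) := [set a in U | k a]%SET.
have low_inj : {in [set k | signature k == sigma]%SET &, injective low}.
  move=> k k'; rewrite !inE => /eqP Ek /eqP Ek' lowE.
  apply/ffunP => -[j b].
  have [bU|bU] := boolP ((j, b) \in U).
    by move/setP/(_ (j, b)): lowE bU; rewrite !inE => + bU; rewrite bU.
  have topE k1 : signature k1 = sigma -> k1 (j, b) = (b \in take alpha.+1 (bits_of k1 j)).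
    move=> E1; apply/idP/idP; last by move=> /mem_take; rewrite mem_bits_of.
    rewrite -mem_bits_of => bk.
    have bs : (index b (bits_of k1 j) < size (bits_of k1 j))%N by rewrite index_mem.
    have [ia|ia] := leqP (index b (bits_of k1 j)) alpha.
      rewrite -[X in X \in _](nth_index l0 bk) -(nth_take l0 (ia : (_ < alpha.+1)%N)).
      by rewrite mem_nth// size_take_min leq_min ltnS ia.
    have H : (nth 0 (positions k1 j) (index b (bits_of k1 j)) < nth 0 (positions k1 j) alpha)%N.
      have tr : transitive gtn by move=> a' b' c' ab bc; exact: ltn_trans bc ab.
      have := sorted_ltn_nth tr 0%N (positions_sorted k1 j) alpha (index b (bits_of k1 j)).
      by rewrite !inE size_map bs (ltn_trans ia bs) => /(_ isT isT ia).
    exfalso; move/negP: bU; apply; rewrite UE/= -E1 signatureE.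
    by move: H; rewrite (nth_map l0)// nth_index.
  by rewrite (topE k Ek) (topE k' Ek') (@signature_take k k' j) ?Ek ?Ek'.
rewrite -(card_in_imset low_inj).
apply: (@leq_trans #|powerset U|).
  apply: subset_leq_card; apply/fintype.subsetP => A /imsetP[k _ ->]; rewrite powersetE.
  by apply/fintype.subsetP => a; rewrite inE => /andP[].
rewrite card_powerset leq_exp2l// /deep_total.
rewrite -sum1_card (eq_bigl (fun a : 'I_s * 'I_N => xpredT a.1 &&
  (a.2.+1 < sigma (a.1, ord_max))%N)); last by move=> a; rewrite UE.
rewrite -(pair_big_dep xpredT (fun (j : 'I_s) (b : 'I_N) => (b.+1 < sigma (j, ord_max))%N)
  (fun _ _ => 1%N))/=.
apply: leq_sum => j _.
have nN : (sigma (j, ord_max) <= N)%N by rewrite -ltnS.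
rewrite -[X in (_ <= X)%N]muln1 -[X in (_ <= X * _)%N]card_ord -sum_nat_const (big_ord_widen N (fun=> 1%N) nN).
rewrite big_mkcond [X in (_ <= X)%N]big_mkcond/=; apply: leq_sum => b _.
by case: ltnP => // /ltnW ->.
Qed.

Lemma powR2_gt1 (e : R) : 0 < e -> 1 < 2 `^ e.
Proof. by move=> e0; rewrite /powR pnatr_eq0/= expR_gt1 mulr_gt0// ln_gt0// ltr1n. Qed.

(** The product over all [s (alpha + 1)] slots of a geometric series of ratio [2^(- nu lambda)].
    Every slot weight is at least [lambda], so this bounds the sum of [2^(- nu T)] over signatures
    uniformly in [N]. *)
Definition geometric_factor (nu : R) : R := (1 - 2 `^ (- (nu * lambda)))^-1 ^+ (s * alpha.+1).

Lemma powR2_lt1 (nu : R) : 0 < nu -> 2 `^ (- (nu * lambda)) < 1.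
Proof.
move=> nu0; have /andP[l0' _] := l01.
by rewrite powRN invf_lt1 ?powR_gt0// powR2_gt1// mulr_gt0.
Qed.

Lemma sum_geometric_le (nu : R) (i : nat) : 0 < nu ->
  \sum_(a < N.+1) 2 `^ (- (nu * (slot_weight i * a%:R))) <= (1 - 2 `^ (- (nu * lambda)))^-1.
Proof.
move=> nu0; have /andP[l0' l1] := l01.
have y1 := powR2_lt1 nu0; set y := 2 `^ (- (nu * lambda)) in y1 *.
have y0 : 0 <= y by exact: powR_ge0.
apply: (@le_trans _ _ (\sum_(a < N.+1) y ^+ a)).
  apply: ler_sum => a _; rewrite /y -powR_mulrn ?powR_ge0// -powRrM.
  apply: ler_powR; first by rewrite ler1n.
  rewrite mulNr lerN2 -mulrA ler_wpM2l ?(ltW nu0)// ler_wpM2r//.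
  by rewrite /slot_weight; case: ifP.
have y1' : 0 < 1 - y by rewrite subr_gt0.
rewrite -[leRHS]mul1r ler_pdivlMr//.
have := subrX1 y N.+1; rewrite mulrC => H.
have -> : (\sum_(a < N.+1) y ^+ a) * (1 - y) = 1 - y ^+ N.+1.
  by rewrite -[1 - y ^+ _]opprB H -mulrN opprB.
by rewrite gerBl exprn_ge0.
Qed.

Lemma geometric_factor_ge0 (nu : R) : 0 < nu -> 0 <= geometric_factor nu.
Proof. by move=> nu0; rewrite exprn_ge0// invr_ge0 subr_ge0 ltW// powR2_lt1. Qed.

Lemma sum_signature_weight (nu : R) : 0 < nu ->
  \sum_sigma 2 `^ (- (nu * smoothness_weight sigma)) <= geometric_factor nu.
Proof.
move=> nu0.
rewrite (eq_bigr (fun sigma : {ffun 'I_s * 'I_alpha.+1 -> 'I_N.+1} =>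
    \prod_(a : 'I_s * 'I_alpha.+1) 2 `^ (- (nu * (slot_weight a.2 * (sigma a)%:R))))); last first.
  by move=> sigma _; rewrite powR2_sum sumrN -mulr_sumr.
rewrite -(bigA_distr_bigA (fun (a : 'I_s * 'I_alpha.+1) (c : 'I_N.+1) =>
   2 `^ (- (nu * (slot_weight a.2 * c%:R))))).
have -> : geometric_factor nu =
    \prod_(a : 'I_s * 'I_alpha.+1) (1 - 2 `^ (- (nu * lambda)))^-1.
  by rewrite prodr_const card_prod !card_ord.
apply: ler_prod => a _; rewrite sum_geometric_le// andbT.
by apply: sumr_ge0 => c _; exact: powR_ge0.
Qed.

(* Chernoff-type bound: a weight [2^(theta (tau - T))] is inserted in the sum. *)
Lemma card_small_weight (nu theta tau : R) : 0 < nu ->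
  theta = nu + (alpha%:R + lambda)^-1 ->
  #|[set k | smoothness_weight (signature k) <= tau]%SET|%:R <=
  2 `^ (theta * tau) * geometric_factor nu :> R.
Proof.
move=> nu0 thE; have /andP[l0' _] := l01.
have al0 : 0 < alpha%:R + lambda by rewrite ltr_wpDl.
have th0 : 0 < theta by rewrite thE addr_gt0// invr_gt0.
rewrite -sum1dep_card natr_sum.
apply: (@le_trans _ _ (\sum_k 2 `^ (theta * tau) *
    2 `^ (- (theta * smoothness_weight (signature k))))).
  rewrite big_mkcond/=; apply: ler_sum => k _; case: ifPn => kt; last first.
    by rewrite mulr_ge0 ?powR_ge0.
  rewrite -powRD; last by rewrite pnatr_eq0 implybT.
  rewrite -mulrBr; apply: (@le_trans _ _ (2 `^ 0)); first by rewrite powRr0.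
  rewrite ler_powR ?ler1n// mulr_ge0 ?(ltW th0)//.
  by rewrite subr_ge0.
rewrite -mulr_sumr ler_wpM2l ?powR_ge0//.
apply: le_trans (sum_signature_weight nu0).
rewrite (partition_big signature xpredT)//=; apply: ler_sum => sigma _.
have [k0 /eqP k0E|H] := pickP (fun k => signature k == sigma); last first.
  by rewrite big_pred0 ?powR_ge0// => k; rewrite H.
rewrite (eq_bigr (fun=> 2 `^ (- (theta * smoothness_weight sigma)))); last first.
  by move=> k /eqP ->.
rewrite sumr_const -[_ *+ _]mulr_natl.
have := card_signature sigma.
rewrite cardsE -(ler_nat R) natrX => H.
apply: le_trans (ler_wpM2r (powR_ge0 _ _) H) _.
rewrite -powR_mulrn// -powRD; last by rewrite pnatr_eq0 implybT.
apply: ler_powR; first by rewrite ler1n.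
(* The part [1 / (alpha + lambda)] of [theta] pays for the size of the class, and the remaining [nu]
   makes the sum over classes converge. *)
have := deep_total_le k0; rewrite k0E.
rewrite -ler_pdivlMl// thE => D.
rewrite mulrDl opprD addrCA gerDl; lra.
Qed.

(** The exponent [2 T] is split into [2 (1 - nu) T], bounded through [T > tau], and [2 nu T], which
    makes the sum over signatures converge. The error [E] is paid once per signature. *)
Lemma sum_large_weight (nu tau B E : R) (c : digits -> R) : 0 < nu < 1 -> 0 <= B -> 0 <= E ->
  (forall k0, \sum_(k | all (k : digits) (bit_list (deep_coords k0) (deep_bit k0) (shallow_bits k0)))
     c k ^+ 2 <= B * (2 `^ (- smoothness_weight (signature k0))) ^+ 2 + E) ->
  \sum_(k | tau < smoothness_weight (signature k)) c k ^+ 2 <=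
  B * 2 `^ (- (2 * (1 - nu) * tau)) * geometric_factor (2 * nu) +
  E * N.+1%:R ^+ (s * alpha.+1).
Proof.
move=> /andP[nu0 nu1] B0 E0 H.
rewrite (partition_big signature xpredT)//=.
have -> : E * N.+1%:R ^+ (s * alpha.+1) =
    \sum_(sigma : {ffun 'I_s * 'I_alpha.+1 -> 'I_N.+1}) E.
  by rewrite sumr_const card_ffun card_prod !card_ord -[RHS]mulr_natl natrX mulrC.
have nu20 : 0 < 2 * nu by rewrite mulr_gt0.
apply: le_trans (lerD (ler_wpM2l _ (sum_signature_weight nu20)) (lexx _)).
  2: by rewrite mulr_ge0 ?powR_ge0.
rewrite mulr_sumr -big_split/=; apply: ler_sum => sigma _.
have R0 : 0 <= B * 2 `^ (- (2 * (1 - nu) * tau)) * 2 `^ (- (2 * nu * smoothness_weight sigma)) + E.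
  by rewrite addr_ge0// !mulr_ge0 ?powR_ge0.
(* The class bound is stated through a member, so a representative is picked; empty classes
   contribute nothing. *)
have [k0 /andP[k0t /eqP k0E]|K0] := pickP (fun k =>
    (tau < smoothness_weight (signature k)) && (signature k == sigma)); last first.
  by rewrite big_pred0// => k; rewrite K0.
apply: (@le_trans _ _ (\sum_(k | all (k : digits)
    (bit_list (deep_coords k0) (deep_bit k0) (shallow_bits k0))) c k ^+ 2)).
  rewrite big_mkcond [leRHS]big_mkcond/=; apply: ler_sum => k _.
  case: ifPn => [/andP[_ /eqP kE]|_]; last by case: ifP => // _; exact: sqr_ge0.
  by rewrite signature_bit_list// kE.
apply: le_trans (H k0) _; rewrite lerD2r -[leRHS]mulrA ler_wpM2l//.
rewrite -powR_mulrn ?powR_ge0// -powRrM -powRD; last by rewrite pnatr_eq0 implybT.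
apply: ler_powR; first by rewrite ler1n.
rewrite k0E in k0t *.
have : (1 - nu) * tau <= (1 - nu) * smoothness_weight sigma.
  by rewrite ler_wpM2l ?subr_ge0// ltW.
by rewrite !mulrBl !mul1r; lra.
Qed.

End signature.

(** * Digital nets *)

Section walsh_net.
Context (R : realType) (J : finType) (m : nat).
Implicit Types (k d : {ffun J -> bool}) (c : {ffun J * 'I_m -> bool}) (b : {ffun 'I_m -> bool}).

Definition linear_bits c b : {ffun J -> bool} :=
  [ffun a => odd (\sum_(q < m) c (a, q) * b q)].

Definition dual_bits c k : {ffun 'I_m -> bool} :=
  [ffun q => odd (\sum_(a : J) k a * c (a, q))].

Lemma sign_odd_sum (I : finType) (F : I -> nat) :
  (-1 : R) ^+ odd (\sum_i F i)%N = \prod_i (-1) ^+ odd (F i).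
Proof.
rewrite signr_odd (big_morph (fun n => (-1 : R) ^+ n) (exprD _) (expr0 _)).
by apply: eq_bigr => i _; rewrite signr_odd.
Qed.

(** Adjointness over the field with two elements: the character of [C b] at [k] is that of [b] at
    the transpose of [C] applied to [k]. *)
Lemma walsh_linear_bits c k b : walsh R k (linear_bits c b) = walsh R (dual_bits c k) b.
Proof.
rewrite /walsh.
transitivity (\prod_(a : J) \prod_(q < m) (-1 : R) ^+ [&& k a, c (a, q) & b q]).
  apply: eq_bigr => a _; rewrite ffunE; case: (k a) => /=.
    by rewrite sign_odd_sum; apply: eq_bigr => q _; rewrite mulnb oddb.
  by rewrite big1.
rewrite exchange_big; apply: eq_bigr => q _; rewrite ffunE.
case: (b q) => /=; last by rewrite andbF expr0 big1// => a _; rewrite !andbF.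
rewrite andbT sign_odd_sum; apply: eq_bigr => a _.
by rewrite andbT mulnb oddb.
Qed.

Definition net_average (F : {ffun J -> bool} -> R) c d : R :=
  (2 ^+ m)^-1 * \sum_(b : {ffun 'I_m -> bool}) F (xor_bits (linear_bits c b) d).

Lemma net_average_walsh F c d :
  net_average F c d =
  \sum_(k | dual_bits c k == zero_bits _) walsh_coef F k * walsh R k d.
Proof.
rewrite /net_average.
under eq_bigr do rewrite (walsh_expansion F).
rewrite exchange_big mulr_sumr [RHS]big_mkcond/=; apply: eq_bigr => k _.
under eq_bigr do rewrite walsh_xorr walsh_linear_bits mulrCA mulrC.
rewrite -mulr_sumr sum_walsh /cells card_ord; case: ifP => _; last by rewrite !mulr0.
by rewrite mulrCA mulVf ?mulr1// expf_neq0.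
Qed.

Lemma dual_bits0 c : dual_bits c (zero_bits J) = zero_bits _.
Proof.
by apply/ffunP => q; rewrite !ffunE big1// => a _; rewrite ffunE mul0n.
Qed.

Lemma walsh_coef_sum (a : {ffun J -> bool} -> R) k :
  walsh_coef (fun x => \sum_l a l * walsh R l x) k = a k.
Proof.
rewrite /walsh_coef; under eq_bigr do rewrite mulr_suml.
rewrite exchange_big/=.
rewrite (eq_bigr (fun l => a l * (if l == k then cells R J else 0))); last first.
  move=> l _; rewrite -sum_walshM mulr_sumr; apply: eq_bigr => x _.
  by rewrite mulrA.
rewrite (bigD1 k)//= eqxx big1 ?addr0; last by move=> l /negbTE ->; rewrite mulr0.
by rewrite mulrCA mulVf ?mulr1// gt_eqF// cells_gt0.
Qed.

(** As a function of the shift, the net average has for Walsh coefficients those of [F] restricted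
    to the dual net. Parseval in the shift variable gives the variance for fixed matrices. *)
Lemma net_average_variance F c :
  (cells R J)^-1 * \sum_d (net_average F c d - walsh_coef F (zero_bits J)) ^+ 2 =
  \sum_(k | (k != zero_bits J) && (dual_bits c k == zero_bits _)) walsh_coef F k ^+ 2.
Proof.
pose a k := if (k != zero_bits J) && (dual_bits c k == zero_bits _) then walsh_coef F k else 0.
have E d : net_average F c d - walsh_coef F (zero_bits J) = \sum_k a k * walsh R k d.
  rewrite net_average_walsh (bigD1 (zero_bits J))/= ?dual_bits0// walsh0 mulr1 addrAC subrr add0r.
  rewrite big_mkcond/=; apply: eq_bigr => k _; rewrite /a andbC.
  by case: ifP => //; rewrite mul0r.
under eq_bigr do rewrite E.
rewrite (parseval (fun d => \sum_k a k * walsh R k d)).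
under eq_bigr do rewrite walsh_coef_sum.
rewrite [RHS]big_mkcond/=; apply: eq_bigr => k _; rewrite /a.
by case: ifP => // _; rewrite expr0n.
Qed.

Lemma walsh_coef_zero F : walsh_coef F (zero_bits J) = (cells R J)^-1 * \sum_x F x.
Proof. by rewrite /walsh_coef; under eq_bigr do rewrite walsh0 mulr1. Qed.

End walsh_net.

(** * Random nets truncated to finitely many digits *)

Section finite_valued.
Context d (T : measurableType d) (R : realType) (P : probability T R).

Definition pr (A : set T) : R := fine (P A).

Lemma prE A : measurable A -> P A = (pr A)%:E.
Proof. by move=> mA; rewrite /pr fineK// fin_num_measure. Qed.

Lemma pr_ge0 A : 0 <= pr A. Proof. exact: fine_ge0. Qed.

Lemma pr_le A B : measurable A -> measurable B -> A `<=` B -> pr A <= pr B.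
Proof.
by move=> mA mB AB; rewrite -lee_fin -!prE//; apply: le_measure; rewrite ?inE.
Qed.

Section finite_value.
Context (I : finType) (V : T -> I).
Hypothesis mV : forall i, measurable (V @^-1` [set i]).

Lemma measurable_finite_value (Q : pred I) : measurable [set w | Q (V w)].
Proof.
rewrite (_ : [set w | _] = \bigcup_(i in [set i | Q i]) (V @^-1` [set i])).
  by apply: fin_bigcup_measurable => //; exact: finite_finset.
apply/seteqP; split => [w Qw|w [i Qi Vw]]; first by exists (V w).
by rewrite /= Vw.
Qed.

Lemma pr_finite_value (Q : pred I) :
  pr [set w | Q (V w)] = \sum_(i | Q i) pr (V @^-1` [set i]).
Proof.
have : forall r : seq I, uniq r ->
    pr [set w | V w \in r] = \sum_(i <- r) pr (V @^-1` [set i]).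
  elim=> [_|i r IH /= /andP[ir ur]].
    by rewrite big_nil /pr (_ : [set _ | _] = set0) ?measure0//; apply/seteqP; split.
  rewrite big_cons -IH//.
  have mr : measurable [set w | V w \in r] by exact: (measurable_finite_value (mem r)).
  have -> : [set w | V w \in i :: r] = (V @^-1` [set i]) `|` [set w | V w \in r].
    apply/seteqP; split => w /=; rewrite in_cons.
      by move=> /orP[/eqP|]; [left|right].
    by move=> [->|->]; rewrite ?eqxx ?orbT.
  apply: EFin_inj; rewrite EFinD -!prE//; last exact: measurableU.
  rewrite measureU//; apply/seteqP; split => w //= [Vw].
  by rewrite Vw (negbTE ir).
move=> /(_ [seq i <- index_enum I | Q i] (filter_uniq _ (index_enum_uniq I))).
rewrite big_filter => <-; congr pr; apply/seteqP; split => w /=;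
  by rewrite mem_filter mem_index_enum andbT.
Qed.

End finite_value.
End finite_valued.

Section truncation.
Context (R : realType) (s m : nat).
Implicit Types (f : 'rV[R]_s -> R).

Lemma limn_binary_series (x : nat -> bool) N :
  \sum_(l < N) (x l)%:R / 2 ^+ l.+1 <= limn (series (fun l => (x l)%:R / 2 ^+ l.+1 : R))
    <= \sum_(l < N) (x l)%:R / 2 ^+ l.+1 + (2 ^+ N)^-1.
Proof.
set u := fun l => (x l)%:R / 2 ^+ l.+1 : R.
have u0 l : 0 <= u l by rewrite divr_ge0 ?exprn_ge0.
have SE n : series u n = \sum_(l < n) u l by rewrite /series/= big_mkord.
have nd : nondecreasing_seq (series u).
  by apply: nondecreasing_series => n _ _; exact: u0.
have tail k : \sum_(l < N + k) u l <= \sum_(l < N) u l + ((2 ^+ N)^-1 - (2 ^+ (N + k))^-1).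
  elim: k => [|k IH]; first by rewrite addn0 subrr addr0.
  rewrite addnS big_ord_recr/=.
  have : u (N + k)%N <= (2 ^+ (N + k).+1)^-1.
    by rewrite /u; case: (x _); rewrite ?mul1r// mul0r invr_ge0 exprn_ge0.
  have : (2 ^+ (N + k))^-1 = (2 ^+ (N + k).+1)^-1 + (2 ^+ (N + k).+1)^-1 :> R.
    by rewrite exprS; field; rewrite expf_neq0.
  lra.
have ub n : series u n <= \sum_(l < N) u l + (2 ^+ N)^-1.
  apply: (@le_trans _ _ (series u (N + n)%N)); first by apply: nd; rewrite leq_addl.
  rewrite SE; apply: le_trans (tail n) _; rewrite lerD2l gerBl invr_ge0 exprn_ge0//.
have cv : cvgn (series u).
  by apply: nondecreasing_is_cvgn => //; exists (\sum_(l < N) u l + (2 ^+ N)^-1) => _ [n _ <-].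
apply/andP; split.
  by rewrite -SE; exact: nondecreasing_cvgn_le.
by apply: limr_le => //; apply: nearW.
Qed.

Definition trunc_matrix N (C : 'I_s -> nat -> 'I_m -> bool) :
    {ffun ('I_s * 'I_N) * 'I_m -> bool} :=
  [ffun a : ('I_s * 'I_N) * 'I_m => C a.1.1 a.1.2 a.2].

Definition trunc_shift N (D : 'I_s -> nat -> bool) : {ffun 'I_s * 'I_N -> bool} :=
  [ffun a : 'I_s * 'I_N => D a.1 a.2].

Lemma net_digit_trunc N C D (b : {ffun 'I_m -> bool}) (a : 'I_s * 'I_N) :
  xor_bits (linear_bits (trunc_matrix N C) b) (trunc_shift N D) a =
  net_digit C D (nat_of_bits b) a.1 a.2.
Proof.
rewrite !ffunE /net_digit oddD oddb; congr (odd _ (+) _).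
by apply: eq_bigr => q _; rewrite ffunE bit_nat_of_bits.
Qed.

Lemma net_point_trunc N C D (b : {ffun 'I_m -> bool}) j :
  grid_pt R (xor_bits (linear_bits (trunc_matrix N C) b) (trunc_shift N D)) ord0 j <=
  net_point R C D (nat_of_bits b) ord0 j <=
  grid_pt R (xor_bits (linear_bits (trunc_matrix N C) b) (trunc_shift N D)) ord0 j + (2 ^+ N)^-1.
Proof.
rewrite !mxE; under eq_bigr do rewrite net_digit_trunc.
exact: (limn_binary_series (net_digit C D (nat_of_bits b) j)).
Qed.

Lemma net_point_cube (C : 'I_s -> nat -> 'I_m -> bool) D (i : nat) : unit_cube (net_point R C D i : 'rV[R]_s).
Proof.
move=> j; rewrite mxE; have := limn_binary_series (net_digit C D i j) 0.
by rewrite big_ord0 add0r expr0 invr1.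
Qed.

Lemma grid_pt_cube N (x : {ffun 'I_s * 'I_N -> bool}) : unit_cube (grid_pt R x).
Proof.
move=> j; have [] := @grid_pt_box R s N [::] x j isT isT.
by rewrite /steps_total big_nil addr0 => -> ->.
Qed.

Lemma net_estimatorE f (C : 'I_s -> nat -> 'I_m -> bool) D :
  net_estimator f C D =
  (2 ^+ m)^-1 * \sum_(b : {ffun 'I_m -> bool}) f (net_point R C D (nat_of_bits b)).
Proof.
rewrite /net_estimator (reindex (@ord_of_bits m))//.
exact/onW_bij/ord_of_bits_bij.
Qed.

(** Deterministic, for each realization: truncation moves each coordinate of each net point by at
    most [2^-N]. *)
Lemma net_estimator_trunc f N (C : 'I_s -> nat -> 'I_m -> bool) D (eta : R) :
  (forall x y, unit_cube x -> unit_cube y ->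
    (forall j, `|x ord0 j - y ord0 j| <= (2 ^+ N)^-1) -> `|f x - f y| <= eta) ->
  `|net_estimator f C D -
    net_average (f \o @grid_pt R s N) (trunc_matrix N C) (trunc_shift N D)| <= eta.
Proof.
move=> fm; rewrite net_estimatorE /net_average -mulrBr -sumrB normrM.
rewrite ger0_norm ?invr_ge0 ?exprn_ge0// -ler_pdivlMl ?invr_gt0 ?exprn_gt0// invrK.
apply: le_trans (ler_norm_sum _ _ _) _.
have -> : 2 ^+ m * eta = \sum_(b : {ffun 'I_m -> bool}) eta.
  by rewrite sumr_const card_ffun card_bool card_ord -[RHS]mulr_natl natrX.
apply: ler_sum => b _; apply: fm.
- exact: net_point_cube.
- exact: grid_pt_cube.
- move=> j; have /andP[a1 a2] := net_point_trunc N C D b j.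
  by rewrite ger0_norm ?subr_ge0// lerBlDl.
Qed.

Lemma sum_vanish (g : nat -> nat) n N : (forall l, (n <= l)%N -> g l = 0%N) ->
  (\sum_(l < n + N) g l = \sum_(l < n) g l)%N.
Proof.
move=> gn; rewrite big_split_ord/= [X in (_ + X)%N]big1 ?addn0// => l _.
by rewrite gn// leq_addr.
Qed.

Lemma net_dual_trunc N (C : 'I_s -> nat -> 'I_m -> bool) (k : {ffun 'I_s * 'I_N -> bool}) :
  net_dual C (fun j => nat_of_bits [ffun l => k (j, l)]) <->
  dual_bits (trunc_matrix N C) k = zero_bits _.
Proof.
have E q : dual_bits (trunc_matrix N C) k q =
    odd (\sum_(j < s) \sum_(l < nat_of_bits [ffun l => k (j, l)])
      bit (nat_of_bits [ffun l => k (j, l)]) l * C j l q)%N.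
  rewrite ffunE; congr odd.
  rewrite (eq_bigr (fun a => k (a.1, a.2) * C a.1 a.2 q)%N); last first.
    by move=> [j l] _; rewrite ffunE.
  rewrite -(pair_bigA _ (fun j l => k (j, l) * C j l q)%N)/=; apply: eq_bigr => j _.
  set n := nat_of_bits _; pose g l := (bit n l * C j l q)%N.
  have -> : (\sum_(l < N) k (j, l) * C j l q = \sum_(l < N) g l)%N.
    by apply: eq_bigr => l _; rewrite /g bit_nat_of_bits ffunE.
  have gn l : (n <= l)%N -> g l = 0%N.
    by move=> nl; rewrite /g bit_small ?mul0n//; apply: leq_ltn_trans nl (ltn_expl _ _).
  have gN l : (N <= l)%N -> g l = 0%N by move=> Nl; rewrite /g /n bit_nat_of_bits_ge.
  (* The definition sums up to [k_j], the truncation up to [N]; both sums equal the one up to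
     [n + N], as the digits vanish beyond either bound. *)
  by rewrite -(sum_vanish n gN) addnC (sum_vanish N gn).
split=> [H|H q].
  by apply/ffunP => q; rewrite E [RHS]ffunE; apply/negbTE; exact: H.
by rewrite -E H ffunE.
Qed.

Lemma nat_of_bits_eq0 N (b : {ffun 'I_N -> bool}) l : b l -> nat_of_bits b <> 0%N.
Proof. by move=> bl b0; have := bit_nat_of_bits b l; rewrite b0 bl /bit div0n. Qed.

End truncation.

Section random_truncation.
Context (R : realType) (s m : nat) d (T : measurableType d) (P : probability T R).
Context (C : T -> 'I_s -> nat -> 'I_m -> bool) (D : T -> 'I_s -> nat -> bool).
Hypothesis net : randomized_net P C D.
Variable N : nat.
Notation J := ('I_s * 'I_N)%type.

Let Cent := fun (x : 'I_s * nat * 'I_m) w => C w x.1.1 x.1.2 x.2.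
Let Dent := fun (x : 'I_s * nat) w => D w x.1 x.2.

Definition trunc_net (w : T) : {ffun J * 'I_m -> bool} * {ffun J -> bool} :=
  (trunc_matrix N (C w), trunc_shift N (D w)).

Lemma trunc_matrix_preimage (c : {ffun J * 'I_m -> bool}) :
  [set w | trunc_matrix N (C w) = c] =
  \bigcap_(a in [set: J * 'I_m]) (Cent (a.1.1, val a.1.2, a.2) @^-1` [set c a]).
Proof.
apply/seteqP; split => [w /= <- a _|w H]; first by rewrite /= ffunE.
by apply/ffunP => a; rewrite ffunE; exact: H.
Qed.

Lemma trunc_shift_preimage (e : {ffun J -> bool}) :
  [set w | trunc_shift N (D w) = e] =
  \bigcap_(a in [set: J]) (Dent (a.1, val a.2) @^-1` [set e a]).
Proof.
apply/seteqP; split => [w /= <- a _|w H]; first by rewrite /= ffunE.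
by apply/ffunP => a; rewrite ffunE; exact: H.
Qed.

Lemma sigma_generated_bigcap d' (T' : measurableType d') (I : Type) (X : I -> T -> T')
    (A : finType) (i : A -> I) (B : A -> set T') : (forall a, measurable (B a)) ->
  sigma_generated X (\bigcap_(a in [set: A]) (X (i a) @^-1` B a)).
Proof.
move=> mB.
pose G := [set A | exists i B, measurable B /\ A = X i @^-1` B].
have H : @measurable _ (g_sigma_algebraType G) (\bigcap_(a in [set: A]) (X (i a) @^-1` B a)).
  apply: fin_bigcap_measurable; first exact: finite_finset.
  by move=> a _; apply: sub_sigma_algebra; exists (i a), (B a).
exact: H.
Qed.

Lemma trunc_net_measurable v : measurable (trunc_net @^-1` [set v]).
Proof.
have [mC mD _ _ _] := net.
have -> : trunc_net @^-1` [set v] = [set w | trunc_matrix N (C w) = v.1] `&`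
    [set w | trunc_shift N (D w) = v.2].
  apply/seteqP; split => w; first by move=> <-.
  by move=> [/= H1 H2]; rewrite /trunc_net H1 H2 -surjective_pairing.
rewrite trunc_matrix_preimage trunc_shift_preimage.
apply: measurableI; apply: fin_bigcap_measurable; try exact: finite_finset.
  by move=> a _; rewrite -[X in measurable X]setTI; exact: mC.
by move=> a _; rewrite -[X in measurable X]setTI; exact: mD.
Qed.

Lemma trunc_matrix_measurable c : measurable [set w | trunc_matrix N (C w) = c].
Proof.
have [mC _ _ _ _] := net; rewrite trunc_matrix_preimage.
apply: fin_bigcap_measurable; first exact: finite_finset.
by move=> a _; rewrite -[X in measurable X]setTI; exact: mC.
Qed.

Lemma pr_trunc_shift (e : {ffun J -> bool}) :
  P [set w | trunc_shift N (D w) = e] = ((cells R J)^-1)%:E.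
Proof.
have [_ mD indep unif _] := net.
pose F : {fset 'I_s * nat} := [fset x | x in [seq (a.1, val a.2) | a : J]]%fset.
have memF x : (x \in F) = (x \in [seq (a.1, val a.2) | a : J]).
  by rewrite inE.
(* Independence is indexed by finite sets of pairs with unbounded second entry, so the pattern [e]
   is extended by [false]. *)
pose b (x : 'I_s * nat) : bool := if insub x.2 is Some l then e (x.1, l) else false.
have bE (a : J) : b (a.1, val a.2) = e a.
  by rewrite /b/= valK -surjective_pairing.
have -> : [set w | trunc_shift N (D w) = e] =
    \bigcap_(x in [set` F]) (Dent x @^-1` [set b x]).
  rewrite trunc_shift_preimage; apply/seteqP; split => w H x.
    by rewrite /= memF => /mapP[a _ ->]; rewrite bE; exact: H.
  move=> _; rewrite -bE; apply: H; rewrite /= memF.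
  by apply/mapP; exists x => //; rewrite mem_enum.
rewrite indep//.
under eq_bigr do rewrite unif.
have -> : (\prod_(x <- F) (2^-1 : R)%:E)%E = (\prod_(x <- F) (2^-1 : R))%:E.
  by rewrite prodEFin.
congr _%:E.
have pF : perm_eq F [seq (a.1, val a.2) | a : J].
  apply: uniq_perm; first exact: fset_uniq.
    rewrite map_inj_uniq ?enum_uniq// => -[j l] [j' l'] /= [-> /val_inj ->]//.
  exact: memF.
rewrite (perm_big _ pF)/= big_map big_enum/= prodr_const /cells -exprVn//.
Qed.

Lemma pr_trunc_net c e :
  pr P (trunc_net @^-1` [set (c, e)]) =
  pr P [set w | trunc_matrix N (C w) = c] * (cells R J)^-1.
Proof.
have [mC mD _ _ ind] := net.
have -> : trunc_net @^-1` [set (c, e)] = [set w | trunc_matrix N (C w) = c] `&`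
    [set w | trunc_shift N (D w) = e].
  apply/seteqP; split => w; first by move=> [<- <-].
  by move=> [/= H1 H2]; rewrite /trunc_net H1 H2.
rewrite /pr ind.
- by rewrite pr_trunc_shift (prE P (trunc_matrix_measurable c)) -EFinM.
- by rewrite trunc_matrix_preimage; exact: sigma_generated_bigcap.
- by rewrite trunc_shift_preimage; exact: sigma_generated_bigcap.
Qed.

(* On the event that no dual vector lies in [K], the conditional variance given the
   matrices is the sum of the squared Walsh coefficients over the dual vectors. *)
Lemma net_average_deviation (F : {ffun J -> bool} -> R) (K : pred {ffun J -> bool})
    (rho Delta : R) : 0 < Delta -> 0 <= rho ->
  (forall k, k != zero_bits J ->
     pr P [set w | dual_bits (trunc_matrix N (C w)) k == zero_bits _] <= rho) ->
  pr P [set w | Delta < `|net_average F (trunc_matrix N (C w)) (trunc_shift N (D w)) -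
                     walsh_coef F (zero_bits J)| ] <=
  rho * (#|[set k | K k]%SET|%:R +
         Delta ^- 2 * \sum_(k | ~~ K k) walsh_coef F k ^+ 2).
Proof.
move=> D0 rho0 Hrho.
pose mu0 := walsh_coef F (zero_bits J).
pose dual (c : {ffun J * 'I_m -> bool}) k :=
  (k != zero_bits J) && (dual_bits c k == zero_bits _).
pose bad c := [exists k, K k && dual c k].
pose pC c := pr P [set w | trunc_matrix N (C w) = c].
have pC0 c : 0 <= pC c by exact: pr_ge0.
have iD0 : 0 <= Delta ^- 2 by rewrite invr_ge0 exprn_ge0// ltW.
have prC (Q : pred {ffun J * 'I_m -> bool}) :
    pr P [set w | Q (trunc_matrix N (C w))] = \sum_(c | Q c) pC c.
  exact: (@pr_finite_value _ _ _ P _ (fun w => trunc_matrix N (C w)) trunc_matrix_measurable Q).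
have prCD (Q : pred ({ffun J * 'I_m -> bool} * {ffun J -> bool})) :
    pr P [set w | Q (trunc_net w)] = \sum_(v | Q v) pC v.1 * (cells R J)^-1.
  rewrite (@pr_finite_value _ _ _ P _ trunc_net trunc_net_measurable Q); apply: eq_bigr => -[c e] _.
  exact: pr_trunc_net.
have dual_le k : \sum_(c | dual c k) pC c <= if k == zero_bits J then 0 else rho.
  case: eqP => [->|/eqP k0]; first by rewrite big_pred0// => c; rewrite /dual eqxx.
  rewrite -prC; apply: le_trans (Hrho k k0); apply: pr_le.
  - exact: (@measurable_finite_value _ _ _ _ trunc_matrix_measurable (fun c => dual c k)).
  - exact: (@measurable_finite_value _ _ _ _ trunc_matrix_measurable
      (fun c => dual_bits c k == zero_bits _)).
  - by move=> w /andP[].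
pose dev (v : {ffun J * 'I_m -> bool} * {ffun J -> bool}) :=
  Delta < `|net_average F v.1 v.2 - mu0|.
rewrite [leLHS](prCD dev).
(* Conditionally on the matrices: a bad matrix is charged its full probability, a good one the
   Chebyshev bound over the uniform shifts. *)
apply: (@le_trans _ _ (\sum_(c : {ffun J * 'I_m -> bool}) pC c *
   ((bad c)%:R + (if bad c then 0 else
      Delta ^- 2 * \sum_(k | dual c k) walsh_coef F k ^+ 2)))).
  rewrite big_mkcond -(pair_bigA _ (fun c e => if dev (c, e) then pC c * (cells R J)^-1 else 0))/=.
  apply: ler_sum => c _.
  have cells_sum : \sum_(e : {ffun J -> bool}) (cells R J)^-1 = 1.
    by rewrite sumr_const -mulr_natl card_bits mulfV// gt_eqF// cells_gt0.
  have ic0 : 0 <= (cells R J)^-1 by rewrite invr_ge0 ltW// cells_gt0.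
  case: ifPn => bc.
    rewrite addr0 mulr1 -[leRHS]mulr1 -cells_sum mulr_sumr; apply: ler_sum => e _.
    by case: ifP => // _; rewrite mulr_ge0.
  rewrite add0r -net_average_variance.
  have -> : pC c * (Delta ^- 2 * ((cells R J)^-1 * \sum_e (net_average F c e - mu0) ^+ 2)) =
      \sum_(e : {ffun J -> bool}) pC c * (cells R J)^-1 *
      (Delta ^- 2 * (net_average F c e - mu0) ^+ 2).
    by rewrite -mulr_sumr -mulr_sumr -mulrA; congr (_ * _); rewrite mulrCA.
  apply: ler_sum => e _; case: ifPn => [|_]; last first.
    by apply: mulr_ge0; [exact: mulr_ge0|apply: mulr_ge0 => //; exact: sqr_ge0].
  rewrite /dev/= => He; rewrite ler_peMr ?mulr_ge0//.
  rewrite mulrC ler_pdivlMr ?exprn_gt0// mul1r -[leRHS]real_normK ?num_real//.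
  by rewrite ler_sqr ?nnegrE ?(ltW D0)// ltW.
under eq_bigr do rewrite mulrDr.
rewrite big_split/= mulrDr; apply: lerD.
  rewrite (eq_bigr (fun c => if bad c then pC c else 0)); last first.
    by move=> c _; case: (bad c); rewrite ?mulr1 ?mulr0.
  (* Union bound over the dual vectors in [K], each dual with probability at most [rho]. *)
  apply: (@le_trans _ _ (\sum_c \sum_(k | K k) if dual c k then pC c else 0)).
    apply: ler_sum => c _; case: ifPn => [/existsP[k /andP[Kk dk]]|_].
      rewrite (bigD1 k)//= dk lerDl; apply: sumr_ge0 => k' _; by case: ifP.
    by apply: sumr_ge0 => k' _; case: ifP.
  rewrite exchange_big/= -sum1dep_card natr_sum mulr_sumr; apply: ler_sum => k _.
  rewrite -big_mkcond mulr1; apply: le_trans (dual_le k) _; case: eqP => // _.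
(* For a good matrix every dual vector lies outside [K]; exchanging the sums then weights each
   squared coefficient by the probability that its vector is dual. *)
apply: (@le_trans _ _ (\sum_c \sum_(k | ~~ K k) if dual c k then
    pC c * (Delta ^- 2 * walsh_coef F k ^+ 2) else 0)).
  apply: ler_sum => c _; case: ifPn => bc.
    rewrite mulr0; apply: sumr_ge0 => k _; case: ifP => // _.
    by apply: mulr_ge0 => //; apply: mulr_ge0 => //; exact: sqr_ge0.
  rewrite !mulr_sumr big_mkcond [leRHS]big_mkcond/=; apply: ler_sum => k _.
  case: ifPn => // dk; case: ifPn => // Kk.
  move/negPn: Kk => Kk.
  by move: bc; rewrite negb_exists => /forallP/(_ k); rewrite dk andbT Kk.
rewrite exchange_big/= mulr_sumr mulr_sumr; apply: ler_sum => k _.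
rewrite -big_mkcond -mulr_suml; apply: ler_wpM2r.
  by apply: mulr_ge0 => //; exact: sqr_ge0.
by apply: le_trans (dual_le k) _; case: eqP.
Qed.

End random_truncation.

(** * Riemann sums *)

Section uniform_continuity.
Context (R : realType) (s : nat).
Implicit Types (f : 'rV[R]_s -> R) (x y : 'rV[R]_s).

Lemma unit_cube_compact : compact (@unit_cube R s).
Proof.
have := @rV_compact R s (fun=> `[0, 1]%classic) (fun=> @segment_compact R 0 1).
by congr compact; apply/seteqP; split => x /= H j; have := H j; rewrite /= in_itv.
Qed.

Lemma unit_cube_bounded f : {within @unit_cube R s, continuous f} ->
  exists2 M, 0 < M & forall x, unit_cube x -> `|f x| <= M.
Proof.
move=> cf; have /compact_bounded[M [Mr H]] := continuous_compact cf unit_cube_compact.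
exists (`|M| + 1) => [|x cx]; first by rewrite ltr_wpDl.
by apply: H; [rewrite (le_lt_trans (ler_norm _))// ltrDl | exists x].
Qed.

(** Uniform continuity by compactness, with the modulus expressed by the grid mesh. Around each [x]
    half of the radius is left for the distance between the two points. *)
Lemma unit_cube_unif_continuous f (eta : R) : {within @unit_cube R s, continuous f} ->
  0 < eta -> \forall N \near \oo, forall x y, unit_cube x -> unit_cube y ->
    (forall j, `|x ord0 j - y ord0 j| <= (2 ^+ N)^-1) -> `|f x - f y| <= eta.
Proof.
move=> cf eta0.
have /compact_near_coveringP/near_covering_withinP cov := unit_cube_compact.
have := cov nat \oo (fun N x => forall y, unit_cube y ->
    (forall j, `|x ord0 j - y ord0 j| <= (2 ^+ N)^-1) -> `|f x - f y| <= eta) _.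
move=> H; have {H} : \forall N \near \oo, @unit_cube R s `<=` (fun x => forall y, unit_cube y ->
    (forall j, `|x ord0 j - y ord0 j| <= (2 ^+ N)^-1) -> `|f x - f y| <= eta).
  apply: H => x cx.
  have /cvgrPdist_lt/(_ (eta / 2)) := (subspace_continuousP _ f).1 cf x cx.
  rewrite divr_gt0// => /(_ isT); rewrite /within/= => /nbhs_ballP[e /= e0 He].
  have e20 : 0 < e / 2 by rewrite divr_gt0.
  exists (ball x (e / 2), [set N | (2 ^+ N)^-1 < e / 2]).
    split => /=; first exact: nbhsx_ballx.
    have := near_infty_natSinv_expn_lt (PosNum e20).
    by apply: filterS => N /=; rewrite div1r.
  move=> [z N] /= [xz Ne] cz y cy zy.
  have xz' : ball x e z by apply: le_ball xz; rewrite ler_pdivrMr// ler_peMr ?(ltW e0)// ler1n.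
  have xy : ball x e y.
    split => // i j; rewrite (ord1 i) -ball_normE/= -(subrKA (z ord0 j)).
    rewrite (le_lt_trans (ler_normD _ _))// (splitr e) ltrD//.
      by have := xz.2 ord0 j; rewrite -ball_normE.
    exact: le_lt_trans (zy j) Ne.
  rewrite -(subrKA (f x)) (le_trans (ler_normD _ _))// (splitr eta).
  rewrite lerD// ltW//; last exact: He xy cy.
  by rewrite distrC; exact: He xz' cz.
by apply: filterS => N H x y cx cy; exact: H.
Qed.

End uniform_continuity.

Section dyadic_cells.
Context (R : realType).
Notation U := (uniform_prob (@ltr01 R)).

(* The last cell contains the end point 1, so that the cells partition [0,1]. *)
Definition dyadic_cell (N : nat) (g : R) : set (measurableTypeR R) :=
  if g + (2 ^+ N)^-1 < 1 then `[g, g + (2 ^+ N)^-1[%classic else `[g, 1]%classic.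

Lemma measurable_dyadic_cell N g : measurable (dyadic_cell N g).
Proof. by rewrite /dyadic_cell; case: ifP => _; exact: measurable_itv. Qed.

Lemma dyadic_cell_dist N g y : 1 - (2 ^+ N)^-1 >= g -> dyadic_cell N g y ->
  `|g - y| <= (2 ^+ N)^-1.
Proof.
by rewrite /dyadic_cell distrC; case: ifP => H gN /=; rewrite in_itv/= => /andP[a b];
  rewrite ger0_norm ?subr_ge0// lerBlDl ?(ltW b)//; lra.
Qed.

Lemma last_dyadic_cell N (c : nat) : (c < 2 ^ N)%N ->
  (c%:R / 2 ^+ N + (2 ^+ N)^-1 < 1 :> R) = (c.+1 < 2 ^ N)%N.
Proof.
move=> cN; rewrite -{2}[(2 ^+ N)^-1]mul1r -mulrDl natr1 ltr_pdivrMr ?exprn_gt0//.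
by rewrite mul1r -natrX ltr_nat.
Qed.

Lemma sum_dyadic_cells N (y : R) :
  \sum_(c < 2 ^ N) \1_(dyadic_cell N (c%:R / 2 ^+ N)) y = ((0 <= y <= 1)%R)%:R :> R.
Proof.
(* Within [y <= 1] each indicator is [h c - h (c + 1)]. The value of [h] at [2^N] is 0 by
   definition, which accounts for the closed last cell and lets the sum telescope to [0 <= y]. *)
pose h (c : nat) : R := ((c < 2 ^ N)%N && (c%:R / 2 ^+ N <= y))%:R.
have n0 : 0 < 2 ^+ N :> R by rewrite exprn_gt0.
have n1 : (0 < 2 ^ N)%N by rewrite expn_gt0.
have E (c : 'I_(2 ^ N)) :
    \1_(dyadic_cell N (c%:R / 2 ^+ N)) y = (y <= 1)%R%:R * (h c - h c.+1).
  have cS : c%:R / 2 ^+ N + (2 ^+ N)^-1 = c.+1%:R / 2 ^+ N :> R.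
    by rewrite -[in RHS]natr1 [RHS]mulrDl [in RHS]mul1r.
  rewrite indicE /dyadic_cell last_dyadic_cell// /h ltn_ord/= cS.
  have c0 : c%:R / 2 ^+ N <= c.+1%:R / 2 ^+ N :> R.
    by rewrite ler_pM2r ?invr_gt0// ler_nat.
  case: ifP => [cN|_]; rewrite mem_setE in_itv/=; last first.
    by rewrite subr0; case: (_ <= y); case: (y <= 1); rewrite ?mulr0 ?mulr1.
  have c1 : c.+1%:R / 2 ^+ N <= 1 :> R.
    by rewrite ler_pdivrMr// mul1r -natrX ler_nat ltnW.
  case: (leP (c.+1%:R / 2 ^+ N) y) => H.
    by rewrite (le_trans c0 H) andbF subrr mulr0.
  by rewrite (le_trans (ltW H) c1) andbT subr0 mul1r.
under eq_bigr do rewrite E.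
rewrite -mulr_sumr -(big_mkord xpredT (fun c => h c - h c.+1)).
rewrite (eq_bigr (fun c => - (h c.+1 - h c))); last by move=> c _; rewrite opprB.
rewrite sumrN telescope_sumr// opprB /h ltnn subr0 n1 mul0r.
by case: (0 <= y); case: (y <= 1); rewrite ?mulr0 ?mulr1.
Qed.

Lemma integral_dyadic_cell N (c : nat) : (c < 2 ^ N)%N ->
  (\int[U]_x (\1_(dyadic_cell N (c%:R / 2 ^+ N)) x)%:E = ((2 ^+ N)^-1)%:E)%E.
Proof.
move=> cN.
have n0 : 0 < 2 ^+ N :> R by rewrite exprn_gt0.
have mC := measurable_dyadic_cell N (c%:R / 2 ^+ N).
have g0 : 0 <= c%:R / 2 ^+ N :> R by rewrite divr_ge0// ltW.
have g1 : c%:R / 2 ^+ N < 1 :> R by rewrite ltr_pdivrMr// mul1r -natrX ltr_nat.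
rewrite integral_uniform//; last first.
  by apply/measurable_EFinP; exact: measurable_indic.
rewrite subr0 invr1 mul1e integral_indic//= setIidl; last first.
  rewrite /dyadic_cell; case: ifP => H y /=; rewrite !in_itv/= => /andP[a b].
    by rewrite (le_trans g0 a) (ltW (lt_trans b H)).
  by rewrite (le_trans g0 a) b.
rewrite /dyadic_cell; case: ifPn => H; rewrite lebesgue_measure_itv/= lte_fin.
  by rewrite ltrDl invr_gt0 n0 -EFinB addrAC subrr add0r.
rewrite g1 -EFinB; congr _%:E.
have : (2 ^ N <= c.+1)%N by rewrite leqNgt -(last_dyadic_cell cN).
move=> {}H; have E1 : c.+1%:R / 2 ^+ N = 1 :> R.
  have <- : (2 ^ N)%N = c.+1 by apply/eqP; rewrite eqn_leq H cN.
  by rewrite natrX mulfV// gt_eqF.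
by rewrite -[X in X - _]E1 -[in LHS]natr1 mulrDl addrAC subrr add0r mul1r.
Qed.

End dyadic_cells.

Section riemann_sums.
Context (R : realType) (s : nat).
Implicit Types (f : 'rV[R]_s -> R) (N : nat) (t : s.-tuple (measurableTypeR R)).

Let cube : set (s.-tuple (measurableTypeR R)) := [set t | unit_cube (row_of_tuple t)].

Definition cell_indic N (x : {ffun 'I_s * 'I_N -> bool}) t : R :=
  \prod_(j < s) \1_(dyadic_cell N (grid_pt R x ord0 j)) (tnth t j).

Lemma cell_indic_ge0 N (x : {ffun 'I_s * 'I_N -> bool}) t : 0 <= cell_indic x t.
Proof. by apply: prodr_ge0 => j _. Qed.

Lemma measurable_cell_indic N (x : {ffun 'I_s * 'I_N -> bool}) :
  measurable_fun setT (cell_indic x).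
Proof.
apply: (measurable_prod_tnth (g := fun j => \1_(dyadic_cell N (grid_pt R x ord0 j)))) => j.
apply: measurable_indic; exact: measurable_dyadic_cell.
Qed.

Lemma grid_ptE N (x : {ffun 'I_s * 'I_N -> bool}) j :
  exists2 c : nat, (c < 2 ^ N)%N & grid_pt R x ord0 j = c%:R / 2 ^+ N.
Proof.
exists (nat_of_bits [ffun l : 'I_N => [ffun l : 'I_N => x (j, l)] (rev_ord l)]).
  exact: nat_of_bits_lt.
rewrite -dyadic_ptE mxE; apply: eq_bigr => l _; by rewrite ffunE.
Qed.

Lemma integral_cell_indic N (x : {ffun 'I_s * 'I_N -> bool}) :
  (\int[cube_measure R s]_t (cell_indic x t)%:E = ((cells R ('I_s * 'I_N)%type)^-1)%:E)%E.
Proof.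
rewrite /cube_measure.
rewrite (@ge0_integral_prob_power _ _ _ (uniform_prob (@ltr01 R)) s
    (fun j => \1_(dyadic_cell N (grid_pt R x ord0 j))))//.
- rewrite (eq_bigr (fun=> ((2 ^+ N)^-1)%:E)); last first.
    by move=> j _; have [c cN ->] := grid_ptE x j; exact: integral_dyadic_cell.
  rewrite prodEFin prodr_const card_ord /cells card_prod !card_ord.
  by rewrite exprVn -exprM mulnC.
- by move=> j; apply: measurable_indic; exact: measurable_dyadic_cell.
Qed.

Lemma sum_cell_indic N t :
  \sum_(x : {ffun 'I_s * 'I_N -> bool}) cell_indic x t = \1_cube t.
Proof.
rewrite (sum_grid_prod N (fun j g => \1_(dyadic_cell N g) (tnth t j))).
under eq_bigr do rewrite sum_dyadic_cells.
rewrite indicE.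
have [tc|tc] := boolP (t \in cube).
  rewrite big1// => j _; move: tc; rewrite inE => /(_ j); rewrite mxE => ->//.
have [j Hj] : exists j, ~~ (0 <= tnth t j <= 1).
  apply/existsP; apply: contraR tc; rewrite negb_exists => /forallP H.
  by rewrite inE => j; rewrite mxE; have := H j; rewrite negbK.
by rewrite (bigD1 j)//= (negbTE Hj) mul0r.
Qed.

Lemma cell_indic_dist N (x : {ffun 'I_s * 'I_N -> bool}) t : cell_indic x t != 0 ->
  forall j, `|grid_pt R x ord0 j - row_of_tuple t ord0 j| <= (2 ^+ N)^-1.
Proof.
move=> /prodf_neq0 H j; rewrite [in X in _ - X]mxE; apply: dyadic_cell_dist.
  have [c cN ->] := grid_ptE x j.
  rewrite lerBrDr -{2}[(2 ^+ N)^-1]mul1r -mulrDl natr1 ler_pdivrMr ?exprn_gt0//.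
  by rewrite mul1r -natrX ler_nat.
have := H j isT; rewrite indicE; case: (boolP (_ \in _)) => [|_]; first by rewrite inE.
by rewrite eqxx.
Qed.

(** The step function whose integral is exactly the grid average of [f], that is, its Walsh
    coefficient at zero. *)
Definition grid_step_fun f N t : R :=
  \sum_(x : {ffun 'I_s * 'I_N -> bool}) f (grid_pt R x) * cell_indic x t.

Lemma measurable_grid_step_fun f N : measurable_fun setT (grid_step_fun f N).
Proof.
apply: measurable_sum => x; apply: measurable_funM => //; exact: measurable_cell_indic.
Qed.

Definition cube_restriction f t : R := \1_cube t * f (row_of_tuple t).

Lemma grid_step_fun_dist f N (eta : R) t : 0 <= eta ->
  (forall x y, unit_cube x -> unit_cube y ->
    (forall j, `|x ord0 j - y ord0 j| <= (2 ^+ N)^-1) -> `|f x - f y| <= eta) ->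
  `|grid_step_fun f N t - cube_restriction f t| <= eta.
Proof.
move=> eta0 H; rewrite /grid_step_fun /cube_restriction -(sum_cell_indic N) mulr_suml -sumrB.
have := sum_cell_indic N t; rewrite indicE; case: (boolP (t \in cube)) => tc S1; last first.
  rewrite big1 ?normr0// => x _.
  have /eqP := S1; rewrite psumr_eq0; last by move=> *; exact: cell_indic_ge0.
  by move=> /allP/(_ x (mem_index_enum _))/eqP ->; rewrite mulr0 mul0r subrr.
rewrite inE in tc.
rewrite (le_trans (ler_norm_sum _ _ _))// -[leRHS]mul1r.
rewrite -[X in _ <= X * _]/(true%:R : R) -S1 mulr_suml; apply: ler_sum => x _.
rewrite [X in X - _]mulrC -mulrBr normrM (ger0_norm (cell_indic_ge0 _ _)).
have [->|w0] := eqVneq (cell_indic x t) 0; first by rewrite !mul0r.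
rewrite ler_wpM2l ?cell_indic_ge0//; apply: H => //; first exact: grid_pt_cube.
exact: cell_indic_dist.
Qed.

(** Continuity is known on row vectors while measurability is needed on tuples; the gap is bridged
    by uniform approximation with step functions. *)
Lemma measurable_cube_restriction f : {within @unit_cube R s, continuous f} ->
  measurable_fun setT (cube_restriction f).
Proof.
move=> cf; apply: (measurable_fun_cvg (fun N => measurable_grid_step_fun f N)) => t _.
apply/cvgrPdist_le => e e0; have := unit_cube_unif_continuous cf e0.
by apply: filterS => N H; rewrite distrC; apply: grid_step_fun_dist => //; exact: ltW.
Qed.

Lemma riemann_sum_dist f N (eta : R) : {within @unit_cube R s, continuous f} -> 0 <= eta ->
  (forall x y, unit_cube x -> unit_cube y ->
    (forall j, `|x ord0 j - y ord0 j| <= (2 ^+ N)^-1) -> `|f x - f y| <= eta) ->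
  `|walsh_coef (f \o @grid_pt R s N) (zero_bits _) - cube_integral f| <= eta.
Proof.
move=> cf eta0 H.
have mS := measurable_grid_step_fun f N.
have mf := measurable_cube_restriction cf.
have bound_integrable (g : s.-tuple (measurableTypeR R) -> R) (M : R) : measurable_fun setT g ->
    (forall t, `|g t| <= M) -> (cube_measure R s).-integrable setT (EFin \o g).
  move=> mg gM; apply: measurable_bounded_integrable => //.
    by rewrite (le_lt_trans (probability_le1 _ _))// ltry.
  exists M; split; first exact: num_real.
  by move=> x Mx t _; rewrite /= (le_trans (gM t))// ltW.
have iw (x : {ffun 'I_s * 'I_N -> bool}) :
    (cube_measure R s).-integrable setT (EFin \o cell_indic x).
  apply: (@bound_integrable _ 1); first exact: measurable_cell_indic.
  move=> t; rewrite ger0_norm ?cell_indic_ge0//; apply: prodr_ile1 => j _.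
  by rewrite indicE; case: (_ \in _); rewrite ?ler01 ?lexx.
have -> : cube_integral f = \int[cube_measure R s]_t cube_restriction f t.
  rewrite /cube_integral Rintegral_mkcond; apply: eq_Rintegral => t _.
  by rewrite /cube_restriction patchE indicE; case: (_ \in _); rewrite ?mul1r ?mul0r.
have -> : walsh_coef (f \o @grid_pt R s N) (zero_bits _) =
    \int[cube_measure R s]_t grid_step_fun f N t.
  rewrite walsh_coef_zero /Rintegral /grid_step_fun.
  under eq_integral do rewrite -sumEFin.
  rewrite integral_sum//; last first.
    move=> x.
    have := integrableZl measurableT (f (grid_pt R x)) (iw x).
    by apply: eq_integrable => // t _; rewrite EFinM.
  rewrite [in RHS](eq_bigr (fun x => (f (grid_pt R x) *
      (cells R ('I_s * 'I_N)%type)^-1)%:E)); last first.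
    move=> x _; under eq_integral do rewrite EFinM.
    by rewrite (integralZl measurableT (iw x))/= integral_cell_indic -EFinM.
  by rewrite sumEFin/= -mulr_suml mulrC.
have [M M0 fM] := unit_cube_bounded cf.
have ir : (cube_measure R s).-integrable setT (EFin \o cube_restriction f).
  apply: (@bound_integrable _ M) => // t; rewrite /cube_restriction indicE.
  case: (boolP (t \in cube)) => tc; last by rewrite mul0r normr0 ltW.
  by rewrite mul1r; apply: fM; rewrite inE in tc.
have iS : (cube_measure R s).-integrable setT (EFin \o grid_step_fun f N).
  apply: (@bound_integrable _ (eta + M)) => // t.
  rewrite -[X in `|X|](subrK (cube_restriction f t)) (le_trans (ler_normD _ _))// lerD//.
    exact: grid_step_fun_dist.
  rewrite /cube_restriction indicE.
  case: (boolP (t \in cube)) => tc; last by rewrite mul0r normr0 ltW.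
  by rewrite mul1r; apply: fM; rewrite inE in tc.
rewrite -RintegralB//.
have ib : (cube_measure R s).-integrable setT
    (EFin \o (fun t => grid_step_fun f N t - cube_restriction f t)).
  apply: (@bound_integrable _ eta); first exact: measurable_funB.
  by move=> t; exact: grid_step_fun_dist.
rewrite (le_trans (le_normr_Rintegral _ _))//.
have : \int[cube_measure R s]_t eta = eta.
  by rewrite Rintegral_cst// [X in fine X](@probability_setT _ _ _ (cube_measure R s))/= mulr1.
move=> <-; apply: le_Rintegral => //.
- apply: (@bound_integrable _ eta).
    by apply: measurableT_comp => //; exact: measurable_funB.
  by move=> t; rewrite normr_id; exact: grid_step_fun_dist.
- apply: (@bound_integrable _ eta) => // t; by rewrite ger0_norm.
- by move=> t _; exact: grid_step_fun_dist.
Qed.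

End riemann_sums.

(** * Concentration of the estimator *)

(** Exponential against polynomial decay: with [g = omega ln 2 / (e + 1)], the bound
    [g1 (N + 1) <= exp (g N)] is raised to the power [e + 1]. Since the base is at most 1, one of
    its two factors may be dropped. *)
Lemma powR_expnV_vanish (R : realType) (omega : R) (e : nat) : 0 < omega ->
  exists2 G : R, 0 < G & forall N : nat,
    ((2 ^ N)%:R^-1 `^ omega) ^+ 2 * N.+1%:R ^+ e <= G / N.+1%:R.
Proof.
move=> o0.
have l2 : 0 < ln 2 :> R by rewrite ln_gt0// ltr1n.
pose g := omega * ln 2 / e.+1%:R.
have g0 : 0 < g by rewrite divr_gt0// mulr_gt0.
pose g1 := Num.min g 1.
have g10 : 0 < g1 by rewrite lt_min g0 ltr01.
exists (g1^-1 ^+ e.+1) => [|N]; first by rewrite exprn_gt0// invr_gt0.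
set h := _ `^ omega.
have hE : h = expR (- (e.+1%:R * (g * N%:R))).
  rewrite /h /powR invr_eq0 pnatr_eq0 expn_eq0/= lnV ?posrE ?ltr0n ?expn_gt0//.
  rewrite natrX lnXn// /g; congr expR; rewrite -mulr_natl.
  by field; rewrite addrC natr1 pnatr_eq0.
have h0 : 0 < h by rewrite hE expR_gt0.
have h1 : h <= 1 by rewrite hE -expR0 ler_expR oppr_le0 !mulr_ge0// ltW.
have NE : g1 * N.+1%:R <= expR (g * N%:R).
  apply: le_trans (expR_ge1Dx _); rewrite -natr1 mulrDr mulr1 addrC lerD//.
    by rewrite ge_min lexx orbT.
  by rewrite ler_wpM2r// ge_min lexx.
have hN : h * N.+1%:R ^+ e.+1 <= g1^-1 ^+ e.+1.
  rewrite hE expRN expRM_natl exprVn -ler_pdivlMl ?invr_gt0 ?exprn_gt0 ?expR_gt0// invrK.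
  rewrite ler_pdivlMr ?exprn_gt0// mulrC -exprMn lerXn2r ?nnegrE ?(ltW (expR_gt0 _))//.
  by rewrite mulr_ge0// ltW.
rewrite ler_pdivlMr// -mulrA -exprSr; apply: le_trans hN.
by rewrite ler_wpM2r// expr2 ler_piMl// ltW.
Qed.

Lemma measurable_deviation d (T : measurableType d) (R : realType) (g : T -> R) (a c : R) :
  measurable_fun setT g -> measurable [set w | c < `|g w - a|].
Proof.
move=> mg; have mh : measurable_fun setT (fun w => `|g w - a|).
  by apply: measurableT_comp => //; exact: measurable_funB.
have -> : [set w | c < `|g w - a|] = (fun w => `|g w - a|) @^-1` `]c, +oo[%classic.
  by apply/seteqP; split => w /=; rewrite in_itv/= andbT.
by rewrite -[X in measurable X]setTI; apply: mh => //; exact: measurable_itv.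
Qed.

Section random_estimator.
Context (R : realType) (s m : nat) (f : 'rV[R]_s -> R).
Context d (T : measurableType d) (P : probability T R).
Context (C : T -> 'I_s -> nat -> 'I_m -> bool) (D : T -> 'I_s -> nat -> bool).
Hypothesis net : randomized_net P C D.
Hypothesis cf : {within @unit_cube R s, continuous f}.

Let est w := net_estimator f (C w) (D w).
Let avg N w := net_average (f \o @grid_pt R s N) (trunc_matrix N (C w)) (trunc_shift N (D w)).

Lemma measurable_trunc_average N : measurable_fun setT (avg N).
Proof.
move=> _ B mB; rewrite setTI.
have -> : avg N @^-1` B =
    [set w | (fun v => `[< B (net_average (f \o @grid_pt R s N) v.1 v.2) >]) (trunc_net C D N w)].
  by apply/seteqP; split => w /= H; apply/asboolP.
exact: (@measurable_finite_value _ _ _ (trunc_net C D N)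
  (trunc_net_measurable net (N := N))
  (fun v => `[< B (net_average (f \o @grid_pt R s N) v.1 v.2) >])).
Qed.

Lemma measurable_net_estimator : measurable_fun setT est.
Proof.
apply: (measurable_fun_cvg measurable_trunc_average) => w _.
apply/cvgrPdist_le => e e0; have := unit_cube_unif_continuous cf e0.
by apply: filterS => N H; exact: net_estimator_trunc.
Qed.

Lemma net_estimator_bound (M : R) w : (forall x, unit_cube x -> `|f x| <= M) -> `|est w| <= M.
Proof.
move=> fM; rewrite /est /net_estimator normrM ger0_norm ?invr_ge0 ?exprn_ge0//.
rewrite ler_pdivrMl ?exprn_gt0//; apply: le_trans (ler_norm_sum _ _ _) _.
have -> : 2 ^+ m * M = \sum_(i < 2 ^ m) M by rewrite sumr_const card_ord -[RHS]mulr_natl natrX.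
by apply: ler_sum => i _; apply: fM; exact: net_point_cube.
Qed.

(** Truncating the net and replacing the integral by the grid average cost [Delta / 2] each. Hence a
    deviation above [2 Delta] forces one above [Delta] in the finite model. *)
Lemma net_estimator_deviation N (K : pred {ffun 'I_s * 'I_N -> bool}) (rho Delta : R) :
  0 < Delta -> 0 <= rho ->
  (forall k : 'I_s -> nat, (exists j, k j <> 0%N) ->
    (P [set w | net_dual (C w) k] <= rho%:E)%E) ->
  (forall x y, unit_cube x -> unit_cube y ->
    (forall j, `|x ord0 j - y ord0 j| <= (2 ^+ N)^-1) -> `|f x - f y| <= Delta / 2) ->
  pr P [set w | 2 * Delta < `|est w - cube_integral f| ] <=
  rho * (#|[set k | K k]%SET|%:R +
    Delta ^- 2 * \sum_(k | ~~ K k) walsh_coef (f \o @grid_pt R s N) k ^+ 2).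
Proof.
move=> D0 rho0 rank H.
pose mu0 := walsh_coef (f \o @grid_pt R s N) (zero_bits _).
have D20 : 0 <= Delta / 2 by rewrite divr_ge0 ?(ltW D0).
apply: le_trans (net_average_deviation net (f \o @grid_pt R s N) K D0 rho0 _); last first.
  move=> k k0.
  have [[j l] kjl] : exists a, k a.
    apply/existsP; apply: contraR k0; rewrite negb_exists => /forallP k0.
    by apply/eqP/ffunP => a; rewrite ffunE; exact/negbTE.
  have := rank (fun j => nat_of_bits [ffun l => k (j, l)]).
  have -> : [set w | net_dual (C w) (fun j => nat_of_bits [ffun l => k (j, l)])] =
      [set w | dual_bits (trunc_matrix N (C w)) k == zero_bits _].
    by apply/seteqP; split => w /=; rewrite net_dual_trunc => /eqP.
  rewrite [X in (X <= _)%E](prE P); last first.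
    exact: (@measurable_finite_value _ _ _ _ (trunc_matrix_measurable net (N := N))
      (fun c => dual_bits c k == zero_bits _)).
  rewrite lee_fin; apply.
  by exists j; apply: (@nat_of_bits_eq0 _ _ l); rewrite ffunE.
apply: pr_le.
- exact: measurable_deviation measurable_net_estimator.
- exact: measurable_deviation (measurable_trunc_average N).
- move=> w /= Hw.
  have e1 := net_estimator_trunc (C w) (D w) H.
  have e2 := riemann_sum_dist cf D20 H.
  rewrite -/(avg N w) -/(est w) -/mu0 in e1 e2 *.
  have E : est w - cube_integral f =
      (est w - avg N w) + (avg N w - mu0) + (mu0 - cube_integral f) by ring.
  rewrite E in Hw.
  have := ler_normD (est w - avg N w + (avg N w - mu0)) (mu0 - cube_integral f).
  have := ler_normD (est w - avg N w) (avg N w - mu0).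
  lra.
Qed.

End random_estimator.

(** The constant is uniform in [tau]; only the range of [N] depends on [tau] and on the tolerance
    [eta], into which the total capping error is absorbed. *)
Lemma walsh_tail_bound (R : realType) (s alpha : nat) (lambda : R) (f : 'rV[R]_s -> R) (nu : R) :
  0 < lambda <= 1 -> finite_sobolev_norm alpha lambda f -> 0 < nu < 1 ->
  exists2 A : R, 0 < A & forall (tau eta : R), 0 < eta -> \forall N \near \oo,
    \sum_(k : {ffun 'I_s * 'I_N -> bool} |
        tau < smoothness_weight lambda (signature alpha k))
      walsh_coef (f \o @grid_pt R s N) k ^+ 2 <=
    A * 2 `^ (- (2 * (1 - nu) * tau)) + eta.
Proof.
move=> l01 hf nu01; have /andP[nu0 nu1] := nu01.
have [C [omega [C0 o0 H]]] := sum_walsh_coef_smooth l01 hf.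
have [G G0 HG] := powR_expnV_vanish (s * alpha.+1) o0.
have nu20 : 0 < 2 * nu by rewrite mulr_gt0.
have g0 := geometric_factor_ge0 s alpha l01 nu20.
exists (8 * C ^+ 2 * geometric_factor s alpha lambda (2 * nu) + 1) => [|tau eta eta0].
  by rewrite ltr_wpDl// !mulr_ge0// ltW.
near=> N.
have N0 : (0 < N)%N by near: N; exact: nbhs_infty_gt.
pose E : R := 4 * (C * (2 ^ N)%:R^-1 `^ omega) ^+ 2.
have E0 : 0 <= E by rewrite mulr_ge0// sqr_ge0.
have B0 : 0 <= 8 * C ^+ 2 by rewrite mulr_ge0// sqr_ge0.
have := @sum_large_weight R s alpha N (Ordinal N0) lambda l01 nu tau (8 * C ^+ 2) E
   (walsh_coef (f \o @grid_pt R s N)) nu01 B0 E0 _.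
have bnd : forall k0 : {ffun 'I_s * 'I_N -> bool},
  \sum_(k : {ffun 'I_s * 'I_N -> bool} | all k (bit_list (deep_coords alpha k0)
       (deep_bit alpha (Ordinal N0) k0) (shallow_bits alpha k0)))
    walsh_coef (f \o @grid_pt R s N) k ^+ 2 <=
  8 * C ^+ 2 * (2 `^ (- smoothness_weight lambda (signature alpha k0))) ^+ 2 + E.
  move=> k0; apply: le_trans (H N _ _ _ (deep_coords_uniq _ _)
    (signature_bit_list_uniq alpha (Ordinal N0) k0) (size_shallow_bits alpha k0)) _.
  by rewrite -[C * _ * _]mulrA prod_steps_signature exprMn mulrA.
move=> /(_ bnd) {bnd}tail; apply: le_trans tail _.
apply: lerD.
  rewrite mulrAC ler_wpM2r ?powR_ge0//; lra.
have EN : E * N.+1%:R ^+ (s * alpha.+1) <= 4 * C ^+ 2 * (G / N.+1%:R).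
  rewrite /E exprMn; move: (HG N); set h := _ `^ omega => hN.
  have -> : 4 * (C ^+ 2 * h ^+ 2) * N.+1%:R ^+ (s * alpha.+1) =
      4 * C ^+ 2 * (h ^+ 2 * N.+1%:R ^+ (s * alpha.+1)) by rewrite !mulrA.
  apply: ler_wpM2l => //.
  by rewrite mulr_ge0// sqr_ge0.
apply: le_trans EN _.
rewrite mulrA ler_pdivrMr// -ler_pdivrMl//.
apply: (@le_trans _ _ N%:R); last by rewrite ler_nat.
by near: N; exact: nbhs_infty_ger.
Unshelve. all: end_near. Qed.

(** With [theta tau] close to [m], the tail decays like [n^(-2 (1 - nu) / theta)]. The hypothesis on
    [nu] keeps the loss against [2 beta] below [epsilon]. *)
Lemma exponent_choice (R : realType) (beta nu epsilon : R) : 0 < beta -> 0 < nu ->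
  0 < epsilon -> nu <= epsilon / (2 * beta * (1 + beta)) ->
  beta - epsilon / 2 <= (1 - nu) / (nu + beta^-1).
Proof.
move=> b0 nu0 e0 nue.
have b1 : 0 < 1 + beta by rewrite addr_gt0.
rewrite ler_pdivlMr ?addr_gt0 ?invr_gt0//.
have -> : (beta - epsilon / 2) * (nu + beta^-1) =
    beta * nu + 1 - epsilon * nu / 2 - epsilon / (2 * beta) by field; rewrite gt_eqF.
have H : nu * (1 + beta) <= epsilon / (2 * beta).
  by rewrite -ler_pdivlMr// -mulrA -invfM.
have : 0 < epsilon * nu by rewrite mulr_gt0.
lra.
Qed.

Lemma net_estimator_concentration (R : realType) (s alpha : nat) (lambda : R)
    (f : 'rV[R]_s -> R) (K epsilon p0 : R) :
  0 < lambda <= 1 -> {within @unit_cube R s, continuous f} ->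
  finite_sobolev_norm alpha lambda f -> 0 < epsilon -> 0 < p0 ->
  exists2 A : R, 0 < A & forall m d (T : measurableType d) (P : probability T R)
      (C : T -> 'I_s -> nat -> 'I_m -> bool) (D : T -> 'I_s -> nat -> bool),
    randomized_net P C D ->
    (forall k : 'I_s -> nat, (exists j, k j <> 0%N) ->
      (P [set w | net_dual (C w) k] <= (2 `^ (K - m%:R))%:E)%E) ->
    exists delta : R, [/\ 0 < delta,
      delta ^+ 2 <= A * (2 ^+ m) `^ (- (2 * alpha%:R) - 2 * lambda - 1 + epsilon) &
      pr P [set w | delta < `|net_estimator f (C w) (D w) - cube_integral f| ] <= p0].
Proof.
move=> l01 cf hf e0 p00; have /andP[l0 l1] := l01.
pose beta : R := alpha%:R + lambda.
have b0 : 0 < beta by rewrite ltr_wpDl.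
pose nu : R := Num.min 2^-1 (epsilon / (2 * beta * (1 + beta))).
have nu0 : 0 < nu.
  by rewrite lt_min invr_gt0 ltr0n divr_gt0// !mulr_gt0// addr_gt0.
have nu1 : nu < 1.
  by rewrite (@le_lt_trans _ _ 2^-1)// ?ge_min ?lexx// invf_lt1 ?ltr1n.
have nu01 : 0 < nu < 1 by rewrite nu0.
pose theta : R := nu + beta^-1.
have th0 : 0 < theta by rewrite addr_gt0// invr_gt0.
have [A1 A10 tail] := walsh_tail_bound l01 hf nu01.
pose G := geometric_factor s alpha lambda nu.
have G0 : 0 <= G by exact: geometric_factor_ge0.
(* The offset [c] depends on the rank constant and on [p0], but not on [m]; it only enters the final
   constant. *)
have [c Hc] : exists c : nat, 2 `^ (K - c%:R) * G <= p0 / 2.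
  pose x := 2 `^ K * G / (p0 / 2).
  have [c _ xc] : \forall c \near \oo, x <= c%:R by exact: nbhs_infty_ger.
  exists c; rewrite powRB ?pnatr_eq0 ?implybT// powR_mulrn// mulrAC ler_pdivrMr ?exprn_gt0//.
  rewrite [leRHS]mulrC -ler_pdivrMr ?divr_gt0//; apply: le_trans (xc c (leqnn c)) _.
  by rewrite -natrX ler_nat ltnW// ltn_expl.
pose kappa : R := 8 * (A1 + 1) / p0.
have k0 : 0 < kappa by rewrite divr_gt0// mulr_gt0// addr_gt0.
exists (kappa * 2 `^ (K + 2 * (1 - nu) / theta * c%:R)) => [|m d T P C D net rank].
  by rewrite mulr_gt0// powR_gt0.
(* [theta tau = m - c], so that the expected number of dual vectors of weight at most
   [tau] is at most [p0 / 2]. *)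
pose tau : R := (m%:R - c%:R) / theta.
pose X : R := 2 `^ (- (2 * (1 - nu) * tau)).
pose rho : R := 2 `^ (K - m%:R).
have X0 : 0 < X by exact: powR_gt0.
have r0 : 0 < rho by exact: powR_gt0.
(* Chosen so that the Chebyshev term equals the other half [p0 / 2]. The factor [A1 + 1] leaves room
   for the tolerance [X] in the tail bound. *)
pose Delta2 : R := 2 * rho * ((A1 + 1) * X) / p0.
have D20 : 0 < Delta2 by rewrite divr_gt0// !mulr_gt0// addr_gt0.
pose Delta : R := Num.sqrt Delta2.
have D0 : 0 < Delta by rewrite sqrtr_gt0.
have DE : Delta ^+ 2 = Delta2 by rewrite sqr_sqrtr// ltW.
exists (2 * Delta); split; first by rewrite mulr_gt0.
  rewrite exprMn DE.
  have -> : 2 ^+ 2 * Delta2 = kappa * (rho * X) by rewrite /Delta2 /kappa; field; rewrite gt_eqF.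
  rewrite -mulrA ler_wpM2l ?(ltW k0)//.
  rewrite /rho /X -powRD ?pnatr_eq0 ?implybT//.
  rewrite -(powR_mulrn m (ler0n R 2)) -powRrM -powRD ?pnatr_eq0 ?implybT//.
  rewrite ler_powR ?ler1n//.
  have nue : nu <= epsilon / (2 * beta * (1 + beta)) by rewrite ge_min lexx orbT.
  have H := exponent_choice b0 nu0 e0 nue; rewrite -/theta in H.
  have {}H : (beta - epsilon / 2) * (2 * m%:R) <= (1 - nu) / theta * (2 * m%:R).
    by rewrite ler_wpM2r// mulr_ge0.
  have -> : K - m%:R + - (2 * (1 - nu) * tau) =
     K + 2 * (1 - nu) / theta * c%:R - m%:R - (1 - nu) / theta * (2 * m%:R).
    by rewrite /tau; field; rewrite gt_eqF.
  rewrite /beta in H; lra.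
near \oo => N.
have N0 : (0 < N)%N by near: N; exact: nbhs_infty_gt.
pose Q (k : {ffun 'I_s * 'I_N -> bool}) := smoothness_weight lambda (signature alpha k) <= tau.
have modul : forall x y, unit_cube x -> unit_cube y ->
    (forall j, `|x ord0 j - y ord0 j| <= (2 ^+ N)^-1) -> `|f x - f y| <= Delta / 2.
  near: N; apply: unit_cube_unif_continuous => //; exact: divr_gt0.
apply: le_trans (net_estimator_deviation net cf Q D0 (ltW r0) rank modul) _.
have card := @card_small_weight R s alpha N (Ordinal N0) lambda l01 nu theta tau nu0 erefl.
have tail_le : \sum_(k | ~~ Q k) walsh_coef (f \o @grid_pt R s N) k ^+ 2 <= (A1 + 1) * X.
  under eq_bigl do rewrite -ltNge.
  rewrite mulrDl mul1r; near: N; exact: tail.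
rewrite mulrDr [leRHS]splitr; apply: lerD.
  apply: le_trans Hc; apply: (le_trans (ler_wpM2l (ltW r0) card)).
  rewrite mulrA -powRD ?pnatr_eq0 ?implybT//.
  by have -> : K - m%:R + theta * tau = K - c%:R by rewrite /tau; field; rewrite gt_eqF.
rewrite DE.
apply: (@le_trans _ _ (rho * (Delta2^-1 * ((A1 + 1) * X)))).
  by rewrite !ler_wpM2l ?invr_ge0 ?(ltW D20) ?(ltW r0).
rewrite le_eqVlt; apply/orP; left; apply/eqP; rewrite /Delta2; field.
by rewrite !gt_eqF// addr_gt0.
Unshelve. all: end_near. Qed.

(** * Medians *)

Section median.
Context (R : realType).
Implicit Types (p : pred R) (t : seq R).

Lemma sorted_nth_count p t k : (forall x y, y <= x -> p x -> p y) ->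
  sorted <=%R t -> (k < size t)%N -> p (nth 0 t k) = (k < count p t)%N.
Proof.
move=> pP st kt; apply/idP/idP => [pk|].
  have : all p (take k.+1 t).
    apply/(all_nthP 0) => i; rewrite size_takel// => ik; rewrite nth_take//.
    by apply: pP pk; apply: (sorted_leq_nth le_trans le_refl 0 st) => //;
      rewrite inE ?(leq_trans ik).
  rewrite all_count size_takel// => /eqP H.
  by rewrite -(cat_take_drop k.+1 t) count_cat H ltnS leq_addr.
apply: contraLR => pk; rewrite -leqNgt -{1}(cat_take_drop k t) count_cat.
have -> : count p (drop k t) = 0%N.
  apply/eqP; rewrite -leqn0 leqNgt -has_count; apply/hasPn => x /(nthP 0)[i].
  rewrite size_drop ltn_subRL => ik <-; rewrite nth_drop.
  apply: contra pk; apply: pP; apply: (sorted_leq_nth le_trans le_refl 0 st);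
    rewrite ?inE ?leq_addr//.
by rewrite addn0 (leq_trans (count_size _ _))// size_take_min geq_minl.
Qed.

(** For a downward closed predicate the sorted list starts with the values satisfying it, so
    statements about the median become counts that ignore the order. *)
Lemma sample_median_count n (x : 'I_n -> R) p : (forall x y, y <= x -> p x -> p y) ->
  (0 < n)%N -> p (sample_median x) = (n./2 < #|[set i | p (x i)]%SET|)%N.
Proof.
move=> pP n0; rewrite /sample_median sorted_nth_count//.
- rewrite count_sort count_map cardsE cardE -size_filter; congr (_ < size _)%N.
  by rewrite enumT.
- exact: sort_le_sorted.
- by rewrite size_sort size_map size_enum_ord -divn2 ltn_Pdiv.
Qed.

(** Of [2 r - 1] values, the median and the [r - 1] values on its far side all deviate in the same
    direction. *)
Lemma sample_median_deviation r (x : 'I_(2 * r).-1 -> R) (a delta : R) : (0 < r)%N ->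
  delta < `|sample_median x - a| -> (r <= #|[set i | (delta < `|x i - a|)%R]%SET|)%N.
Proof.
move=> r0; have n0 : (0 < (2 * r).-1)%N by lia.
have n2 : ((2 * r).-1)./2.+1 = r by lia.
rewrite ltr_normr => /orP[H|H].
  have E := @sample_median_count _ x (fun y => y <= a + delta) (fun y z => @le_trans _ _ _ _ _) n0.
  have {}E : (#|[set i | (x i <= a + delta)%R]%SET| <= ((2 * r).-1)./2)%N.
    by rewrite leqNgt -E -ltNge; lra.
  have := cardsC [set i | (x i <= a + delta)%R]%SET; rewrite card_ord => C.
  apply: (@leq_trans #|~: [set i | (x i <= a + delta)%R]%SET|); first by lia.
  apply/subset_leq_card/fintype.subsetP => i; rewrite !inE -ltNge => Hi.
  by rewrite ltr_normr; apply/orP; left; lra.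
have E := @sample_median_count _ x (fun y => y < a - delta) (fun y z => @le_lt_trans _ _ _ _ _) n0.
apply: (@leq_trans #|[set i | (x i < a - delta)%R]%SET|).
  by rewrite -[X in (X <= _)%N]n2 -E; lra.
apply/subset_leq_card/fintype.subsetP => i; rewrite !inE => Hi.
by rewrite ltr_normr; apply/orP; right; lra.
Qed.

Lemma sample_median_mem n (x : 'I_n -> R) : (0 < n)%N -> exists i, sample_median x = x i.
Proof.
move=> n0; have : sample_median x \in [seq x i | i <- enum 'I_n].
  rewrite -(mem_sort <=%R) mem_nth// size_sort size_map size_enum_ord -divn2.
  by rewrite ltn_Pdiv.
by move=> /mapP[i _ ->]; exists i.
Qed.

End median.

Section median_of_copies.
Context d (T : measurableType d) (R : realType) (Q : probability T R) (n : nat).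
Context (X : 'I_n -> T -> R).
Hypothesis mX : forall i, measurable_fun setT (X i).

Let pattern (B : 'I_n -> set R) (w : T) : {ffun 'I_n -> bool} := [ffun i => `[< B i (X i w) >]].

Lemma pattern_preimage (B : 'I_n -> set R) (v : {ffun 'I_n -> bool}) :
  pattern B @^-1` [set v] =
  \bigcap_(i in [set: 'I_n]) (X i @^-1` (if v i then B i else ~` B i)).
Proof.
apply/seteqP; split => [w /= <- i _|w H].
  by rewrite ffunE/=; case: asboolP.
apply/ffunP => i; rewrite ffunE; have := H i I; rewrite /=.
by case: (v i) => Hi; apply/asboolP.
Qed.

Lemma measurable_pattern (B : 'I_n -> set R) : (forall i, measurable (B i)) ->
  forall v, measurable (pattern B @^-1` [set v]).
Proof.
move=> mB v; rewrite pattern_preimage.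
apply: fin_bigcap_measurable; first exact: finite_finset.
move=> i _; rewrite -[X in measurable X]setTI; apply: mX => //.
by case: (v i) => //; exact: measurableC.
Qed.

Lemma measurable_sample_median : (0 < n)%N ->
  measurable_fun setT (fun w => sample_median (fun i => X i w)).
Proof.
move=> n0; apply: (measurability _ (RGenOInfty.measurableE R)) => _ [_ [c ->] <-].
rewrite setTI.
have mB (i : 'I_n) : measurable (`]-oo, c]%classic : set R) by exact: measurable_itv.
have E w : (sample_median (fun i => X i w) <= c) =
    (n./2 < #|[set i | pattern (fun=> `]-oo, c]%classic) w i]%SET|)%N.
  rewrite (@sample_median_count _ n (fun i => X i w) (fun y => y <= c)
    (fun y z => @le_trans _ _ _ _ _) n0); congr (_ < #|pred_of_set _|)%N.
  by apply/setP => i; rewrite !inE ffunE; apply/idP/asboolP; rewrite /= in_itv.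
have -> : (fun w => sample_median (fun i => X i w)) @^-1` `]c, +oo[ =
    [set w | (#|[set i | pattern (fun=> `]-oo, c]%classic) w i]%SET| <= n./2)%N].
  by apply/seteqP; split => w; rewrite /= in_itv/= andbT ltNge E -leqNgt.
exact: (@measurable_finite_value _ _ _ _ (measurable_pattern mB)
  (fun v => (#|[set i | v i]%SET| <= n./2)%N)).
Qed.

Lemma measurable_pattern_count (B : set R) (r : nat) : measurable B ->
  measurable [set w | (r <= #|[set i | `[< B (X i w) >]]%SET|)%N].
Proof.
move=> mB; rewrite (_ : [set w | _] =
    [set w | (r <= #|[set i | pattern (fun=> B) w i]%SET|)%N]).
  exact: (@measurable_finite_value _ _ _ _ (measurable_pattern (fun=> mB))
    (fun v => (r <= #|[set i | v i]%SET|)%N)).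
apply: eq_set => w; congr (_ <= #|pred_of_set _|)%N.
by apply/setP => i; rewrite !inE ffunE.
Qed.

Hypothesis indep : mutually_independent Q X.

(** A sum over all [2^n] patterns of success and failure replaces binomial estimates; with
    [n = 2 r - 1] this is the source of the factor 4 per power of [p0]. *)
Lemma pr_independent_le (B : set R) (p0 : R) (r : nat) : measurable B -> 0 <= p0 <= 1 ->
  (forall i, pr Q (X i @^-1` B) <= p0) ->
  pr Q [set w | (r <= #|[set i | `[< B (X i w) >]]%SET|)%N] <= 2 ^+ n * p0 ^+ r.
Proof.
move=> mB /andP[p00 p01] HB.
have HV := @pr_finite_value _ _ _ Q _ (pattern (fun=> B)) (measurable_pattern (fun=> mB))
  (fun v => r <= #|[set i | v i]%SET|)%N.
have -> : [set w | (r <= #|[set i | `[< B (X i w) >]]%SET|)%N] =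
    [set w | (r <= #|[set i | pattern (fun=> B) w i]%SET|)%N].
  apply: eq_set => w; congr (_ <= #|pred_of_set _|)%N.
  by apply/setP => i; rewrite !inE ffunE.
rewrite {}HV.
have mBv (v : {ffun 'I_n -> bool}) i : measurable (if v i then B else ~` B).
  by case: (v i) => //; exact: measurableC.
have mXB (v : {ffun 'I_n -> bool}) i : measurable (X i @^-1` (if v i then B else ~` B)).
  by rewrite -[X in measurable X]setTI; exact: mX.
have HV v : pr Q (pattern (fun=> B) @^-1` [set v]) <= p0 ^+ #|[set i | v i]%SET|.
  have -> : pattern (fun=> B) @^-1` [set v] =
      \bigcap_(i in [set` [fset i | i in 'I_n]%fset]) (X i @^-1` (if v i then B else ~` B)).
    rewrite pattern_preimage; apply: eq_bigcapl.
    by split => i // _; rewrite /= inE.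
  rewrite {1}/pr indep//.
  under eq_bigr do rewrite (prE Q (mXB v _)).
  rewrite prodEFin/=.
  rewrite (perm_big (enum 'I_n)); last first.
    apply: uniq_perm; rewrite ?fset_uniq ?enum_uniq// => i.
    by rewrite in_fset mem_enum.
  rewrite big_enum/= -prodr_const [leRHS]big_mkcond/=.
  apply: ler_prod => i _; rewrite pr_ge0/= inE; case: ifP => // vi.
  by have := mXB v i; rewrite vi => mi; rewrite -lee_fin -prE// probability_le1.
apply: (@le_trans _ _ (\sum_(v : {ffun 'I_n -> bool}) p0 ^+ r)); last first.
  by rewrite sumr_const card_ffun card_bool card_ord -[leLHS]mulr_natl natrX.
rewrite [leLHS]big_mkcond; apply: ler_sum => v _; case: ifP => rv; last by rewrite exprn_ge0.
by apply: le_trans (HV v) _; rewrite ler_wiXn2l.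
Qed.

End median_of_copies.
(** Off the deviation event the squared error is at most [delta^2], on it at most [(M + |a|)^2]. The
    bound [M] is only asked almost everywhere because the copies are known only in law. *)
Lemma expectation_sqr_deviation d (T : measurableType d) (R : realType)
    (Q : probability T R) (g : T -> R) (a delta M : R) :
  measurable_fun setT g -> 0 <= delta -> {ae Q, forall w, `|g w| <= M} ->
  ('E_Q[fun w => ((g w - a) ^+ 2)%R] <=
   (delta ^+ 2 + (M + `|a|) ^+ 2 * pr Q [set w | (delta < `|g w - a|)%R])%:E)%E.
Proof.
move=> mg d0 gM.
have mB := measurable_deviation a delta mg.
set B := [set w | _] in mB *.
rewrite unlock.
apply: (@le_trans _ _ (\int[Q]_w (delta ^+ 2 + (M + `|a|) ^+ 2 * \1_B w)%:E)%E).
  apply: ae_ge0_le_integral => //.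
  - by move=> w _; rewrite lee_fin sqr_ge0.
  - by apply/measurable_EFinP; apply: measurable_funX; exact: measurable_funB.
  - by move=> w _; rewrite lee_fin addr_ge0 ?sqr_ge0// mulr_ge0 ?sqr_ge0.
  - apply/measurable_EFinP; apply: measurable_funD => //; apply: measurable_funM => //.
  apply: filterS gM => w gM _; rewrite lee_fin indicE -[leLHS]real_normK ?num_real//.
  case: (boolP (w \in B)) => wB.
    rewrite mulr1 ler_wpDl ?sqr_ge0// lerXn2r ?nnegrE ?addr_ge0//.
      by rewrite (le_trans _ gM).
    by rewrite (le_trans (ler_normB _ _))// lerD2r.
  rewrite mulr0 addr0 lerXn2r ?nnegrE// leNgt; apply: contra wB => H; by rewrite inE.
have := sqr_ge0 delta; have := sqr_ge0 (M + `|a|).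
move: (delta ^+ 2) ((M + `|a|) ^+ 2) => b c c0 b0.
under eq_integral do rewrite EFinD EFinM.
have mI : measurable_fun setT (fun w => (\1_B w)%:E : \bar R).
  by apply/measurable_EFinP; exact: measurable_indic.
rewrite ge0_integralD//.
- rewrite integral_cst// [X in (_ * X)%E](@probability_setT _ _ _ Q) mule1 ge0_integralZl//.
  by rewrite integral_indic// setIT EFinD EFinM -(prE Q mB).
- by move=> w _; rewrite -EFinM lee_fin mulr_ge0.
- by apply: emeasurable_funM.
Qed.

Theorem theorem6 (R : realType) (s alpha : nat) (lambda : R)
    (f : 'rV[R]_s -> R)
    (d : nat -> measure_display) (T : forall m, measurableType (d m))
    (P : forall m, probability (T m) R)
    (C : forall m, T m -> 'I_s -> nat -> 'I_m -> bool)
    (D : forall m, T m -> 'I_s -> nat -> bool)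
    (r : nat -> nat)
    (d' : nat -> measure_display) (T' : forall m, measurableType (d' m))
    (Q : forall m, probability (T' m) R)
    (Y : forall m, 'I_(2 * r m).-1 -> T' m -> R)
    (hs : (0 < s)%N)
    (hlambda : 0 < lambda <= 1)
    (hcont : {within @unit_cube R s, continuous f})
    (hf : finite_sobolev_norm alpha lambda f)
    (hnet : forall m, (0 < m)%N -> randomized_net (P m) (C m) (D m))
    (hrank : asymptotically_full_rank P C)
    (hr : forall m, (0 < m)%N -> (m <= r m)%N)
    (hY : forall m, (0 < m)%N ->
      iid_copies (P m) (fun w => net_estimator f (C m w) (D m w)) (Q m) (Y m))
    (epsilon : R) (hepsilon : 0 < epsilon) :
  exists K : R, \forall m \near \oo,
    ('E_(Q m)[fun w => ((sample_median (fun i => Y m i w) - cube_integral f) ^+ 2)%R]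
     <= (K * (2 ^+ m) `^ (- (2 * alpha%:R) - 2 * lambda - 1 + epsilon))%:E)%E.
Proof.
have /andP[l0 _] := hlambda.
have [K rank] := hrank.
pose e : R := 2 * alpha%:R + 2 * lambda + 1.
have e0 : 0 <= e by rewrite !addr_ge0// mulr_ge0// ltW.
(* Then [4 p0 = 2^(-e)], and the [m]-th power of this is [n^(-e)], the target order without
   [epsilon]. *)
pose p0 : R := 2 `^ (- e) / 4.
have p00 : 0 < p0 by rewrite divr_gt0// powR_gt0.
have p01 : p0 <= 1.
  rewrite ler_pdivrMr// mul1r (@le_trans _ _ 1)//; last by rewrite ler1n.
  by rewrite -[leRHS](powRr0 2) ler_powR ?ler1n// oppr_le0.
have [A A0 conc] := net_estimator_concentration K hlambda hcont hf hepsilon p00.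
have [M M0 fM] := unit_cube_bounded hcont.
set mu := cube_integral f in conc *.
exists (A + (M + `|mu|) ^+ 2); near=> m.
have m0 : (0 < m)%N by near: m; exact: nbhs_infty_gt.
have r0 : (0 < r m)%N by apply: leq_trans (hr m m0).
have n0 : (0 < (2 * r m).-1)%N by lia.
have [mY iY lY] := hY m m0.
have [delta [d0 d2 dp]] := conc m _ _ _ _ _ (hnet m m0) (fun k => rank m k m0).
have mmed := measurable_sample_median mY n0.
have mabs (c b : R) : measurable [set y : R | c < `|y - b|].
  exact: (measurable_deviation b c (@measurable_id _ R setT)).
have bY : {ae Q m, forall w, `|sample_median (fun i => Y m i w)| <= M}.
  (* The estimator is bounded by [M] everywhere, its copies only through equality of laws. The
     written [- 0] puts the event in the form whose measurability is already available. *)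
  have H : {ae Q m, forall w, forall i, `|Y m i w| <= M}.
    apply: filter_forall => i.
    exists (Y m i @^-1` [set y | M < `|y - 0|]); split.
    - by rewrite -[X in measurable X]setTI; exact: mY.
    - rewrite lY// [X in P m X](_ : _ = set0) ?measure0//.
      apply/seteqP; split => // w /=; rewrite subr0 ltNge => /negP; apply.
      exact: net_estimator_bound.
    - by move=> w /= H; rewrite subr0 ltNge; exact/negP.
  by apply: filterS H => w H; have [i ->] := sample_median_mem (fun i => Y m i w) n0.
apply: (le_trans (expectation_sqr_deviation mu mmed (ltW d0) bY)).
rewrite lee_fin mulrDl lerD// ler_wpM2l ?sqr_ge0//.
pose B : set R := [set y | delta < `|y - mu|].
have HB i : pr (Q m) (Y m i @^-1` B) <= p0.
  by rewrite /pr lY; [exact: dp|exact: mabs].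
have p0i : 0 <= p0 <= 1 by rewrite ltW.
apply: le_trans (_ : _ <= 2 ^+ (2 * r m).-1 * p0 ^+ r m) _.
  apply: le_trans (pr_independent_le mY iY (r m) (mabs delta mu) p0i HB).
  apply: pr_le.
  - exact: measurable_deviation mmed.
  - exact: measurable_pattern_count.
  - move=> w /= /(sample_median_deviation r0) H; apply: leq_trans H _.
    apply: subset_leq_card; apply/fintype.subsetP => i; by rewrite !inE.
apply: (@le_trans _ _ ((4 * p0) ^+ r m)).
  rewrite [leRHS]exprMn; apply: ler_wpM2r; first by rewrite exprn_ge0 ?(ltW p00).
  have -> : 4 = 2 ^+ 2 :> R by rewrite expr2; ring.
  by rewrite -exprM ler_eXn2l ?ltr1n// leq_pred.
have -> : 4 * p0 = 2 `^ (- e) by rewrite /p0; field.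
(* Here [r m >= m] is used: the base is at most 1, so lowering the exponent to [m] increases the
   power. *)
apply: (@le_trans _ _ ((2 `^ (- e)) ^+ m)).
  rewrite ler_wiXn2l ?hr// ?powR_ge0//.
  by rewrite -[leRHS](powRr0 2) ler_powR ?ler1n// oppr_le0.
rewrite -powR_mulrn ?powR_ge0// -powRrM mulrC powRrM powR_mulrn//.
rewrite ler_powR//; first by rewrite exprn_ege1// ler1n.
rewrite /e; lra.
Unshelve. all: end_near. Qed.
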